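(* Let $n \geq 1$ and let $f,g \in C^{2}_{buc}(\mathbb{C}^n)$. Then $$\left\| [T_f^{(t)},T_g^{(t)}] - it\,T_{\{f,g\}}^{(t)} \right\| = o(t)$$ as $t \to 0$ ($t>0$), where $\|\cdot\|$ is the operator norm of bounded operators on the Fock space $H^2_t$, $[A,B]=AB-BA$ is the commutator, and $\{f,g\}$ is the Poisson bracket of $f$ and $g$.
   Context: $C^{2}_{buc}(\mathbb{C}^n)$ is the set of functions $f\colon\mathbb{C}^n\to\mathbb{C}$ that are twice continuously differentiable (in the real sense, $\mathbb{C}^n\cong\mathbb{R}^{2n}$) and all of whose partial derivatives up to order $2$ (including order $0$) are bounded and uniformly continuous. The Poisson bracket in complex coordinates is $\{f,g\} = i\sum_{j=1}^n \left(\partial_j f\,\bar\partial_j g - \bar\partial_j f\,\partial_j g\right)$, where $\partial_j = \partial/\partial z_j$ and $\bar\partial_j=\partial/\partial\bar z_j$ are the Wirtinger derivatives. For $t>0$ let $\mathrm{d}\mu_t(z) = \frac{1}{(\pi t)^n} e^{-|z|^2/t}\,\mathrm{d}v(z)$ with $\mathrm{d}v$ the Lebesgue measure on $\mathbb{C}^n$. Let $L^2_t = L^2(\mathbb{C}^n,\mu_t)$ and let the Fock space $H^2_t$ be its closed subspace of entire functions $f$ with $\int_{\mathbb{C}^n}|f|^2\,\mathrm{d}\mu_t<\infty$. Let $P^{(t)}\colon L^2_t\to H^2_t$ be the orthogonal projection, $[P^{(t)}f](z) = \int_{\mathbb{C}^n} f(w) e^{\langle z,w\rangle/t}\,\mathrm{d}\mu_t(w)$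 with $\langle z,w\rangle=\sum_j z_j\bar w_j$. For bounded measurable $f$, the Toeplitz operator is $T_f^{(t)} := P^{(t)}M_f\colon H^2_t\to H^2_t$, where $M_f$ is multiplication by $f$. *)

(* Defs.v *)
From HB Require Import structures.
From mathcomp Require Import all_boot all_order all_algebra.
From mathcomp Require Import all_classical all_reals all_analysis.
From mathcomp Require Import measurable_realfun.
From mathcomp Require Import complex.

Set Implicit Arguments.
Unset Strict Implicit.
Unset Printing Implicit Defensive.
Import Order.TTheory GRing.Theory Num.Theory.
Import numFieldNormedType.Exports.
Local Open Scope classical_set_scope.
Local Open Scope ring_scope.
Local Open Scope complex_scope.

(* C^n is ['rV[R[i]]_n].  The library puts the topology and the norm of a
   numFieldType on the alias [R[i]^o], hence the casts to [R[i]^o] below.  The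
   norm of ['rV[R[i]^o]_n] is the sup norm; it is only used through its
   (uniform) topology, the Euclidean norm being [sqnorm] below. *)

Section Derivatives.
Context (R : realType) (n : nat).
Implicit Types (f g : 'rV[R[i]]_n -> R[i]) (v z : 'rV[R[i]]_n).

(* Directional derivative in the real sense: [s] ranges over the reals. *)
Definition Rderivable v f z : Prop :=
  derivable (fun s : R => complex.Re (f (z + s%:C *: v))) 0 1 /\
  derivable (fun s : R => complex.Im (f (z + s%:C *: v))) 0 1.

Definition Rderive v f z : R[i] :=
  derive1 (fun s : R => complex.Re (f (z + s%:C *: v))) 0 +i*
  derive1 (fun s : R => complex.Im (f (z + s%:C *: v))) 0.

Definition xdir (j : 'I_n) : 'rV[R[i]]_n := delta_mx 0 j.
Definition ydir (j : 'I_n) : 'rV[R[i]]_n := 'i *: delta_mx 0 j.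

(* The 2n coordinate directions of R^{2n}: [dir (j, false)] is the direction
   of Re z_j, [dir (j, true)] that of Im z_j. *)
Definition dir (k : 'I_n * bool) : 'rV[R[i]]_n :=
  if k.2 then ydir k.1 else xdir k.1.

Definition wirtinger (j : 'I_n) f z : R[i] :=
  (Rderive (xdir j) f z - 'i * Rderive (ydir j) f z) / 2.

Definition wirtinger_bar (j : 'I_n) f z : R[i] :=
  (Rderive (xdir j) f z + 'i * Rderive (ydir j) f z) / 2.

Definition poisson f g z : R[i] :=
  'i * \sum_(j < n) (wirtinger j f z * wirtinger_bar j g z
                     - wirtinger_bar j f z * wirtinger j g z).

Definition buc f : Prop :=
  bounded_fun (f : 'rV[R[i]^o]_n -> R[i]^o) /\
  unif_continuous (f : 'rV[R[i]^o]_n -> R[i]^o).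

Definition C2buc f : Prop :=
  [/\ buc f,
      forall k, (forall z, Rderivable (dir k) f z) /\ buc (Rderive (dir k) f) &
      forall k l, (forall z, Rderivable (dir l) (Rderive (dir k) f) z) /\
                  buc (Rderive (dir l) (Rderive (dir k) f)) ].

End Derivatives.

(* Restated here because canonical structure inference does not find the
   library's sigma-finite structure on [m1 \x m2]. *)
Lemma product_sigma_finite d1 d2 (T1 : measurableType d1)
    (T2 : measurableType d2) (R : realType)
    (m1 : {sigma_finite_measure set T1 -> \bar R})
    (m2 : {sigma_finite_measure set T2 -> \bar R}) :
  sigma_finite setT (m1 \x m2)%E.
Proof.
have /sigma_finiteP[F [TF ndF Foo]] := sigma_finiteT m1.
have /sigma_finiteP[G [TG ndG Goo]] := sigma_finiteT m2.
exists (fun n => F n `*` G n).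
  rewrite -setXTT TF TG predeqE => -[x y]; split.
    move=> [/= [n _ Fnx] [k _ Gky]]; exists (maxn n k) => //; split.
    - by move: x Fnx; exact/subsetPset/ndF/leq_maxl.
    - by move: y Gky; exact/subsetPset/ndG/leq_maxr.
  by move=> [n _ []/= ? ?]; split; exists n.
move=> k; have [? ?] := Foo k; have [? ?] := Goo k.
split; first exact: measurableX.
by rewrite product_measure1E// lte_mul_pinfty// ge0_fin_numE.
Qed.

(* The n-fold power of a sigma-finite measure, on n-tuples. *)
Section TuplePower.
Context d (T : measurableType d) (R : realType).
Variable m : {sigma_finite_measure set T -> \bar R}.

Section Step.
Variables (n : nat) (p : {sigma_finite_measure set (n.-tuple T) -> \bar R}).

Definition tcons (x : T * n.-tuple T) : n.+1.-tuple T := [tuple of x.1 :: x.2].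

Lemma measurable_tcons : measurable_fun setT tcons.
Proof. exact: (measurable_cons measurable_fst measurable_snd). Qed.

Definition cons_measure : set (n.+1.-tuple T) -> \bar R :=
  pushforward (m \x p)%E tcons.

Let cons_measure0 : cons_measure set0 = 0%E.
Proof. by rewrite /cons_measure /pushforward preimage_set0 measure0. Qed.

Let cons_measure_ge0 A : (0 <= cons_measure A)%E.
Proof. by rewrite /cons_measure /pushforward measure_ge0. Qed.

Let cons_measure_sigma_additive : semi_sigma_additive cons_measure.
Proof.
move=> F mF tF mUF; rewrite /cons_measure /pushforward preimage_bigcup.
have mt A : measurable A -> measurable (tcons @^-1` A).
  by move=> mA; rewrite -[X in measurable X]setTI; exact: measurable_tcons.
apply: measure_semi_sigma_additive.
- by move=> k; exact: mt.
- apply/trivIsetP => /= i j _ _ ij; rewrite -preimage_setI.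
  by move/trivIsetP : tF => /(_ _ _ _ _ ij) ->//; rewrite preimage_set0.
- by rewrite -preimage_bigcup; exact: mt.
Qed.

HB.instance Definition _ := isMeasure.Build _ _ _ cons_measure
  cons_measure0 cons_measure_ge0 cons_measure_sigma_additive.

Let cons_measure_sigma_finite : sigma_finite setT cons_measure.
Proof.
have [F TF Foo] := product_sigma_finite m p.
pose u (x : n.+1.-tuple T) : T * n.-tuple T :=
  (thead x, [tuple of behead x]).
have uK x : u (tcons x) = x.
  by case: x => a b; congr pair; apply/val_inj.
have mu A : measurable A -> measurable (u @^-1` A).
  move=> mA; rewrite -[X in measurable X]setTI.
  have : measurable_fun setT u.
    apply/measurable_fun_pairP; split.
      exact: measurable_tnth.
    exact: measurable_behead.
  exact.
exists (fun k => u @^-1` F k).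
  by rewrite -preimage_bigcup -TF preimage_setT.
move=> k; have [mFk Fky] := Foo k; split; first exact: mu.
rewrite /cons_measure /pushforward -comp_preimage.
by rewrite (_ : u \o tcons = id)//; apply/funext => x /=; exact: uK.
Qed.

HB.instance Definition _ := Measure_isSigmaFinite.Build _ _ _ cons_measure
  cons_measure_sigma_finite.

End Step.

Fixpoint tuple_power (n : nat) :
    {sigma_finite_measure set (n.-tuple T) -> \bar R} :=
  match n with
  | 0 => (dirac [tuple] : {sigma_finite_measure set _ -> \bar R})
  | k.+1 => (cons_measure (tuple_power k) :
               {sigma_finite_measure set _ -> \bar R})
  end.

End TuplePower.

(* The Borel sigma-algebra and the Lebesgue measure of C^n are transported from
   (R * R)^n along z_j = x_j + i y_j. *)
Section LebesgueC.
Context (R : realType).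

Definition lebesgueC : set (measurableTypeR R * measurableTypeR R) -> \bar R :=
  (@lebesgue_measure R \x @lebesgue_measure R)%E.

HB.instance Definition _ := Measure.on lebesgueC.

HB.instance Definition _ := Measure_isSigmaFinite.Build _ _ _ lebesgueC
  (product_sigma_finite (@lebesgue_measure R) (@lebesgue_measure R)).

End LebesgueC.

Section LebesgueCn.
Context (R : realType) (n : nat).

Definition to_real (z : 'rV[R[i]]_n) : n.-tuple (R * R) :=
  [tuple (complex.Re (z 0 j), complex.Im (z 0 j)) | j < n].

Definition of_real (x : n.-tuple (R * R)) : 'rV[R[i]]_n :=
  \row_j ((tnth x j).1 +i* (tnth x j).2).

Let measurableCn : set (set 'rV[R[i]]_n) :=
  preimage_set_system setT to_real measurable.

Let measurableCnP : sigma_algebra setT measurableCn.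
Proof. exact/sigma_algebra_preimage/sigma_algebra_measurable. Qed.

Let measurableCn0 : measurableCn set0.
Proof. by have [] := measurableCnP. Qed.

Let measurableCnC A : measurableCn A -> measurableCn (~` A).
Proof. by have [_ + _] := measurableCnP; rewrite -setTD; exact. Qed.

Let measurableCn_bigcup (F : (set 'rV[R[i]]_n)^nat) :
  (forall k, measurableCn (F k)) -> measurableCn (\bigcup_k F k).
Proof. by have [_ _] := measurableCnP; exact. Qed.

HB.instance Definition _ := @isMeasurable.Build default_measure_display
  'rV[R[i]^o]_n measurableCn measurableCn0 measurableCnC measurableCn_bigcup.

Lemma measurable_to_real : measurable_fun setT to_real.
Proof. by move=> _ A mA; exists A. Qed.

Lemma of_realK : cancel of_real to_real.
Proof.
move=> x; apply: eq_from_tnth => j; rewrite tnth_mktuple mxE /=.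
by case: (tnth x j).
Qed.

Lemma measurable_of_real : measurable_fun setT of_real.
Proof.
move=> _ _ [A mA <-]; rewrite !setTI -comp_preimage.
by rewrite (_ : to_real \o of_real = id)//; apply/funext => x /=; rewrite of_realK.
Qed.

Definition lebesgueCn : set 'rV[R[i]]_n -> \bar R :=
  pushforward (tuple_power (@lebesgueC R) n) of_real.

Let lebesgueCn0 : lebesgueCn set0 = 0%E.
Proof. by rewrite /lebesgueCn /pushforward preimage_set0 measure0. Qed.

Let lebesgueCn_ge0 A : (0 <= lebesgueCn A)%E.
Proof. by rewrite /lebesgueCn /pushforward measure_ge0. Qed.

Let lebesgueCn_sigma_additive : semi_sigma_additive lebesgueCn.
Proof.
move=> F mF tF mUF; rewrite /lebesgueCn /pushforward preimage_bigcup.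
have mt A : measurable A -> measurable (of_real @^-1` A).
  by move=> mA; rewrite -[X in measurable X]setTI; exact: measurable_of_real.
apply: measure_semi_sigma_additive.
- by move=> k; exact: mt.
- apply/trivIsetP => /= i j _ _ ij; rewrite -preimage_setI.
  by move/trivIsetP : tF => /(_ _ _ _ _ ij) ->//; rewrite preimage_set0.
- by rewrite -preimage_bigcup; exact: mt.
Qed.

HB.instance Definition _ := isMeasure.Build _ _ _ lebesgueCn
  lebesgueCn0 lebesgueCn_ge0 lebesgueCn_sigma_additive.

End LebesgueCn.

Section Gaussian.
Context (R : realType) (n : nat) (t : {posnum R}).

(* |z|^2 for the Euclidean norm of C^n *)
Definition sqnorm (z : 'rV[R[i]]_n) : R :=
  \sum_(j < n) (complex.Re (z 0 j) ^+ 2 + complex.Im (z 0 j) ^+ 2).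

Definition gauss_density (z : 'rV[R[i]]_n) : R :=
  (pi * t%:num) ^- n * expR (- sqnorm z / t%:num).

Lemma gauss_density_ge0 z : 0 <= gauss_density z.
Proof.
by rewrite mulr_ge0 ?expR_ge0// invr_ge0 exprn_ge0// mulr_ge0// pi_ge0.
Qed.

Lemma measurable_gauss_density : measurable_fun setT gauss_density.
Proof.
apply: measurable_funM => //; apply: measurableT_comp => //.
apply: measurable_funM => //; apply: measurableT_comp => //.
have m12 j : measurable_fun setT
    (fun z : 'rV[R[i]]_n => (complex.Re (z 0 j), complex.Im (z 0 j)) : R * R).
  rewrite (_ : (fun z => _) = (@tnth _ (R * R)%type ^~ j) \o @to_real R n).
    apply: measurableT_comp; first exact: measurable_tnth.
    exact: measurable_to_real.
  by apply/funext => z /=; rewrite tnth_mktuple.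
apply: measurable_sum => j.
by apply: measurable_funD; apply: measurable_funX;
  [exact: (measurableT_comp measurable_fst (m12 j))
  |exact: (measurableT_comp measurable_snd (m12 j))].
Qed.

Definition gaussCn : set 'rV[R[i]]_n -> \bar R :=
  fun A => (\int[@lebesgueCn R n]_(z in A) (gauss_density z)%:E)%E.

Let gaussCn0 : gaussCn set0 = 0%E.
Proof. by rewrite /gaussCn integral_set0. Qed.

Let gaussCn_ge0 A : (0 <= gaussCn A)%E.
Proof. by apply: integral_ge0 => z _; rewrite lee_fin gauss_density_ge0. Qed.

Let gaussCn_sigma_additive : semi_sigma_additive gaussCn.
Proof.
move=> /= A mA tA mUA; rewrite /gaussCn ge0_integral_bigcup//=.
- apply: is_cvg_ereal_nneg_natsum_cond => k _ _.
  exact: gaussCn_ge0.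
- apply/measurable_EFinP; apply: measurable_funTS.
  exact: measurable_gauss_density.
- by move=> z _; rewrite lee_fin gauss_density_ge0.
Qed.

HB.instance Definition _ := isMeasure.Build _ _ _ gaussCn
  gaussCn0 gaussCn_ge0 gaussCn_sigma_additive.

End Gaussian.

Section Fock.
Context (R : realType) (n : nat) (t : {posnum R}).
Local Notation Cn := ('rV[R[i]]_n).
Local Notation mu := (@gaussCn R n t).
Implicit Types (f F G h : Cn -> R[i]).

Definition Cintegral F : R[i] :=
  (\int[mu]_z complex.Re (F z)) +i* (\int[mu]_z complex.Im (F z)).

(* The norm of L^2_t; [Normc.normc] is the modulus as an element of [R]. *)
Definition L2norm F : \bar R :=
  ('N[mu]_2%:E[(fun z => (Normc.normc (F z))%:E)])%E.

Definition L2 F : Prop :=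
  [/\ measurable_fun setT (fun z => complex.Re (F z)),
      measurable_fun setT (fun z => complex.Im (F z)) &
      (L2norm F < +oo)%E].

Definition L2inner F G : R[i] := Cintegral (fun z => F z * (G z)^*).

(* Complex (Frechet) differentiability over [R[i]] at every point *)
Definition entire F : Prop :=
  forall z : 'rV[R[i]^o]_n,
    differentiable (F : 'rV[R[i]^o]_n -> R[i]^o) z.

Definition fock : set (Cn -> R[i]) := [set h | entire h /\ L2 h].

Definition is_fock_proj F G : Prop :=
  fock G /\ forall h, fock h -> L2inner (fun z => F z - G z) h = 0.

(* The orthogonal projection of L^2_t onto the Fock space.  An entire function
   is determined by its almost-everywhere class, so [is_fock_proj F G]
   determines [G] pointwise; the default value is irrelevant on L^2_t. *)
Definition fock_proj F : Cn -> R[i] := xget (cst 0) [set G | is_fock_proj F G].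

Definition toeplitz f (h : Cn -> R[i]) : Cn -> R[i] :=
  fock_proj (fun z => f z * h z).

(* Operators on the Fock space are given by their action on functions; the
   operator norm only looks at arguments in the Fock space. *)
Definition opnorm (A : (Cn -> R[i]) -> (Cn -> R[i])) : \bar R :=
  ereal_sup [set L2norm (A h) | h in [set h | fock h /\ (L2norm h <= 1)%E]].

Definition commutator (A B : (Cn -> R[i]) -> (Cn -> R[i])) :
    (Cn -> R[i]) -> (Cn -> R[i]) :=
  fun h z => A (B h) z - B (A h) z.

End Fock.

(* Main.v *)
(* For h in the Fock space put Q_g h = T_g h - g h = P (g h) - g h; by the
   reproducing property it is the integral operator with kernel
   (g(w) - g(z)) e^{<z,w>/t}.  It is orthogonal to the Fock space, so for k in
   the Fock space <f Q_g h, k> = - <Q_g h, Q_{conj f} k>.  Schur's test with the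
   weight e^{|w|^2/2t} bounds a kernel operator by the supremum of its symbol
   against e^{|z-w|^2/4t}; a factor |z - w|^m in the symbol thus costs t^{m/2}.
   Expand g(w) - g(z) to first order at z: the holomorphic part reproduces to 0,
   hence Q_g = sum_j (dbar_j g) R_j + O(t), where R_j has symbol
   conj (w_j - z_j) and is O(sqrt t).  Multiplication by a Lipschitz function
   commutes with R_j up to O(t), and <R_i F, R_j k> = t delta_ij <F, k>.
   Therefore <f Q_g h, k> = - t sum_j <(d_j f)(dbar_j g) h, k> + O(t^{3/2}), and
   subtracting the same with f and g exchanged produces i t {f, g}.  As
   [T_f, T_g] h - i t T_{f,g} h = P (f Q_g h - g Q_f h - i t {f, g} h), testing
   it against itself gives a norm O(t^{3/2}).  The reproducing property is the
   mean value property of entire functions for rotation invariant weights, which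
   is derived from Goursat's theorem. *)

From HB Require Import structures.
Require Import Defs.
From mathcomp Require Import all_boot all_order all_algebra.
From mathcomp Require Import all_classical all_reals all_analysis.
From mathcomp Require Import measurable_realfun complex ring lra.

Set Implicit Arguments.
Unset Strict Implicit.
Unset Printing Implicit Defensive.
Import Order.TTheory GRing.Theory Num.Theory.
Import numFieldNormedType.Exports.
Local Open Scope classical_set_scope.
Local Open Scope ring_scope.
Local Open Scope complex_scope.

(** The exponents in Schur's test come from completing the square: the modulus of the kernel, the
    allowance e^{|z-w|^2/4t}, the weight and the Gaussian density multiply to e^{|z|^2/2t} times a
    Gaussian of parameter 4t centred at z. The resulting bound 4^n does not depend on t; half of the
    decay in |z-w| is spent on the unbounded symbols. Expanding T_f T_g directly would bring in
    second order terms of the symbols. A pairing of two defects is already quadratic in first order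
    quantities, so a first order expansion with quadratic remainder is enough, and bounded second
    derivatives give it. An obstacle is that conj(w_j) h need not be square integrable for h in the
    Fock space. Such products are handled in a larger class, [nice], stable under multiplication by
    coordinates and kernels. The kernel integrals are shown to be finite at every point, so that no
    null sets have to be tracked. *)

Local Notation Re := complex.Re.
Local Notation Im := complex.Im.
Local Notation normc := Normc.normc.

(** * Complex numbers and the exponential *)

Section ComplexNorm.
Context (R : realType).
Implicit Types (z w : R[i]) (x y a b : R).

Lemma complex_eqP z w : Re z = Re w -> Im z = Im w -> z = w.
Proof. by case: z w => [? ?] [? ?] /= -> ->. Qed.

Lemma ReD z w : Re (z + w) = Re z + Re w. Proof. by case: z w => [? ?] []. Qed.
Lemma ImD z w : Im (z + w) = Im z + Im w. Proof. by case: z w => [? ?] []. Qed.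
Lemma ReN z : Re (- z) = - Re z. Proof. by case: z. Qed.
Lemma ImN z : Im (- z) = - Im z. Proof. by case: z. Qed.
Lemma ReM z w : Re (z * w) = Re z * Re w - Im z * Im w.
Proof. by case: z w => [? ?] []. Qed.
Lemma ImM z w : Im (z * w) = Re z * Im w + Im z * Re w.
Proof. by case: z w => [? ?] []. Qed.
Lemma ReJ z : Re z^* = Re z. Proof. by case: z. Qed.
Lemma ImJ z : Im z^* = - Im z. Proof. by case: z. Qed.
Definition ReImE := (ReD, ImD, ReN, ImN, ReM, ImM, ReJ, ImJ).

Lemma normcE z : normc z = Num.sqrt (Re z ^+ 2 + Im z ^+ 2).
Proof. by case: z. Qed.

Lemma normc_ge0 z : 0 <= normc z.
Proof. by rewrite normcE sqrtr_ge0. Qed.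

Lemma normc_sqr z : normc z ^+ 2 = Re z ^+ 2 + Im z ^+ 2.
Proof. by rewrite normcE sqr_sqrtr// addr_ge0// sqr_ge0. Qed.

Lemma normr_normc z : `|z| = (normc z)%:C.
Proof. by rewrite normcE normc_def. Qed.

Lemma normc_real x : normc x%:C = `|x|.
Proof. by rewrite normcE /= expr0n addr0 sqrtr_sqr. Qed.

Lemma normcJ z : normc z^* = normc z.
Proof. by rewrite !normcE ReJ ImJ sqrrN. Qed.

Lemma normc_i : normc 'i%C = 1 :> R.
Proof. by rewrite normcE /= expr0n expr1n add0r sqrtr1. Qed.

Lemma normr_Re z : `|Re z| <= normc z.
Proof. by rewrite normcE -sqrtr_sqr ler_sqrt ?lerDl ?addr_ge0// sqr_ge0. Qed.

Lemma normr_Im z : `|Im z| <= normc z.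
Proof. by rewrite normcE -sqrtr_sqr ler_sqrt ?lerDr ?addr_ge0// sqr_ge0. Qed.

Lemma normc_ReIm z : normc z <= `|Re z| + `|Im z|.
Proof.
rewrite [z in normc z]complexE (le_trans (le_normcD _ _))//.
by rewrite Normc.normcM normc_i mul1r !normc_real.
Qed.

Lemma mulcJ z : z * z^* = (normc z ^+ 2)%:C.
Proof. by rewrite normc_sqr; apply: complex_eqP; rewrite !ReImE /=; ring. Qed.

Lemma le_normcB z w : normc (z - w) <= normc z + normc w.
Proof. by rewrite (le_trans (le_normcD _ _))// normcN. Qed.

Lemma le_normc_sum I (r : seq I) P (F : I -> R[i]) :
  normc (\sum_(i <- r | P i) F i) <= \sum_(i <- r | P i) normc (F i).
Proof.
elim/big_rec2: _ => [|i a b _ h]; first by rewrite Normc.normc0.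
by rewrite (le_trans (le_normcD _ _))// lerD2l.
Qed.

End ComplexNorm.

Section ComplexExp.
Context (R : realType).
Implicit Types (z w : R[i]) (x y a b : R).

Definition cexp z : R[i] :=
  (expR (Re z) * cos (Im z)) +i* (expR (Re z) * sin (Im z)).

Lemma Re_cexp z : Re (cexp z) = expR (Re z) * cos (Im z).
Proof. by []. Qed.

Lemma Im_cexp z : Im (cexp z) = expR (Re z) * sin (Im z).
Proof. by []. Qed.

Lemma cexp0 : cexp 0 = 1.
Proof.
by apply: complex_eqP; rewrite ?(Re_cexp, Im_cexp)/= expR0 ?cos0 ?sin0 ?mul1r.
Qed.

Lemma cexpD z w : cexp (z + w) = cexp z * cexp w.
Proof.
apply: complex_eqP; rewrite ?(Re_cexp, Im_cexp) !ReImE !(Re_cexp, Im_cexp).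
  by rewrite expRD cosD; ring.
by rewrite expRD sinD; ring.
Qed.

Lemma normc_cexp z : normc (cexp z) = expR (Re z).
Proof.
rewrite normcE Re_cexp Im_cexp !exprMn -mulrDr cos2Dsin2 mulr1 sqrtr_sqr.
by rewrite ger0_norm// expR_ge0.
Qed.

Lemma cexpJ z : (cexp z)^* = cexp z^*.
Proof.
by apply: complex_eqP; rewrite ?ReImE !(Re_cexp, Im_cexp) !ReImE ?cosN ?sinN ?mulrN.
Qed.

Lemma cexp_real x : cexp x%:C = (expR x)%:C.
Proof.
by apply: complex_eqP; rewrite ?(Re_cexp, Im_cexp)/= ?cos0 ?sin0 ?mulr1 ?mulr0.
Qed.

(** Both signs come from e^x >= 1 + x, used at [a] and at [- a]; the latter, multiplied by e^a, is
    the upper bound [h3]. *)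
Lemma expR_sub1_le a : `|expR a - 1| <= `|a| * expR `|a|.
Proof.
have h1 := expR_ge1Dx a; have h2 := expR_ge1Dx (- a).
have e0 := expR_gt0 a.
have h3 : expR a - 1 <= a * expR a.
  move: h2; rewrite expRN -(ler_pM2r e0) mulVf ?gt_eqF//; lra.
have [a0|a0] := lerP 0 a.
  rewrite (ger0_norm a0) ger0_norm//; lra.
have : expR a < 1 by rewrite expR_lt1.
have : 1 <= expR (- a) by rewrite (le_trans _ h2)//; lra.
by move=> h5 h4; rewrite (ltr0_norm a0) ltr0_norm ?subr_lt0//; nra.
Qed.

Lemma expR_sub1D_le a : `|expR a - 1 - a| <= a ^+ 2 * expR `|a|.
Proof.
have h1 := expR_ge1Dx a; have h2 := expR_ge1Dx (- a).
have e0 := expR_gt0 a.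
have h3 : expR a - 1 <= a * expR a.
  move: h2; rewrite expRN -(ler_pM2r e0) mulVf ?gt_eqF//; lra.
rewrite ger0_norm; last lra.
rewrite (@le_trans _ _ (a * (expR a - 1)))//; first lra.
rewrite (le_trans (ler_norm _))// normrM (le_trans (ler_wpM2l _ (expR_sub1_le a)))//.
by rewrite mulrA -expr2 real_normK ?num_real.
Qed.

Lemma normr_sin_le b : `|sin b| <= `|b|.
Proof.
wlog b0 : b / 0 <= b.
  move=> h; have [/h//|/ltW b0] := lerP 0 b.
  by rewrite -normrN -sinN -[leRHS]normrN h// oppr_ge0.
have [->|bn0] := eqVneq b 0; first by rewrite sin0.
have b0' : 0 < b by rewrite lt_neqAle eq_sym bn0.
have [|c _ e] := @MVT R sin cos 0 b b0' (fun x _ => is_derive_sin x).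
  by apply: continuous_subspaceT; exact: continuous_sin.
move: e; rewrite sin0 !subr0 => ->; rewrite normrM ler_piMl//.
by rewrite ler_norml cos_geN1 cos_le1.
Qed.

Lemma cos_sub1E b : 1 - cos b = 2 * sin (b / 2) ^+ 2.
Proof.
have {1}-> : b = b / 2 + b / 2 by field.
by rewrite cosD -!expr2; have := cos2Dsin2 (b / 2); lra.
Qed.

Lemma cos_sub1_le b : `|cos b - 1| <= b ^+ 2.
Proof.
rewrite distrC cos_sub1E normrM normrX ger0_norm//.
have h : `|sin (b / 2)| ^+ 2 <= `|b / 2| ^+ 2.
  by rewrite ler_pXn2r ?nnegrE//; exact: normr_sin_le.
by move: h; rewrite (real_normK (num_real (b / 2))); have := sqr_ge0 b; nra.
Qed.

Lemma cos_sub1_le1 b : `|cos b - 1| <= `|b|.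
Proof.
rewrite distrC cos_sub1E normrM normrX [`|2|]ger0_norm//.
have h := normr_sin_le (b / 2).
have h1 : `|sin (b / 2)| <= 1 by rewrite ler_norml sin_geN1 sin_le1.
have h0 := normr_ge0 (sin (b / 2)).
by move: h; rewrite normrM (@ger0_norm _ 2^-1)//; nra.
Qed.

(** Mean value theorem: the derivative cos - 1 is at most |c| by [cos_sub1_le1]. A quadratic bound
    suffices for [cexp_taylor]. *)
Lemma sin_sub_le b : `|sin b - b| <= b ^+ 2.
Proof.
wlog b0 : b / 0 <= b.
  move=> h; have [/h//|/ltW b0] := lerP 0 b.
  by rewrite -normrN opprB addrC -sinN -sqrrN -[X in _ + X]opprK h// oppr_ge0.
have [->|bn0] := eqVneq b 0; first by rewrite sin0 subrr normr0 sqr_ge0.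
have b0' : 0 < b by rewrite lt_neqAle eq_sym bn0.
have dsin x : is_derive x 1 (fun x => sin x - x) (cos x - 1) by exact: is_deriveB.
have [|c /andP[c0 cb] e] := @MVT R _ _ 0 b b0' (fun x _ => dsin x).
  apply: continuous_subspaceT => x; apply: cvgB; first exact: continuous_sin.
  exact: cvg_id.
move: e; rewrite sin0 !subr0 => ->; rewrite normrM expr2.
rewrite (ger0_norm b0) ler_wpM2r// (le_trans (cos_sub1_le1 _))//.
by move: c0 cb; rewrite !bnd_simp => c0 cb; rewrite ger0_norm ltW.
Qed.

(** The 3 is 1 from the real part plus 2 from the imaginary part. The bound serves twice: for the
    complex derivative of [cexp], and for differentiating a Bergman integral under the integral
    sign. *)
Lemma cexp_taylor z :
  normc (cexp z - 1 - z) <= 3 * normc z ^+ 2 * expR (normc z).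
Proof.
set a := Re z; set b := Im z.
have ea : expR `|a| <= expR (normc z) by rewrite ler_expR normr_Re.
have a1 : 1 + `|a| <= expR `|a| by exact: expR_ge1Dx.
have a0 := normr_ge0 a.
have hRe : `|Re (cexp z - 1 - z)| <= (a ^+ 2 + b ^+ 2) * expR (normc z).
  rewrite !ReImE Re_cexp /= -/a -/b.
  have -> : expR a * cos b + -1 + - a = (expR a - 1 - a) * cos b + (1 + a) * (cos b - 1).
    by ring.
  rewrite (le_trans (ler_normD _ _))// !normrM.
  have c1 : `|cos b| <= 1 by rewrite ler_norml cos_geN1 cos_le1.
  have h1 := expR_sub1D_le a; have h2 := cos_sub1_le b.
  have h3 : `|1 + a| <= expR `|a|.
    by rewrite (le_trans _ a1)// (le_trans (ler_normD _ _))// normr1.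
  have p1 : `|expR a - 1 - a| * `|cos b| <= a ^+ 2 * expR (normc z).
    by rewrite -[leRHS]mulr1 ler_pM// (le_trans h1)// ler_wpM2l// sqr_ge0.
  have p2 : `|1 + a| * `|cos b - 1| <= expR (normc z) * b ^+ 2.
    by rewrite ler_pM// (le_trans h3).
  by rewrite mulrDl (mulrC (b ^+ 2)) lerD.
have hIm : `|Im (cexp z - 1 - z)| <= 2 * (a ^+ 2 + b ^+ 2) * expR (normc z).
  rewrite !ReImE Im_cexp /= -/a -/b.
  have -> : expR a * sin b + - 0 + - b = (expR a - 1) * sin b + (sin b - b).
    by ring.
  rewrite (le_trans (ler_normD _ _))// !normrM.
  have h1 := expR_sub1_le a; have h2 := sin_sub_le b; have h3 := normr_sin_le b.
  have p1 : `|expR a - 1| * `|sin b| <= `|a| * expR (normc z) * `|b|.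
    by rewrite ler_pM// (le_trans h1)// ler_wpM2l.
  have p2 : `|a| * `|b| <= a ^+ 2 + b ^+ 2.
    rewrite -(real_normK (num_real a)) -(real_normK (num_real b)).
    by have := sqr_ge0 (`|a| - `|b|); have := sqr_ge0 (`|a| + `|b|); nra.
  have e1 : 1 <= expR (normc z) by lra.
  have b20 := sqr_ge0 b; have a20 := sqr_ge0 a.
  nra.
rewrite (le_trans (normc_ReIm _))// normc_sqr.
lra.
Qed.

End ComplexExp.

(** * Goursat's theorem on rectangles *)

Section SegmentIntegral.
Context (R : realType).
Local Notation leb := (@lebesgue_measure R).
Implicit Types (f g : R -> R) (a b : R).

Lemma continuous_integrable_segment f a b : continuous f ->
  leb.-integrable `[a, b] (EFin \o f).
Proof.
move=> cf; apply: continuous_compact_integrable; first exact: segment_compact.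
exact: continuous_subspaceT.
Qed.

Lemma Rintegral_segment_split f a m b : continuous f -> a <= m -> m <= b ->
  \int[leb]_(x in `[a, b]) f x =
  \int[leb]_(x in `[a, m]) f x + \int[leb]_(x in `[m, b]) f x.
Proof.
move=> cf am mb; have := @Rintegral_itvB R f (BLeft a) (BRight b) m.
move=> /(_ (continuous_integrable_segment a b cf)).
rewrite !bnd_simp => /(_ am mb) h.
rewrite -(@Rintegral_itv_obnd_cbnd R m (BRight b)); last first.
  apply: integrableS (continuous_integrable_segment m b cf) => //.
  by move=> x /=; rewrite !in_itv/= => /andP[/ltW-> ->].
by rewrite -h addrC subrK.
Qed.

Lemma Rintegral_segmentB f g a b : continuous f -> continuous g ->
  \int[leb]_(x in `[a, b]) (f x - g x) =
  \int[leb]_(x in `[a, b]) f x - \int[leb]_(x in `[a, b]) g x.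
Proof.
move=> cf cg; have i1 := @continuous_integrable_segment f a b cf.
have i2 := @continuous_integrable_segment g a b cg.
exact: RintegralB.
Qed.

Lemma Rintegral_segment_bound f a b lo hi : continuous f -> a <= b ->
  (forall x, a <= x <= b -> lo <= f x <= hi) ->
  lo * (b - a) <= \int[leb]_(x in `[a, b]) f x <= hi * (b - a).
Proof.
move=> cf ab h.
have icst r : \int[leb]_(x in `[a, b]) r = r * (b - a).
  rewrite Rintegral_cst//= lebesgue_measure_itv/= lte_fin.
  by case: ltP => // ba; rewrite (@le_anti _ _ a b) ?ab// subrr.
have int_cst r : leb.-integrable `[a, b] (EFin \o cst r).
  by apply: continuous_integrable_segment => x; exact: cvg_cst.
apply/andP; split; rewrite -icst; apply: le_Rintegral => //;
  by [exact: continuous_integrable_segment|exact: int_cst|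
      move=> x /=; rewrite in_itv/= => /h/andP[]].
Qed.

End SegmentIntegral.

Section Bisection.
Context (R : realType).
Variable Q : R -> R -> R -> R -> R.
Hypothesis Qx : forall a m b c d, a <= m -> m <= b -> c <= d ->
  Q a b c d = Q a m c d + Q m b c d.
Hypothesis Qy : forall a b c m d, a <= b -> c <= m -> m <= d ->
  Q a b c d = Q a b c m + Q a b m d.
Hypothesis Qsmall : forall (x0 y0 e : R), 0 < e -> exists2 dl : R, 0 < dl &
  forall a b c d, a <= x0 <= b -> c <= y0 <= d -> b - a <= dl -> d - c <= dl ->
    `|Q a b c d| <= e * ((b - a) + (d - c)) ^+ 2.

Lemma quadrants a c (u v e : R) : 0 <= u -> 0 <= v ->
  `|Q a (a + u) c (c + v)| <= e -> `|Q (a + u) (a + u + u) c (c + v)| <= e ->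
  `|Q a (a + u) (c + v) (c + v + v)| <= e ->
  `|Q (a + u) (a + u + u) (c + v) (c + v + v)| <= e ->
  `|Q a (a + u + u) c (c + v + v)| <= 4 * e.
Proof.
move=> u0 v0.
have h (b l : R) : 0 <= l -> b <= b + l by move=> ?; rewrite lerDl.
have a1 := h a u u0; have a2 := h (a + u) u u0.
have c1 := h c v v0; have c2 := h (c + v) v v0.
rewrite (Qx a1 a2 (le_trans c1 c2)) (Qy a1 c1 c2) (Qy a2 c1 c2).
move: (Q a _ c _) (Q a _ (c + v) _) (Q (a + u) _ c _) (Q (a + u) _ (c + v) _) => q1 q2 q3 q4.
by clear -R; rewrite !ler_norml; lra.
Qed.

(** If |Q| exceeds e on a rectangle, it exceeds e / 4 on one of the quarters. Iterating gives nested
    rectangles, whose common point (x0, y0) contradicts [Qsmall]: the sides halve at each stage, so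
    a multiple of the squared half-perimeter also shrinks by 4. *)
Lemma bisection a b c d : a <= b -> c <= d -> Q a b c d = 0.
Proof.
move=> ab cd; apply/eqP; rewrite -normr_le0; apply/ler_addgt0Pl => e e0.
rewrite addr0.
pose L := b - a; pose H := d - c.
pose w k (l : R) : R := l / 2 ^+ k.
(* A rectangle of stage [k] is encoded by its lower left corner [s]; its sides are [w k L] and
   [w k H]. *)
pose P k (s : R * R) :=
  e / 4 ^+ k < `|Q s.1 (s.1 + w k L) s.2 (s.2 + w k H)|.
have w0 k l : 0 <= l -> 0 <= w k l by move=> l0; rewrite divr_ge0// exprn_ge0.
have wS k l : w k l = w k.+1 l + w k.+1 l.
  by rewrite /w exprS; field; rewrite expf_neq0.
have L0 : 0 <= L by rewrite subr_ge0.
have H0 : 0 <= H by rewrite subr_ge0.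
rewrite leNgt; apply/negP => eP.
pose sub k (s s' : R * R) := [/\ s.1 <= s'.1, s'.1 + w k.+1 L <= s.1 + w k L,
  s.2 <= s'.2 & s'.2 + w k.+1 H <= s.2 + w k H].
have step k s : P k s -> exists2 s', P k.+1 s' & sub k s s'.
  move=> Pks; apply: contrapT => nP.
  have le s' : sub k s s' -> `|Q s'.1 (s'.1 + w k.+1 L) s'.2 (s'.2 + w k.+1 H)| <= e / 4 ^+ k.+1.
    by move=> ss'; rewrite leNgt; apply/negP => Ps'; apply: nP; exists s'.
  have wL := w0 k.+1 L L0; have wH := w0 k.+1 H H0.
  have {}le i j : 0 <= i <= w k.+1 L -> 0 <= j <= w k.+1 H ->
      `|Q (s.1 + i) (s.1 + i + w k.+1 L) (s.2 + j) (s.2 + j + w k.+1 H)| <= e / 4 ^+ k.+1.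
    move=> /andP[i0 iL] /andP[j0 jH]; apply: (le (s.1 + i, s.2 + j)).
    by split; rewrite /= ?lerDl// -addrA lerD2l (wS k) lerD2r.
  move: Pks; rewrite /P; apply/negP; rewrite -leNgt (wS k L) (wS k H) !addrA.
  have -> : e / 4 ^+ k = 4 * (e / 4 ^+ k.+1).
    by rewrite exprS; field; rewrite expf_neq0.
  have lL : 0 <= w k.+1 L <= w k.+1 L by rewrite wL lexx.
  have lH : 0 <= w k.+1 H <= w k.+1 H by rewrite wH lexx.
  have l0 (l : R) : 0 <= l -> (0 : R) <= 0 <= l by rewrite lexx.
  apply: quadrants => //.
  - by have := le 0 0 (l0 _ wL) (l0 _ wH); rewrite !addr0.
  - by have := le _ 0 lL (l0 _ wH); rewrite !addr0.
  - by have := le 0 _ (l0 _ wL) lH; rewrite !addr0.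
  - exact: le.
(* The stage is stored with the corner, so that a single type carries all stages and dependent
   choice applies. *)
pose X := {ks : nat * (R * R) | P ks.1 ks.2}.
have P0 : P 0%N (a, c).
  by rewrite /P /w /= !expr0 !divr1 !subrKC.
have [f [f0 fS]] : {f : nat -> X | f 0%N = exist _ (0%N, (a, c)) P0 /\
    forall n, (val (f n.+1)).1 = (val (f n)).1.+1 /\
      sub (val (f n)).1 (val (f n)).2 (val (f n.+1)).2}.
  apply: (@dependent_choice X (fun u v => (val v).1 = (val u).1.+1 /\
    sub (val u).1 (val u).2 (val v).2)) => -[[k s] Pks].
  apply: cid; have [s' Ps' ss'] := step _ _ Pks.
  by exists (exist _ (k.+1, s') Ps').
have f1 n : (val (f n)).1 = n.
  by elim: n => [|n ih]; [rewrite f0|rewrite (fS n).1 ih].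
pose s n := (val (f n)).2.
have Ps n : P n (s n) by have := valP (f n); rewrite f1.
have sS n : sub n (s n) (s n.+1) by have := (fS n).2; rewrite f1.
have mono m n : (m <= n)%N -> [/\ (s m).1 <= (s n).1,
    (s n).1 + w n L <= (s m).1 + w m L,
    (s m).2 <= (s n).2 & (s n).2 + w n H <= (s m).2 + w m H].
  move/subnK => <-; elim: (n - m)%N => [|j [i1 i2 i3 i4]]; first by split.
  have [j1 j2 j3 j4] := sS (j + m)%N.
  by rewrite addSn; split; [exact: le_trans j1|exact: le_trans i2|
    exact: le_trans j3|exact: le_trans i4].
(* Lower endpoints increase and upper endpoints decrease, so the supremum of the lower ones lies in
   every interval. *)
have lim (g : nat -> R) l : 0 <= l ->
    (forall m n, (m <= n)%N -> g m <= g n /\ g n + w n l <= g m + w m l) ->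
    exists x, forall n, g n <= x <= g n + w n l.
  move=> l0 gm; exists (sup (range g)) => n.
  have ub m : ubound (range g) (g m + w m l).
    move=> _ [j _ <-]; have [mj|jm] := leqP m j.
      by rewrite (le_trans _ (gm _ _ mj).2)// lerDl w0.
    by rewrite (le_trans (gm _ _ (ltnW jm)).1)// lerDl w0.
  apply/andP; split.
    by apply: ub_le_sup; [exists (g 0%N + w 0%N l); exact: ub|exists n].
  by apply: sup_le_ub; [exists (g 0%N); exists 0%N|exact: ub].
have [x0 hx0] := lim (fun n => (s n).1) L L0 (fun m n mn =>
  let: And4 i j _ _ := mono m n mn in conj i j).
have [y0 hy0] := lim (fun n => (s n).2) H H0 (fun m n mn =>
  let: And4 _ _ i j := mono m n mn in conj i j).
(* The 1 keeps [S] positive for a degenerate rectangle. With tolerance [e / S ^+ 2] the bound at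
   stage [k] is at most [e / 4 ^+ k]. *)
pose S := L + H + 1.
have S0 : 0 < S by rewrite ltr_wpDl// addr_ge0.
have [dl dl0 hd] := @Qsmall x0 y0 (e / S ^+ 2) ltac:(by rewrite divr_gt0// exprn_gt0).
have [k hk] : exists k, S / 2 ^+ k <= dl.
  have [k hk] : exists k : nat, S / dl <= k%:R.
    exists (Num.bound (S / dl)); apply/ltW/archi_boundP.
    by rewrite divr_ge0// ltW.
  exists k; rewrite ler_pdivrMr ?exprn_gt0// -ler_pdivrMl// mulrC (le_trans hk)//.
  by rewrite -natrX ler_nat ltnW// ltn_expl.
have wk l : l <= S -> w k l <= dl.
  by move=> lS; rewrite (le_trans _ hk)// ler_pM2r// invr_gt0 exprn_gt0.
have wLk : w k L <= dl by rewrite wk// /S -addrA lerDl addr_ge0.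
have wHk : w k H <= dl by rewrite wk// /S addrAC lerDr addr_ge0.
have := Ps k; rewrite /P ltNge => /negP; apply.
have sub0 (u v : R) : u + v - u = v by rewrite addrAC subrr add0r.
apply: (le_trans (hd _ _ _ _ (hx0 k) (hy0 k) _ _)); rewrite !sub0//.
have -> : w k L + w k H = (L + H) / 2 ^+ k by rewrite /w -mulrDl.
have -> : 4 ^+ k = 2 ^+ k * 2 ^+ k :> R by rewrite -exprMn -natrM.
have k0 : 0 < 2 ^+ k :> R by rewrite exprn_gt0.
rewrite [leLHS](_ : _ = e / (2 ^+ k * 2 ^+ k) * ((L + H) ^+ 2 / S ^+ 2)); last first.
  by field; rewrite !gt_eqF.
rewrite ler_piMr ?divr_ge0 ?mulr_ge0 ?(ltW e0) ?(ltW k0)//.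
rewrite ler_pdivrMr ?exprn_gt0// mul1r ler_pXn2r ?nnegrE ?(ltW S0) ?(addr_ge0 L0 H0)//.
by rewrite /S lerDl.
Qed.

End Bisection.

Section Goursat.
Context (R : realType).
Local Notation leb := (@lebesgue_measure R).
Variables A B : R -> R -> R.
Hypothesis contA : forall c, continuous (A ^~ c).
Hypothesis contB : forall b, continuous (B b).
Hypothesis closedAB : forall x0 y0 : R, exists p q r : R, forall e : R, 0 < e ->
  exists2 d : R, 0 < d & forall x y : R, `|x - x0| <= d -> `|y - y0| <= d ->
    `|A x y - (A x0 y0 + p * (x - x0) + q * (y - y0))|
       <= e * (`|x - x0| + `|y - y0|) /\
    `|B x y - (B x0 y0 + q * (x - x0) + r * (y - y0))|
       <= e * (`|x - x0| + `|y - y0|).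

(** The integral of the form A dx + B dy around the rectangle, counterclockwise. The coefficient [q]
    shared by both expansions in [closedAB] says that A_y = B_x at the point: the form is closed
    pointwise, as in Goursat's theorem. *)
Definition circulation a b c d : R :=
  \int[leb]_(x in `[a, b]) (A x c - A x d) +
  \int[leb]_(y in `[c, d]) (B b y - B a y).

Let contAB c d : continuous (fun x => A x c - A x d).
Proof. by move=> x; apply: cvgB; exact: contA. Qed.

Let contBB b a : continuous (fun y => B b y - B a y).
Proof. by move=> x; apply: cvgB; exact: contB. Qed.

Lemma circulation_splitx a m b c d : a <= m -> m <= b -> c <= d ->
  circulation a b c d = circulation a m c d + circulation m b c d.
Proof.
move=> am mb cd; rewrite /circulation (Rintegral_segment_split _ am mb)//.
rewrite addrACA; congr +%R; rewrite -RintegralD//=;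
  try exact: continuous_integrable_segment.
by apply: eq_Rintegral => y _; rewrite [RHS]addrC subrKA.
Qed.

Lemma circulation_splity a b c m d : a <= b -> c <= m -> m <= d ->
  circulation a b c d = circulation a b c m + circulation a b m d.
Proof.
move=> ab cm md; rewrite /circulation (@Rintegral_segment_split _ _ c m d)//.
rewrite addrACA; congr +%R; rewrite -RintegralD//=;
  try exact: continuous_integrable_segment.
by apply: eq_Rintegral => y _; rewrite subrKA.
Qed.

(** The affine approximation of the form is closed: its terms in [q] cancel between the two pairs of
    sides. What remains is an error of at most [e] along each of the four sides. *)
Lemma circulation_small a b c d x0 y0 p q r e : a <= x0 <= b -> c <= y0 <= d ->
  0 <= e ->
  (forall x y, a <= x <= b -> c <= y <= d ->
    `|A x y - (A x0 y0 + p * (x - x0) + q * (y - y0))| <= e /\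
    `|B x y - (B x0 y0 + q * (x - x0) + r * (y - y0))| <= e) ->
  `|circulation a b c d| <= 2 * e * ((b - a) + (d - c)).
Proof.
move=> /andP[ax xb] /andP[cy yd] e0 h.
have ab := le_trans ax xb; have cd := le_trans cy yd.
have /andP[] : (q * (c - d) - 2 * e) * (b - a) <=
    \int[leb]_(x in `[a, b]) (A x c - A x d) <= (q * (c - d) + 2 * e) * (b - a).
  apply: Rintegral_segment_bound => // x axb.
  have [+ _] := h x c axb ltac:(by rewrite lexx).
  have [+ _] := h x d axb ltac:(by rewrite lexx andbT).
  by rewrite !ler_norml; clear -R; lra.
have /andP[] : (q * (b - a) - 2 * e) * (d - c) <=
    \int[leb]_(y in `[c, d]) (B b y - B a y) <= (q * (b - a) + 2 * e) * (d - c).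
  apply: Rintegral_segment_bound => // y cyd.
  have [_ +] := h a y ltac:(by rewrite lexx) cyd.
  have [_ +] := h b y ltac:(by rewrite lexx andbT) cyd.
  by rewrite !ler_norml; clear -R; lra.
rewrite /circulation; move: (Rintegral _ _ _) (Rintegral _ _ _) => I J.
by rewrite ler_norml => *; apply/andP; split; nra.
Qed.

Lemma circulation0 a b c d : a <= b -> c <= d -> circulation a b c d = 0.
Proof.
apply: (bisection circulation_splitx circulation_splity) => x0 y0 e e0.
have [p [q [r h]]] := closedAB x0 y0.
(* Half of [e] absorbs the factor 2 of [circulation_small]. *)
have [dl dl0 hd] := h (e / 2) ltac:(by rewrite divr_gt0).
exists dl => // {}a {}b {}c {}d /andP[ax xb] /andP[cy yd] abd cdd.
have ab := le_trans ax xb; have cd := le_trans cy yd.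
rewrite [leRHS](_ : _ = 2 * (e / 2 * ((b - a) + (d - c))) * ((b - a) + (d - c))); last by field.
have e2 : 0 <= e / 2 by rewrite ltW// divr_gt0.
apply: (@circulation_small _ _ _ _ x0 y0 p q r) => //; rewrite ?ax ?cy//.
  by apply: (mulr_ge0 e2 (addr_ge0 _ _)); rewrite subr_ge0.
move=> x y /andP[x1 x2] /andP[y1 y2].
have hx : `|x - x0| <= b - a by rewrite ler_norml; clear -R ax xb x1 x2; lra.
have hy : `|y - y0| <= d - c by rewrite ler_norml; clear -R cy yd y1 y2; lra.
have [h1 h2] := hd x y (le_trans hx abd) (le_trans hy cdd).
by split; [apply: le_trans h1 _|apply: le_trans h2 _]; rewrite ler_wpM2l// lerD.
Qed.

End Goursat.

(** * Holomorphic functions of one variable and their means on circles *)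

Section HoloCircle.
Context (R : realType).
Local Notation leb := (@lebesgue_measure R).

Definition holo (phi : R[i] -> R[i]) : Prop :=
  forall a, differentiable (phi : R[i]^o -> R[i]^o) a.

Lemma normc_ltC (h : R[i]) (d : R) : (`|h| < d%:C) = (normc h < d).
Proof. by rewrite normr_normc ltcR. Qed.

Lemma differentiable_epsilon (phi : R[i] -> R[i]) a :
  differentiable (phi : R[i]^o -> R[i]^o) a ->
  exists c : R[i], forall e : R, 0 < e -> exists2 d : R, 0 < d &
    forall h, normc h < d -> normc (phi (a + h) - phi a - c * h) <= e * normc h.
Proof.
move=> /derivable1_diffP dphi; pose c := 'D_1 (phi : R[i]^o -> R[i]^o) a.
exists c => e e0.
have : h^-1 *: ((phi (h *: 1 + a) : R[i]^o) - phi a) @[h --> (0 : R[i]^o)^'] --> (c : R[i]^o).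
  exact: dphi.
move=> /cvgrPdist_le /(_ e%:C); rewrite ltcR => /(_ e0).
rewrite near_withinE => /nbhs_ballP[/= d d0 hd].
exists (Re d); first by move: d0; rewrite ltcE => /andP[].
have dE : d = (Re d)%:C.
  by move: d0; rewrite ltcE => /andP[/eqP di _]; apply: complex_eqP => //=; rewrite -di.
move=> h hlt; have [->|h0] := eqVneq h 0.
  by rewrite addr0 subrr mulr0 subrr Normc.normc0 mulr0.
have := hd h; rewrite -ball_normE /= sub0r normrN dE normc_ltC => /(_ hlt h0).
rewrite normr_normc lecR => k.
have -> : phi (a + h) - phi a - c * h =
   - ((c - h^-1 * (phi (h + a) - phi a)) * h).
  by rewrite [a + h]addrC; field.
rewrite normcN Normc.normcM ler_wpM2r ?normc_ge0//.
by move: k; rewrite /GRing.scale/= mulr1.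
Qed.

Lemma epsilon_differentiable (phi : R[i] -> R[i]) (a : R[i]^o) (c : R[i]) :
  (forall e : R, 0 < e -> exists2 d : R, 0 < d &
    forall h, normc h < d -> normc (phi (a + h) - phi a - c * h) <= e * normc h) ->
  differentiable (phi : R[i]^o -> R[i]^o) a.
Proof.
move=> H; apply/derivable1_diffP.
suff : h^-1 *: ((phi (h *: 1 + a) : R[i]^o) - phi a) @[h --> (0 : R[i]^o)^'] --> (c : R[i]^o).
  by move=> /cvgP.
apply/cvgrPdist_le => e; rewrite ltcE => /andP[/eqP e1 e2].
have eE : e = (Re e)%:C by apply: complex_eqP => //=; rewrite -e1.
have [d d0 hd] := H _ e2.
rewrite near_withinE; apply/nbhs_ballP; exists d%:C => /=; first by rewrite ltcR.
move=> h; rewrite -ball_normE /= sub0r normrN normc_ltC => hlt h0.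
rewrite normr_normc eE lecR.
have hp : 0 < normc h.
  rewrite lt_neqAle normc_ge0 andbT eq_sym; apply/eqP => /Normc.eq0_normc h'.
  by rewrite h' eqxx in h0.
rewrite -(ler_pM2r hp) -Normc.normcM.
have -> : (c - h^-1 *: (phi (h *: 1 + a) - phi a)) * h = - (phi (a + h) - phi a - c * h).
  by rewrite /GRing.scale/= mulr1 [h + a]addrC; field.
by rewrite normcN; exact: hd.
Qed.

Lemma cexp_holo : holo (@cexp R).
Proof.
move=> a; apply: (@epsilon_differentiable _ _ (cexp a)) => e e0.
pose M := normc (cexp a) * (3 * expR 1) + 1.
have M0 : 0 < M.
  by rewrite ltr_wpDl// mulr_ge0 ?normc_ge0 ?mulr_ge0 ?expR_ge0.
exists (Num.min 1 (e / M)); first by rewrite lt_min ltr01 divr_gt0.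
move=> h; rewrite lt_min => /andP[h1 he].
have -> : cexp (a + h) - cexp a - cexp a * h = cexp a * (cexp h - 1 - h).
  by rewrite cexpD; ring.
rewrite Normc.normcM (le_trans (ler_wpM2l (normc_ge0 _) (cexp_taylor h)))//.
have h0 := normc_ge0 h; have ca0 := normc_ge0 (cexp a).
apply: (@le_trans _ _ (M * normc h ^+ 2)).
  have : expR (normc h) <= expR 1 by rewrite ler_expR ltW.
  move=> hx; have := sqr_ge0 (normc h) => hh.
  rewrite [leLHS](_ : _ = (normc (cexp a) * (3 * expR (normc h))) * normc h ^+ 2); last by ring.
  rewrite ler_wpM2r// /M (@le_trans _ _ (normc (cexp a) * (3 * expR 1)))//.
    by rewrite ler_wpM2l// ler_wpM2l.
  by rewrite lerDl.
rewrite expr2 mulrA ler_wpM2r//.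
by rewrite mulrC -ler_pdivlMr// ltW.
Qed.

Lemma holo_comp (phi psi : R[i] -> R[i]) :
  holo phi -> holo psi -> holo (phi \o psi).
Proof. by move=> h1 h2 a; exact: differentiable_comp (h2 a) (h1 _). Qed.

Lemma holoM (phi psi : R[i] -> R[i]) :
  holo phi -> holo psi -> holo (fun z => phi z * psi z).
Proof. by move=> h1 h2 a; exact: differentiableM (h1 a) (h2 a). Qed.

Lemma holoD (phi psi : R[i] -> R[i]) :
  holo phi -> holo psi -> holo (fun z => phi z + psi z).
Proof. by move=> h1 h2 a; exact: differentiableD (h1 a) (h2 a). Qed.

Lemma holo_cst c : holo (fun=> c).
Proof. by move=> a; exact: differentiable_cst. Qed.

Lemma holo_id : holo id.
Proof. by move=> a; apply/derivable1_diffP; exact: derivable_id. Qed.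

Lemma locally_lipschitz_continuous (f : R -> R) (x0 p d : R) : 0 <= p -> 0 < d ->
  (forall x, `|x - x0| <= d -> `|f x - f x0| <= p * `|x - x0|) ->
  {for x0, continuous f}.
Proof.
move=> p0 d0 h; apply/cvgrPdist_le => e e0.
have p1 : 0 < p + 1 by rewrite ltr_wpDl.
apply/nbhs_ballP; exists (Num.min d (e / (p + 1))) => /=.
  by rewrite lt_min d0 divr_gt0.
move=> x; rewrite /ball_/= lt_min distrC => /andP[xd xe].
rewrite distrC (le_trans (h x (ltW xd)))//.
rewrite (@le_trans _ _ ((p + 1) * `|x - x0|))//.
  by rewrite ler_wpM2r// lerDl.
by rewrite mulrC -ler_pdivlMr// ltW.
Qed.

(** The Cauchy-Riemann equations for Im psi dx + Re psi dy, the imaginary part of psi dz: if the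
    derivative is [c], the two coefficients have gradients (Im c, Re c) and (Re c, - Im c). *)
Lemma holo_closed (psi : R[i] -> R[i]) : holo psi -> forall x0 y0 : R,
  exists p q r : R, forall e : R, 0 < e ->
  exists2 d : R, 0 < d & forall x y : R, `|x - x0| <= d -> `|y - y0| <= d ->
    `|Im (psi (x +i* y)) - (Im (psi (x0 +i* y0)) + p * (x - x0) + q * (y - y0))|
       <= e * (`|x - x0| + `|y - y0|) /\
    `|Re (psi (x +i* y)) - (Re (psi (x0 +i* y0)) + q * (x - x0) + r * (y - y0))|
       <= e * (`|x - x0| + `|y - y0|).
Proof.
move=> hpsi x0 y0; have [c hc] := differentiable_epsilon (hpsi (x0 +i* y0)).
exists (Im c), (Re c), (- Im c) => e e0.
have [d d0 hd] := hc e e0; exists (d / 3); first by rewrite divr_gt0.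
move=> x y hx hy; pose h : R[i] := (x - x0) +i* (y - y0).
have hh : normc h <= `|x - x0| + `|y - y0| by exact: normc_ReIm.
have hlt : normc h < d by rewrite (le_lt_trans hh)//; clear -hx hy d0; lra.
have xyE : x +i* y = x0 +i* y0 + h by apply: complex_eqP; rewrite !ReImE /=; ring.
have k : normc (psi (x +i* y) - psi (x0 +i* y0) - c * h) <= e * (`|x - x0| + `|y - y0|).
  by rewrite xyE (le_trans (hd h hlt))// ler_wpM2l// ltW.
split; apply: le_trans k.
  apply: le_trans (normr_Im _); rewrite !ReImE /=.
  by rewrite le_eqVlt; apply/orP; left; apply/eqP; congr `|_|; ring.
apply: le_trans (normr_Re _); rewrite !ReImE /=.
by rewrite le_eqVlt; apply/orP; left; apply/eqP; congr `|_|; ring.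
Qed.

Lemma holo_continuous_Re (psi : R[i] -> R[i]) b : holo psi ->
  continuous (fun y : R => Re (psi (b +i* y))).
Proof.
move=> hpsi y0; pose B x y := Re (psi (x +i* y)).
have AB := holo_closed hpsi.
have [p [q [r /(_ 1 ltr01)[d d0 h]]]] := AB b y0.
apply: (@locally_lipschitz_continuous _ _ (`|r| + 1) d) => [|//|y yd].
  by rewrite addr_ge0.
have [_ +] := h b y ltac:(by rewrite subrr normr0 ltW) yd.
rewrite subrr mulr0 addr0 normr0 add0r mul1r opprD addrA => k.
rewrite -[B b y - _](subrK (r * (y - y0))) (le_trans (ler_normD _ _))//.
by rewrite mulrDl mul1r addrC normrM lerD2l.
Qed.

(** Composing with the exponential turns circles about 0 into vertical segments of length 2 pi. By
    periodicity the horizontal sides of a rectangle cancel, so the integral is the same for all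
    radii up to 1, and small radii give the value at 0. *)
Lemma circle_mean (phi : R[i] -> R[i]) : holo phi ->
  \int[leb]_(y in `[0, 2 * pi]) Re (phi (cexp (0 +i* y))) = 2 * pi * Re (phi 0).
Proof.
move=> hphi; pose psi := phi \o @cexp R.
have hpsi : holo psi := holo_comp hphi cexp_holo.
pose A x y := Im (psi (x +i* y)); pose B x y := Re (psi (x +i* y)).
have AB := holo_closed hpsi.
have contA c : continuous (A ^~ c).
  move=> x0; have [p [q [r /(_ 1 ltr01)[d d0 h]]]] := AB x0 c.
  apply: (@locally_lipschitz_continuous _ _ (`|p| + 1) d) => [|//|x xd].
    by rewrite addr_ge0.
  have [+ _] := h x c xd ltac:(by rewrite subrr normr0 ltW).
  rewrite subrr mulr0 addr0 normr0 addr0 mul1r opprD addrA => k.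
  rewrite -[A x c - _](subrK (p * (x - x0))) (le_trans (ler_normD _ _))//.
  by rewrite mulrDl mul1r addrC normrM lerD2l.
have contB b : continuous (B b) by exact: holo_continuous_Re.
have pi0 : 0 <= 2 * pi :> R by rewrite mulr_ge0// pi_ge0.
have per x : psi (x +i* (2 * pi)) = psi (x +i* 0).
  congr phi; apply: complex_eqP => /=.
    by rewrite mulr_natl cos2pi cos0.
  by rewrite mulr_natl sin2pi sin0.
have shift s : s <= 0 -> \int[leb]_(y in `[0, 2 * pi]) B 0 y =
                     \int[leb]_(y in `[0, 2 * pi]) B s y.
  move=> s0; have := circulation0 contA contB AB s0 pi0.
  have -> : circulation A B s 0 0 (2 * pi) =
      \int[leb]_(y in `[0, 2 * pi]) (B 0 y - B s y).
    rewrite /circulation (@eq_Rintegral _ _ _ _ _ (fun=> 0)); last first.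
      by move=> x _; rewrite /A per subrr.
    by rewrite Rintegral_cst ?mul0r ?add0r.
  rewrite (Rintegral_segmentB _ _ (contB 0) (contB s)).
  by move=> /eqP; rewrite subr_eq0 => /eqP.
apply/eqP; rewrite -subr_eq0 -normr_le0; apply/ler_addgt0Pl => e e0; rewrite addr0.
have [c hc] := differentiable_epsilon (hphi 0).
have [d d0 hd] := hc 1 ltr01.
pose M := normc c + 1.
have M0 : 0 < M by rewrite ltr_wpDl// normc_ge0.
pose e' := e / (2 * pi + 1).
have e'0 : 0 < e' by rewrite divr_gt0// ltr_wpDl.
(* The three bounds make [ln r] nonpositive, put the circle inside the disc where the derivative
   estimate holds, and give [M * r <= e'], where [M] bounds the difference quotients of [phi] at 0
   in that disc. *)
pose r := Num.min 1 (Num.min (d / 2) (e' / M)).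
have r0 : 0 < r by rewrite !lt_min ltr01 (divr_gt0 e'0 M0) divr_gt0.
rewrite (shift (ln r)); last by rewrite ln_le0// ge_min lexx.
have /andP[] : (Re (phi 0) - e') * (2 * pi - 0) <= \int[leb]_(y in `[0, 2 * pi]) B (ln r) y
    <= (Re (phi 0) + e') * (2 * pi - 0).
  apply: Rintegral_segment_bound => // y _.
  have nr : normc (cexp (ln r +i* y)) = r by rewrite normc_cexp /= lnK.
  have := hd (cexp (ln r +i* y)).
  have rd : r < d by rewrite !gt_min (_ : d / 2 < d) ?orbT//; clear -d0; lra.
  rewrite nr add0r mul1r => /(_ rd) h1.
  have : normc (phi (cexp (ln r +i* y)) - phi 0) <= e'.
    rewrite -[_ - phi 0](subrK (c * cexp (ln r +i* y))) (le_trans (le_normcD _ _))//.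
    rewrite Normc.normcM nr (@le_trans _ _ (M * r))//.
      by rewrite mulrDl mul1r addrC lerD2l.
    by rewrite mulrC -ler_pdivlMr// !ge_min lexx !orbT.
  move/(le_trans (normr_Re _)); rewrite !ReImE ler_norml -/(psi _) -/(B _ _).
  by clear; lra.
rewrite subr0; move: (Rintegral _ _ _) => I.
have : e' * (2 * pi) <= e.
  by rewrite /e' mulrAC ler_pdivrMr ?ltr_wpDl// ler_pM2l// lerDl.
by clear; rewrite ler_norml; lra.
Qed.

End HoloCircle.

(** * Measure-preserving maps *)

Section MeasurePreserving.
Local Open Scope ereal_scope.
Context d1 d2 (T1 : measurableType d1) (T2 : measurableType d2) (R : realType).

(** Stated with integrals of nonnegative functions and not with measures of sets, since iterated
    integrals produce invariance in this form. *)
Definition mpres (m1 : {measure set T1 -> \bar R}) (m2 : {measure set T2 -> \bar R})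
    (tau : T1 -> T2) : Prop :=
  measurable_fun setT tau /\
  forall f : T2 -> \bar R, measurable_fun setT f -> (forall x, 0 <= f x) ->
    \int[m1]_x f (tau x) = \int[m2]_x f x.

Lemma mpres_pushforward (m1 : {measure set T1 -> \bar R})
    (m2 : {measure set T2 -> \bar R}) tau : measurable_fun setT tau ->
  (forall A, measurable A -> m1 (tau @^-1` A) = m2 A) -> mpres m1 m2 tau.
Proof.
move=> mt h; split=> // f mf f0.
have -> : \int[m2]_x f x = \int[pushforward m1 tau]_x f x.
  apply: eq_measure_integral => A mA _; exact/esym/h.
by rewrite ge0_integral_pushforward// preimage_setT.
Qed.

End MeasurePreserving.

Lemma mpres_comp d1 d2 d3 (T1 : measurableType d1) (T2 : measurableType d2)
    (T3 : measurableType d3) (R : realType) (m1 : {measure set T1 -> \bar R})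
    (m2 : {measure set T2 -> \bar R}) (m3 : {measure set T3 -> \bar R}) f g :
  mpres m1 m2 f -> mpres m2 m3 g -> mpres m1 m3 (g \o f).
Proof.
move=> [mf hf] [mg hg]; split; first exact: measurableT_comp.
move=> u mu u0; rewrite -hg// -hf//; exact: measurableT_comp.
Qed.

Section PlaneInvariance.
Local Open Scope ereal_scope.
Context (R : realType).
Local Notation leb := (@lebesgue_measure R).
Local Notation RT := (measurableTypeR R).
Local Notation m2 := (@lebesgueC R).

Lemma mpres_translation (a : R) : mpres leb leb (fun x : RT => (x + a)%R : RT).
Proof.
have mt : measurable_fun setT (fun x : RT => (x + a)%R : RT).
  exact: measurable_funD.
apply: mpres_pushforward => //; move=> A mA.
suff : pushforward leb (fun x : RT => (x + a)%R : RT) A = leb A by [].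
apply/esym/lebesgue_measure_unique => //= _ [[x y]] _ <-.
rewrite /pushforward.
have -> : (fun x : R => (x + a)%R) @^-1` `]x, y] = `](x - a)%R, (y - a)%R]%classic.
  by apply/seteqP; split => z /=; rewrite !in_itv/= ltrBlDr lerBrDr.
rewrite !lebesgue_measure_itv/= !lte_fin ltrD2r.
by case: ifP => // _; rewrite -!EFinB; congr EFin; ring.
Qed.

Lemma measurable_pairR d (T : measurableType d) (f g : T -> RT) :
  measurable_fun setT f -> measurable_fun setT g ->
  measurable_fun setT (fun x => (f x, g x)).
Proof. by move=> mf mg; apply/measurable_fun_pairP; split. Qed.

Lemma lebesgueC_tonelli1 (f : RT * RT -> \bar R) : measurable_fun setT f ->
  (forall x, 0 <= f x) -> \int[m2]_z f z = \int[leb]_x \int[leb]_y f (x, y).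
Proof. by move=> mf f0; exact: fubini_tonelli1. Qed.

Lemma lebesgueC_tonelli2 (f : RT * RT -> \bar R) : measurable_fun setT f ->
  (forall x, 0 <= f x) -> \int[m2]_z f z = \int[leb]_y \int[leb]_x f (x, y).
Proof. by move=> mf f0; exact: fubini_tonelli2. Qed.

(** With the second coordinate fixed a shear is a translation of the line, and Tonelli integrates
    that invariance. Translations and rotations of the plane are then products of shears. *)
Lemma mpres_shear1 (h : RT -> RT) : measurable_fun setT h ->
  mpres m2 m2 (fun z : RT * RT => ((z.1 + h z.2)%R : RT, z.2)).
Proof.
move=> mh; have mt : measurable_fun setT (fun z : RT * RT => ((z.1 + h z.2)%R : RT, z.2)).
  apply: measurable_pairR => //; apply: measurable_funD => //.
  exact: (measurableT_comp mh).
split=> // f mf f0; rewrite (lebesgueC_tonelli2 mf f0)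
  (lebesgueC_tonelli2 (measurableT_comp mf mt) (fun z => f0 _)).
apply: eq_integral => y _ /=.
have [_ hy] := mpres_translation (h y).
apply: (hy (fun x => f (x, y))) => //.
exact: measurableT_comp mf (pair2_measurable y).
Qed.

Lemma mpres_shear2 (h : RT -> RT) : measurable_fun setT h ->
  mpres m2 m2 (fun z : RT * RT => (z.1, (z.2 + h z.1)%R : RT)).
Proof.
move=> mh; have mt : measurable_fun setT (fun z : RT * RT => (z.1, (z.2 + h z.1)%R : RT)).
  apply: measurable_pairR => //; apply: measurable_funD => //.
  exact: (measurableT_comp mh).
split=> // f mf f0; rewrite (lebesgueC_tonelli1 mf f0)
  (lebesgueC_tonelli1 (measurableT_comp mf mt) (fun z => f0 _)).
apply: eq_integral => x _ /=.
have [_ hx] := mpres_translation (h x).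
apply: (hx (fun y => f (x, y))) => //.
exact: measurableT_comp mf (pair1_measurable x).
Qed.

Lemma mpres_translationC (a b : R) :
  mpres m2 m2 (fun z : RT * RT => ((z.1 + a)%R : RT, (z.2 + b)%R : RT)).
Proof.
exact: (mpres_comp (mpres_shear1 (measurable_cst a)) (mpres_shear2 (measurable_cst b))).
Qed.

(* A rotation whose angle is not [pi] is a product of three shears. *)
Let mpres_rotation_shear (c s : R) : (c ^+ 2 + s ^+ 2 = 1)%R -> (c != -1)%R ->
  mpres m2 m2 (fun z : RT * RT =>
    ((c * z.1 - s * z.2)%R : RT, (s * z.1 + c * z.2)%R : RT)).
Proof.
(* With c = cos theta and s = sin theta, [t] is - tan (theta / 2). *)
move=> cs c1; pose t := (- (s / (1 + c)))%R.
have mm (k : R) : measurable_fun setT (fun x : RT => (k * x)%R : RT).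
  exact: measurable_funM.
have := mpres_comp (mpres_comp (mpres_shear1 (mm t)) (mpres_shear2 (mm s)))
  (mpres_shear1 (mm t)).
have c10 : (1 + c != 0)%R by rewrite addrC addr_eq0.
have e1 : (1 + s * t = c)%R.
  apply/eqP; rewrite -subr_eq0 /t; apply/eqP.
  rewrite (_ : (_ - _)%R = ((1 - c ^+ 2 - s ^+ 2) / (1 + c))%R); last by field.
  by rewrite (_ : (1 - c ^+ 2 - s ^+ 2 = 0)%R) ?mul0r//; move: cs; clear; lra.
have e2 : (t * (1 + c) = - s)%R by rewrite /t; field.
set g := (_ \o _); rewrite (_ : g = (fun z : RT * RT =>
    ((c * z.1 - s * z.2)%R : RT, (s * z.1 + c * z.2)%R : RT)))//.
have k1 (x y : R) : (x + t * y + t * (y + s * (x + t * y)) = c * x - s * y)%R.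
  rewrite [LHS](_ : _ = (1 + s * t) * x + t * (1 + (1 + s * t)) * y)%R; last by ring.
  by rewrite e1 e2 mulNr.
have k2 (x y : R) : (y + s * (x + t * y) = s * x + c * y)%R by rewrite -e1; ring.
by apply/funext => -[x y]; rewrite /g /=; congr pair; [exact: k1|exact: k2].
Qed.

Lemma mpres_rotation (c s : R) : (c ^+ 2 + s ^+ 2 = 1)%R ->
  mpres m2 m2 (fun z : RT * RT =>
    ((c * z.1 - s * z.2)%R : RT, (s * z.1 + c * z.2)%R : RT)).
Proof.
move=> cs; have [c1|c1] := eqVneq c (-1)%R; last exact: mpres_rotation_shear.
have s0 : s = 0%R.
  by apply/eqP; rewrite -sqrf_eq0; apply/eqP; move: cs; rewrite c1; lra.
(* The rotation by pi is the square of the rotation by pi / 2, which is a product of shears. *)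
have h : mpres m2 m2 (fun z : RT * RT =>
    ((0 * z.1 - 1 * z.2)%R : RT, (1 * z.1 + 0 * z.2)%R : RT)).
  apply: mpres_rotation_shear; first by rewrite expr0n expr1n add0r.
  by rewrite eq_sym oppr_eq0 oner_eq0.
have := mpres_comp h h; set g := (_ \o _).
rewrite (_ : g = (fun z : RT * RT =>
    ((c * z.1 - s * z.2)%R : RT, (s * z.1 + c * z.2)%R : RT)))//.
by apply/funext => -[x y]; rewrite /g /= c1 s0; congr pair; ring.
Qed.

End PlaneInvariance.

Section TuplePowerIntegral.
Local Open Scope ereal_scope.
Context d (T : measurableType d) (R : realType).
Variable m : {sigma_finite_measure set T -> \bar R}.

Lemma tuple_power_tonelli n (f : n.+1.-tuple T -> \bar R) :
  measurable_fun setT f -> (forall x, 0 <= f x) ->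
  \int[tuple_power m n.+1]_x f x =
  \int[m]_x \int[tuple_power m n]_y f (tcons (x, y)).
Proof.
move=> mf f0 /=.
transitivity (\int[m \x tuple_power m n]_z f (tcons z)).
  rewrite -[RHS](ge0_integral_pushforward (@measurable_tcons _ T n) (m \x tuple_power m n)%E
   measurableT mf)//.
by rewrite fubini_tonelli1//; exact: measurableT_comp mf (@measurable_tcons _ T n).
Qed.

Definition tmap n (tau : 'I_n -> T -> T) (x : n.-tuple T) : n.-tuple T :=
  [tuple tau j (tnth x j) | j < n].

Lemma measurable_tmap n (tau : 'I_n -> T -> T) :
  (forall j, measurable_fun setT (tau j)) -> measurable_fun setT (tmap tau).
Proof.
move=> mt; apply/measurable_fun_tnthP => j /=.
rewrite (_ : _ \o _ = tau j \o (@tnth _ T ^~ j)).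
  by apply: measurableT_comp => //; exact: measurable_tnth.
by apply/funext => x /=; rewrite tnth_mktuple.
Qed.

Lemma tmap_tcons n (tau : 'I_n.+1 -> T -> T) x (y : n.-tuple T) :
  tmap tau (tcons (x, y)) = tcons (tau ord0 x, tmap (tau \o lift ord0) y).
Proof.
apply: eq_from_tnth => j; rewrite tnth_mktuple.
have [->|[k ->]] : j = ord0 \/ exists k, j = lift ord0 k.
  by case: (unliftP ord0 j) => [k ->|->]; [right; exists k|left].
  by rewrite /tcons !(tnth_nth x)/=.
by rewrite /tcons !tnthS tnth_mktuple.
Qed.

Lemma mpres_tmap n (tau : 'I_n -> T -> T) :
  (forall j, mpres m m (tau j)) -> mpres (tuple_power m n) (tuple_power m n) (tmap tau).
Proof.
elim: n tau => [|n ih] tau mt.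
  split=> [|f mf f0]; first by apply: measurable_tmap => -[].
  by apply: eq_integral => x _; congr f; apply/eq_from_tnth => -[].
have mtau : measurable_fun setT (tmap tau).
  by apply: measurable_tmap => j; have [] := mt j.
split=> // f mf f0; rewrite (tuple_power_tonelli mf f0)
  (tuple_power_tonelli (measurableT_comp mf mtau) (fun z => f0 _)).
have [_ h] := ih (tau \o lift ord0) (fun j => mt _).
have mcons : measurable_fun setT (f \o @tcons _ T n).
  exact: measurableT_comp mf (@measurable_tcons _ T n).
transitivity (\int[m]_x \int[tuple_power m n]_y f (tcons (tau ord0 x, y))).
  apply: eq_integral => x _; under eq_integral do rewrite /comp tmap_tcons.
  apply: (h (fun y => f (tcons (tau ord0 x, y)))) => // .
  exact: measurableT_comp mcons (pair1_measurable _).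
have [_ h0] := mt ord0.
apply: (h0 (fun x => \int[tuple_power m n]_y f (tcons (x, y)))) => [|x].
  by apply: (measurable_fun_fubini_tonelli_F (f \o @tcons _ T n) mcons) => z; exact: f0.
exact: integral_ge0.
Qed.

Lemma tuple_power_prod n (phi : 'I_n -> T -> R) (c : 'I_n -> R) :
  (forall j, measurable_fun setT (phi j)) -> (forall j x, (0 <= phi j x)%R) ->
  (forall j, \int[m]_x (phi j x)%:E = (c j)%:E) ->
  \int[tuple_power m n]_x (\prod_(j < n) phi j (tnth x j))%:E =
  (\prod_(j < n) c j)%:E.
Proof.
elim: n phi c => [|n ih] phi c mphi phi0 hphi.
  under eq_integral do rewrite big_ord0.
  by rewrite big_ord0 integral_cst//= diracT mule1.
have mprod k (psi : 'I_k -> T -> R) : (forall j, measurable_fun setT (psi j)) ->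
    measurable_fun setT (fun x : k.-tuple T => (\prod_(j < k) psi j (tnth x j))%R).
  move=> mpsi; apply: measurable_prod => j _.
  by apply: measurableT_comp => //; exact: measurable_tnth.
rewrite tuple_power_tonelli//; last 2 first.
- by apply/measurable_EFinP; exact: mprod.
- by move=> x; rewrite lee_fin prodr_ge0.
rewrite big_ord_recl EFinM -hphi.
have c0 : 0 <= (\prod_(i < n) c (lift ord0 i))%:E.
  rewrite lee_fin prodr_ge0// => i _.
  by rewrite -lee_fin -hphi; apply: integral_ge0 => x _; rewrite lee_fin.
rewrite -ge0_integralZr//; last 2 first.
- by apply/measurable_EFinP.
- by move=> x _; rewrite lee_fin.
apply: eq_integral => x _.
transitivity (\int[tuple_power m n]_y
   ((phi ord0 x)%:E * (\prod_(j < n) phi (lift ord0 j) (tnth y j))%:E)).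
  apply: eq_integral => y _; rewrite -EFinM big_ord_recl; congr (_ * _)%:E.
  by apply: eq_bigr => i _; rewrite /tcons tnthS.
rewrite ge0_integralZl//.
- by rewrite (ih (fun j => phi (lift ord0 j)) (fun j => c (lift ord0 j))).
- apply/measurable_EFinP; exact: (mprod n (fun j => phi (lift ord0 j))).
- by move=> y _; rewrite lee_fin prodr_ge0.
- by rewrite lee_fin.
Qed.

End TuplePowerIntegral.

(** * Complex-valued integrals *)

Section ComplexMeasurable.
Context d (T : measurableType d) (R : realType).
Implicit Types (F G : T -> R[i]).

(** The same measurability as in the clauses of [L2], so that it can be read off from them. *)
Definition Cmeas F : Prop :=
  measurable_fun setT (fun x => Re (F x)) /\ measurable_fun setT (fun x => Im (F x)).

Lemma Cmeas_cst (c : R[i]) : Cmeas (fun=> c).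
Proof. by split; exact: measurable_cst. Qed.

Lemma CmeasD F G : Cmeas F -> Cmeas G -> Cmeas (fun x => F x + G x).
Proof.
move=> [F1 F2] [G1 G2]; split.
  by under eq_fun do rewrite ReD; exact: measurable_funD.
by under eq_fun do rewrite ImD; exact: measurable_funD.
Qed.

Lemma CmeasN F : Cmeas F -> Cmeas (fun x => - F x).
Proof.
move=> [F1 F2]; split.
  by under eq_fun do rewrite ReN; exact: measurable_funN.
by under eq_fun do rewrite ImN; exact: measurable_funN.
Qed.

Lemma CmeasB F G : Cmeas F -> Cmeas G -> Cmeas (fun x => F x - G x).
Proof. by move=> mF mG; apply: CmeasD => //; exact: CmeasN. Qed.

Lemma CmeasM F G : Cmeas F -> Cmeas G -> Cmeas (fun x => F x * G x).
Proof.
move=> [F1 F2] [G1 G2]; split.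
  by under eq_fun do rewrite ReM; apply: measurable_funB; exact: measurable_funM.
by under eq_fun do rewrite ImM; apply: measurable_funD; exact: measurable_funM.
Qed.

Lemma CmeasJ F : Cmeas F -> Cmeas (fun x => (F x)^*).
Proof.
move=> [F1 F2]; split; first by under eq_fun do rewrite ReJ.
by under eq_fun do rewrite ImJ; exact: measurable_funN.
Qed.

Lemma Cmeas_real (f : T -> R) : measurable_fun setT f -> Cmeas (fun x => (f x)%:C).
Proof. by move=> mf; split => //=; exact: measurable_cst. Qed.

Lemma Cmeas_sum I (s : seq I) (F : I -> T -> R[i]) :
  (forall i, Cmeas (F i)) -> Cmeas (fun x => \sum_(i <- s) F i x).
Proof.
move=> mF; elim: s => [|i s ih].
  by under eq_fun do rewrite big_nil; exact: Cmeas_cst.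
by under eq_fun do rewrite big_cons; exact: CmeasD.
Qed.

Lemma Cmeas_normc F : Cmeas F -> measurable_fun setT (fun x => normc (F x)).
Proof.
move=> [F1 F2]; under eq_fun do rewrite normcE.
apply: (measurableT_comp (continuous_measurable_fun (@sqrt_continuous R))) => //.
by apply: measurable_funD; exact: measurable_funX.
Qed.

Lemma Cmeas_cexp F : Cmeas F -> Cmeas (fun x => cexp (F x)).
Proof.
move=> [F1 F2]; have mexp : measurable_fun setT (fun x => expR (Re (F x))).
  exact: measurableT_comp.
split.
  under eq_fun do rewrite Re_cexp; apply: measurable_funM => //.
  exact: measurableT_comp (continuous_measurable_fun (@continuous_cos R)) F2.
under eq_fun do rewrite Im_cexp; apply: measurable_funM => //.
exact: measurableT_comp (continuous_measurable_fun (@continuous_sin R)) F2.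
Qed.

End ComplexMeasurable.

Lemma Cmeas_comp d1 d2 (T1 : measurableType d1) (T2 : measurableType d2)
    (R : realType) (tau : T1 -> T2) (F : T2 -> R[i]) :
  measurable_fun setT tau -> Cmeas F -> Cmeas (fun x => F (tau x)).
Proof.
move=> mt [F1 F2]; split; first exact: measurableT_comp F1 mt.
exact: measurableT_comp F2 mt.
Qed.

Section ComplexIntegral.
Context d (T : measurableType d) (R : realType) (m : {measure set T -> \bar R}).
Implicit Types (F G : T -> R[i]) (g : T -> R).

(** [Cintegral] is the case of the Gaussian measure. The mean value property also integrates over
    the line, hence the general measure. *)
Definition Cint F : R[i] :=
  (\int[m]_x Re (F x)) +i* (\int[m]_x Im (F x)).

Definition Cibl F : Prop :=
  Cmeas F /\ (\int[m]_x (normc (F x))%:E < +oo)%E.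

Lemma Cibl_meas F : Cibl F -> Cmeas F. Proof. by case. Qed.

Lemma eq_Cint F G : F =1 G -> Cint F = Cint G.
Proof. by move=> FG; congr Cint; apply/funext. Qed.

Lemma Cibl_normc F : Cibl F -> m.-integrable setT (EFin \o (fun x => normc (F x))).
Proof.
move=> [mF iF]; apply/integrableP; split.
  by apply/measurable_EFinP; exact: Cmeas_normc.
by under eq_integral => x _ do rewrite gee0_abs ?lee_fin ?normc_ge0//.
Qed.

Lemma Cibl_Re F : Cibl F -> m.-integrable setT (EFin \o (fun x => Re (F x))).
Proof.
move=> iF; apply: le_integrable (Cibl_normc iF) => //.
  by apply/measurable_EFinP; case: iF => -[].
by move=> x _; rewrite /= lee_fin (ger0_norm (normc_ge0 _)) normr_Re.
Qed.

Lemma Cibl_Im F : Cibl F -> m.-integrable setT (EFin \o (fun x => Im (F x))).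
Proof.
move=> iF; apply: le_integrable (Cibl_normc iF) => //.
  by apply/measurable_EFinP; case: iF => -[].
by move=> x _; rewrite /= lee_fin (ger0_norm (normc_ge0 _)) normr_Im.
Qed.

Lemma le_Cibl F (g : T -> R) : Cmeas F -> (forall x, normc (F x) <= g x) ->
  measurable_fun setT g -> (\int[m]_x (g x)%:E < +oo)%E -> Cibl F.
Proof.
move=> mF Fg mg ig; split=> //; apply: le_lt_trans ig.
apply: ge0_le_integral => //.
- by move=> x _; rewrite lee_fin normc_ge0.
- by apply/measurable_EFinP; exact: Cmeas_normc.
- exact/measurable_EFinP.
- by move=> x _; rewrite lee_fin.
Qed.

Lemma le_Cibl_normc F G : Cmeas F -> (forall x, normc (F x) <= normc (G x)) ->
  Cibl G -> Cibl F.
Proof. by move=> mF FG [mG iG]; apply: le_Cibl iG => //; exact: Cmeas_normc. Qed.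

Lemma Cibl_parts F : m.-integrable setT (EFin \o (fun x => Re (F x))) ->
  m.-integrable setT (EFin \o (fun x => Im (F x))) -> Cibl F.
Proof.
move=> iR iI; have mF : Cmeas F.
  by split; apply/measurable_EFinP; [exact: measurable_int iR|exact: measurable_int iI].
split=> //; have iA : m.-integrable setT (EFin \o (fun x => `|Re (F x)| + `|Im (F x)|)).
  rewrite (_ : _ \o _ = (fun x => `|(Re (F x))%:E| + `|(Im (F x))%:E|)%E)//.
  by apply: integrableD => //; exact: integrable_abse.
apply: le_lt_trans (integrable_lty _ iA) => //.
apply: ge0_le_integral => //.
- by move=> x _; rewrite lee_fin normc_ge0.
- by apply/measurable_EFinP; exact: Cmeas_normc.
- exact: measurable_int iA.
- by move=> x _; rewrite lee_fin normc_ReIm.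
Qed.

Lemma CiblD F G : Cibl F -> Cibl G -> Cibl (fun x => F x + G x).
Proof.
move=> iF iG; apply: Cibl_parts.
  under eq_fun do rewrite ReD.
  exact: (integrableD measurableT (Cibl_Re iF) (Cibl_Re iG)).
under eq_fun do rewrite ImD.
exact: (integrableD measurableT (Cibl_Im iF) (Cibl_Im iG)).
Qed.

Lemma Cibl0 : Cibl (fun=> 0).
Proof.
split; first exact: Cmeas_cst.
by under eq_integral do rewrite Normc.normc0; rewrite integral0.
Qed.

Lemma Cibl_sum I (s : seq I) (F : I -> T -> R[i]) :
  (forall i, Cibl (F i)) -> Cibl (fun x => \sum_(i <- s) F i x).
Proof.
move=> mF; elim: s => [|i s ih].
  by under eq_fun do rewrite big_nil; exact: Cibl0.
by under eq_fun do rewrite big_cons; exact: CiblD.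
Qed.

Lemma CiblZ (c : R[i]) F : Cibl F -> Cibl (fun x => c * F x).
Proof.
move=> [mF iF]; apply: (@le_Cibl _ (fun x => normc c * normc (F x))).
- by apply: CmeasM => //; exact: Cmeas_cst.
- by move=> x; rewrite Normc.normcM.
- by apply: measurable_funM => //; exact: Cmeas_normc.
under eq_integral do rewrite EFinM.
rewrite ge0_integralZl//.
- by rewrite lte_mul_pinfty// ?lee_fin ?normc_ge0.
- by apply/measurable_EFinP; exact: Cmeas_normc.
- by move=> x _; rewrite lee_fin normc_ge0.
- by rewrite lee_fin normc_ge0.
Qed.

Lemma CiblJ F : Cibl F -> Cibl (fun x => (F x)^*).
Proof.
move=> [mF iF]; split; first exact: CmeasJ.
by under eq_integral do rewrite normcJ.
Qed.

Lemma CiblN F : Cibl F -> Cibl (fun x => - F x).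
Proof. by move=> /(CiblZ (-1)); under eq_fun do rewrite mulN1r. Qed.

Lemma CiblB F G : Cibl F -> Cibl G -> Cibl (fun x => F x - G x).
Proof. by move=> iF iG; apply: CiblD => //; exact: CiblN. Qed.

Lemma CintD F G : Cibl F -> Cibl G -> Cint (fun x => F x + G x) = Cint F + Cint G.
Proof.
move=> iF iG; apply: complex_eqP; rewrite ?ReD ?ImD /=.
  rewrite -(RintegralD measurableT (Cibl_Re iF) (Cibl_Re iG)).
  by apply: eq_Rintegral => x _; rewrite ReD.
rewrite -(RintegralD measurableT (Cibl_Im iF) (Cibl_Im iG)).
by apply: eq_Rintegral => x _; rewrite ImD.
Qed.

Lemma CintZ (c : R[i]) F : Cibl F -> Cint (fun x => c * F x) = c * Cint F.
Proof.
move=> iF; have iR := Cibl_Re iF; have iI := Cibl_Im iF.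
have zR k := integrableZl measurableT k iR.
have zI k := integrableZl measurableT k iI.
apply: complex_eqP; rewrite ?ReM ?ImM /=.
  rewrite -(RintegralZl _ measurableT iR) -(RintegralZl _ measurableT iI).
  rewrite -(RintegralB measurableT (zR _) (zI _)).
  by apply: eq_Rintegral => x _; rewrite ReM.
rewrite -(RintegralZl _ measurableT iR) -(RintegralZl _ measurableT iI).
rewrite -(RintegralD measurableT (zI _) (zR _)).
by apply: eq_Rintegral => x _; rewrite ImM.
Qed.

Lemma CintZr (c : R[i]) F : Cibl F -> Cint (fun x => F x * c) = Cint F * c.
Proof. by move=> iF; rewrite mulrC -CintZ//; apply: eq_Cint => x; rewrite mulrC. Qed.

Lemma CintN F : Cibl F -> Cint (fun x => - F x) = - Cint F.
Proof. by move=> iF; rewrite -mulN1r -CintZ//; apply: eq_Cint => x; rewrite mulN1r. Qed.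

Lemma CintB F G : Cibl F -> Cibl G -> Cint (fun x => F x - G x) = Cint F - Cint G.
Proof. by move=> iF iG; rewrite -CintN// CintD//; exact: CiblN. Qed.

Lemma Cint0 : Cint (fun=> 0) = 0.
Proof. by apply: complex_eqP; rewrite /= Rintegral_cst//= mul0r. Qed.

Lemma Cint_sum I (s : seq I) (F : I -> T -> R[i]) :
  (forall i, Cibl (F i)) -> Cint (fun x => \sum_(i <- s) F i x) = \sum_(i <- s) Cint (F i).
Proof.
move=> iF; elim: s => [|i s ih].
  by rewrite big_nil -[RHS]Cint0; apply: eq_Cint => x; rewrite big_nil.
rewrite big_cons -ih -CintD//; last exact: Cibl_sum.
by apply: eq_Cint => x; rewrite big_cons.
Qed.

Lemma CintJ F : Cibl F -> Cint (fun x => (F x)^*) = (Cint F)^*.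
Proof.
move=> iF; apply: complex_eqP; rewrite ?ReJ ?ImJ /=.
  by apply: eq_Rintegral => x _; rewrite ReJ.
rewrite -[RHS]mulN1r -(RintegralZl _ measurableT (Cibl_Im iF)).
by apply: eq_Rintegral => x _; rewrite ImJ mulN1r.
Qed.

(* Rotating the integral onto the positive real axis reduces the bound to that
   of a real integral. *)
Lemma le_normc_Cint F : Cibl F -> normc (Cint F) <= \int[m]_x normc (F x).
Proof.
move=> iF; have iN := Cibl_normc iF.
have [->|I0] := eqVneq (Cint F) 0.
  by rewrite Normc.normc0; apply: Rintegral_ge0 => x _; exact: normc_ge0.
have n0 : normc (Cint F) != 0.
  by apply: contra_neq I0; exact: Normc.eq0_normc.
pose c := (Cint F)^* / (normc (Cint F))%:C.
have nc : normc c = 1.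
  rewrite Normc.normcM Normc.normcV normcJ normc_real (ger0_norm (normc_ge0 _)).
  by rewrite divff.
have -> : normc (Cint F) = Re (Cint (fun x => c * F x)).
  rewrite CintZ// /c mulrAC [_^* * _]mulrC mulcJ.
  by rewrite -(rmorphV _) ?unitfE// -rmorphM /= expr2 mulfK.
apply: le_Rintegral => //; first exact: Cibl_Re (CiblZ c iF).
move=> x _; rewrite -[leRHS]mul1r -nc -Normc.normcM.
exact: le_trans (ler_norm _) (normr_Re _).
Qed.

Lemma le_normc_CintE F : Cibl F ->
  ((normc (Cint F))%:E <= \int[m]_x (normc (F x))%:E)%E.
Proof.
move=> iF; rewrite (le_trans _ (_ : (\int[m]_x normc (F x))%:E <= _)%E)//.
  by rewrite lee_fin le_normc_Cint.
rewrite /Rintegral fineK//.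
have [_] := iF; rewrite ge0_fin_numE//.
by apply: integral_ge0 => x _; rewrite lee_fin normc_ge0.
Qed.

End ComplexIntegral.

Section ComplexFubini.
Context d1 d2 (T1 : measurableType d1) (T2 : measurableType d2) (R : realType).
Variable m1 : {sigma_finite_measure set T1 -> \bar R}.
Variable m2 : {sigma_finite_measure set T2 -> \bar R}.
Variable F : T1 * T2 -> R[i].
Hypothesis mF : Cmeas F.
Hypothesis iF : (\int[m1]_x \int[m2]_y (normc (F (x, y)))%:E < +oo)%E.
Hypothesis iF1 : forall x, Cibl m2 (fun y => F (x, y)).
Hypothesis iF2 : forall y, Cibl m1 (fun x => F (x, y)).

Let Rfubini (f : T1 * T2 -> R) : measurable_fun setT f ->
  (forall z, `|f z| <= normc (F z)) ->
  (forall x, m2.-integrable setT (EFin \o (fun y => f (x, y)))) ->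
  (forall y, m1.-integrable setT (EFin \o (fun x => f (x, y)))) ->
  \int[m1]_x \int[m2]_y f (x, y) = \int[m2]_y \int[m1]_x f (x, y).
Proof.
move=> mf fF if1 if2.
have iff : (m1 \x m2)%E.-integrable setT (EFin \o f).
  apply/integrable12ltyP; first exact/measurable_EFinP.
  have mFE : measurable_fun setT (fun z => (normc (F z))%:E).
    by apply/measurable_EFinP; exact: Cmeas_normc.
  have mfE : measurable_fun setT (fun z => (`|f z|)%:E).
    by apply/measurable_EFinP; exact: measurableT_comp.
  apply: le_lt_trans iF; apply: ge0_le_integral => //.
  - by move=> x _; exact: integral_ge0.
  - exact: (measurable_fun_fubini_tonelli_F (fun z => (`|f z|)%:E) mfE).
  - apply: (measurable_fun_fubini_tonelli_F (fun z => (normc (F z))%:E) mFE).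
    by move=> z; rewrite lee_fin normc_ge0.
  move=> x _; apply: ge0_le_integral => //.
  - exact: (measurableT_comp mfE (pair1_measurable x)).
  - exact: (measurableT_comp mFE (pair1_measurable x)).
  - by move=> y _; rewrite /= lee_fin.
rewrite /Rintegral; congr fine.
transitivity (\int[m1]_x \int[m2]_y (f (x, y))%:E)%E.
  apply: eq_integral => x _; rewrite fineK//.
  exact: (integrable_fin_num measurableT (if1 x)).
rewrite (Fubini iff); apply: eq_integral => y _; rewrite fineK//.
exact: (integrable_fin_num measurableT (if2 y)).
Qed.

(** Absolute integrability is asked for as an iterated integral, and sectional integrability at
    every point: [fine] can then be removed everywhere, with no almost-everywhere argument. *)
Lemma Cfubini : Cint m1 (fun x => Cint m2 (fun y => F (x, y))) =
  Cint m2 (fun y => Cint m1 (fun x => F (x, y))).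
Proof.
apply: complex_eqP => /=.
  apply: (Rfubini (f := fun z => Re (F z))); first by case: mF.
  - by move=> z; exact: normr_Re.
  - by move=> x; exact: Cibl_Re (iF1 x).
  - by move=> y; exact: Cibl_Re (iF2 y).
apply: (Rfubini (f := fun z => Im (F z))); first by case: mF.
- by move=> z; exact: normr_Im.
- by move=> x; exact: Cibl_Im (iF1 x).
- by move=> y; exact: Cibl_Im (iF2 y).
Qed.

End ComplexFubini.

Section ComplexFubiniMeas.
Context d1 d2 (T1 : measurableType d1) (T2 : measurableType d2) (R : realType).
Variable m2 : {sigma_finite_measure set T2 -> \bar R}.

Lemma measurable_Rintegral (f : T1 * T2 -> R) : measurable_fun setT f ->
  measurable_fun setT (fun x => \int[m2]_y f (x, y)).
Proof.
move=> mf; have mfE : measurable_fun setT (EFin \o f) by exact/measurable_EFinP.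
rewrite (_ : (fun x => _) = fine \o (fun x => \int[m2]_y (f (x, y))%:E)%E)//.
apply: measurableT_comp => //.
rewrite (_ : (fun x => _) = (fun x => (\int[m2]_y (EFin \o f)^\+ (x, y)) -
   (\int[m2]_y (EFin \o f)^\- (x, y)))%E); last first.
  apply/funext => x; rewrite integralE; congr (_ - _)%E; apply: eq_integral => y _.
    by rewrite !funeposE.
  by rewrite !funenegE.
by apply: emeasurable_funB; apply: measurable_fun_fubini_tonelli_F => //;
  [exact: measurable_funepos|exact: measurable_funeneg].
Qed.

Lemma Cmeas_Cint (F : T1 * T2 -> R[i]) : Cmeas F ->
  Cmeas (fun x => Cint m2 (fun y => F (x, y))).
Proof.
move=> [F1 F2]; split => /=.
  exact: (measurable_Rintegral F1).
exact: (measurable_Rintegral F2).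
Qed.

End ComplexFubiniMeas.

Section Transfer.
Context d1 d2 (T1 : measurableType d1) (T2 : measurableType d2) (R : realType).
Variables (m1 : {measure set T1 -> \bar R}) (m2 : {measure set T2 -> \bar R}).
Variables (tau : T1 -> T2) (rho : T1 -> R).

(* [m2] is the image under [tau] of the measure with density [rho] with respect
   to [m1]. *)
Definition transfers : Prop :=
  [/\ measurable_fun setT tau, measurable_fun setT rho, forall x, 0 <= rho x &
    forall f : T2 -> \bar R, measurable_fun setT f -> (forall x, 0 <= f x)%E ->
    (\int[m2]_x f x = \int[m1]_x (f (tau x) * (rho x)%:E))%E].

Hypothesis tr : transfers.

Lemma transfers_integral (f : T2 -> R) : measurable_fun setT f ->
  (\int[m2]_x (f x)%:E = \int[m1]_x (f (tau x) * rho x)%:E)%E.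
Proof.
case: tr => mt mrho rho0 h mf; rewrite [LHS]integralE [RHS]integralE.
have mfE : measurable_fun setT (EFin \o f) by exact/measurable_EFinP.
rewrite (h _ (measurable_funepos mfE))// (h _ (measurable_funeneg mfE))//.
congr (_ - _)%E; apply: eq_integral => x _; rewrite ?funeposE ?funenegE.
  by rewrite -!EFin_max -EFinM maxr_pMl// mul0r.
by rewrite -!EFin_max -EFinM maxr_pMl// mul0r mulNr.
Qed.

Lemma transfers_Cmeas (F : T2 -> R[i]) : Cmeas F ->
  Cmeas (fun x => F (tau x) * (rho x)%:C).
Proof.
case: tr => mt mrho _ _ mF.
by apply: CmeasM; [exact: Cmeas_comp|exact: Cmeas_real].
Qed.

Lemma transfers_Cint (F : T2 -> R[i]) : Cmeas F ->
  Cint m2 F = Cint m1 (fun x => F (tau x) * (rho x)%:C).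
Proof.
move=> [F1 F2]; apply: complex_eqP => /=; rewrite /Rintegral.
  rewrite (transfers_integral F1); congr fine; apply: eq_integral => x _.
  by rewrite ReM /= mulr0 subr0.
rewrite (transfers_integral F2); congr fine; apply: eq_integral => x _.
by rewrite ImM /= mulr0 add0r mulrC.
Qed.

Lemma transfers_Cibl (F : T2 -> R[i]) : Cmeas F ->
  Cibl m2 F <-> Cibl m1 (fun x => F (tau x) * (rho x)%:C).
Proof.
move=> mF; have mF' := transfers_Cmeas mF.
have e : (\int[m2]_x (normc (F x))%:E =
  \int[m1]_x (normc (F (tau x) * (rho x)%:C))%:E)%E.
  rewrite (transfers_integral (Cmeas_normc mF)); apply: eq_integral => x _.
  by case: tr => _ _ rho0 _; rewrite Normc.normcM normc_real ger0_norm.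
by split=> -[_ i]; split => //; rewrite ?e// -e.
Qed.

End Transfer.

Lemma mpres_transfers d1 d2 (T1 : measurableType d1) (T2 : measurableType d2)
    (R : realType) (m1 : {measure set T1 -> \bar R})
    (m2 : {measure set T2 -> \bar R}) tau :
  mpres m1 m2 tau -> transfers m1 m2 tau (cst 1).
Proof.
move=> [mt h]; split => // f mf f0; rewrite -h//.
by apply: eq_integral => x _; rewrite mule1.
Qed.

Section MeasurePreservingComplex.
Context d1 d2 (T1 : measurableType d1) (T2 : measurableType d2) (R : realType).
Variables (m1 : {measure set T1 -> \bar R}) (m2 : {measure set T2 -> \bar R}).
Variables (tau : T1 -> T2) (tr : mpres m1 m2 tau).

Lemma mpres_Cint (F : T2 -> R[i]) : Cmeas F ->
  Cint m2 F = Cint m1 (fun x => F (tau x)).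
Proof.
move=> mF; rewrite (transfers_Cint (mpres_transfers tr))//.
by apply: eq_Cint => x; rewrite mulr1.
Qed.

Lemma mpres_Cibl (F : T2 -> R[i]) : Cmeas F ->
  Cibl m2 F <-> Cibl m1 (fun x => F (tau x)).
Proof.
move=> mF; rewrite (transfers_Cibl (mpres_transfers tr))//.
by under eq_fun do rewrite mulr1.
Qed.

End MeasurePreservingComplex.

(** * Gaussian measures *)

Section Density.
Local Open Scope ereal_scope.
Context d (T : measurableType d) (R : realType).
Variables (m m' : {measure set T -> \bar R}) (rho : T -> R).
Hypothesis mrho : measurable_fun setT rho.
Hypothesis rho0 : forall x, (0 <= rho x)%R.
Hypothesis m'E : forall A, measurable A -> m' A = \int[m]_(x in A) (rho x)%:E.

Import HBNNSimple.

Let density_nnsfun (g : {nnsfun T >-> R}) :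
  \int[m']_x (g x)%:E = \int[m]_x ((g x)%:E * (rho x)%:E).
Proof.
have mk k : measurable (g @^-1` [set k]) by [].
have mindic k : measurable_fun setT (fun x => (k * \1_(g @^-1` [set k]) x * rho x)%R).
  by apply: measurable_funM => //; exact: measurable_funM.
transitivity (\sum_(k \in range g) \int[m']_x (k * \1_(g @^-1` [set k]) x)%:E).
  under eq_integral do rewrite fimfunE -fsumEFin//.
  rewrite ge0_integral_fsum//.
  - by move=> k; apply/measurable_EFinP; exact: measurable_funM.
  - by move=> k x _; rewrite nnfun_muleindic_ge0.
transitivity (\sum_(k \in range g) \int[m]_x (k * \1_(g @^-1` [set k]) x * rho x)%:E); last first.
  rewrite -ge0_integral_fsum//.
  - apply: eq_integral => x _; rewrite [in RHS]fimfunE -fsumEFin//.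
    rewrite ge0_mule_fsuml//; last by move=> k; rewrite nnfun_muleindic_ge0.
  - by move=> k; exact/measurable_EFinP.
  - by move=> k x _; rewrite EFinM mule_ge0 ?nnfun_muleindic_ge0// lee_fin.
apply: eq_fsbigr => k; rewrite inE => -[x0 _ gk].
have k0 : (0 <= k)%R by rewrite -gk.
rewrite integralZl_indic_nnsfun// integral_indic// setIT m'E//.
under [RHS]eq_integral do rewrite -mulrA EFinM.
rewrite ge0_integralZl//; last 2 first.
- by apply/measurable_EFinP; exact: measurable_funM.
- by move=> x _; rewrite lee_fin mulr_ge0.
congr (_ * _); rewrite integral_mkcond; apply: eq_integral => x _.
rewrite patchE indicE; case: ifPn => xk; first by rewrite mul1r.
by rewrite mul0r.
Qed.

(** [gaussCn] is given by its values on sets. The formula for functions follows by simple functions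
    and monotone convergence. *)
Lemma density_integral (f : T -> \bar R) : measurable_fun setT f ->
  (forall x, 0 <= f x) -> \int[m']_x f x = \int[m]_x (f x * (rho x)%:E).
Proof.
move=> mf f0; pose g := nnsfun_approx measurableT mf.
have cg x : (g n x)%:E @[n --> \oo] --> f x.
  by apply: cvg_nnsfun_approx => // *; exact: f0.
have ndg x : {homo (fun n => g n x) : a b / (a <= b)%N >-> (a <= b)%R}.
  by move=> a b ab; exact/lefP/nd_nnsfun_approx.
have mrhoE : measurable_fun setT (EFin \o rho) by exact/measurable_EFinP.
transitivity (limn (fun n => \int[m']_x (g n x)%:E)).
  rewrite -monotone_convergence//.
  - by apply: eq_integral => x _; apply/esym/cvg_lim => //; exact: cg.
  - by move=> n; exact/measurable_EFinP.
  - by move=> n x _; rewrite lee_fin.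
  - by move=> x _ a b ab; rewrite lee_fin; exact: ndg.
under eq_fun do rewrite density_nnsfun.
rewrite -monotone_convergence//.
- apply: eq_integral => x _; apply/cvg_lim => //.
  by apply: cvgeZr => //; exact: cg.
- by move=> n; apply: emeasurable_funM => //; exact/measurable_EFinP.
- by move=> n x _; rewrite mule_ge0 ?lee_fin.
- by move=> x _ a b ab; rewrite lee_wpmul2r ?lee_fin//; exact: ndg.
Qed.

End Density.

(** * Gaussian integrals on the line and on the plane *)

Section PlaneGauss.
Context (R : realType).
Local Notation leb := (@lebesgue_measure R).
Local Notation RT := (measurableTypeR R).
Local Notation m2 := (@lebesgueC R).
Implicit Types (l h : R).

Let q (z : RT * RT) : R := (z.1 : R) ^+ 2 + (z.2 : R) ^+ 2.

Let q0 z : 0 <= q z. Proof. by rewrite addr_ge0// sqr_ge0. Qed.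

Let mq : measurable_fun setT q.
Proof. by apply: measurable_funD; exact: measurable_funX. Qed.

Let mexp l : measurable_fun setT (fun z => expR (- (l * q z))).
Proof.
apply: (measurableT_comp (@measurable_expR R)) => //; apply: measurableT_comp => //.
exact: measurable_funM.
Qed.

Lemma integral_gauss1 l : 0 < l ->
  (\int[leb]_x (expR (- (l * x ^+ 2)))%:E = (Num.sqrt (pi / l))%:E)%E.
Proof.
(* The standard deviation for which the normal density is a multiple of exp (- l x^2). *)
move=> l0; pose s := Num.sqrt ((2 * l)^-1).
have s2 : s ^+ 2 = (2 * l)^-1 by rewrite sqr_sqrtr// invr_ge0 mulr_ge0// ltW.
have s0 : s != 0 by rewrite gt_eqF// sqrtr_gt0 invr_gt0 mulr_gt0.
have := integral_normal_pdf 0 s; rewrite normal_pdfE// => h.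
have p0 : 0 < pi / l by rewrite divr_gt0// pi_gt0.
have pk : normal_peak s = (Num.sqrt (pi / l))^-1.
  rewrite /normal_peak s2; congr (Num.sqrt _)^-1; field.
  by rewrite gt_eqF.
have sp : 0 < Num.sqrt (pi / l) by rewrite sqrtr_gt0.
transitivity (\int[leb]_x ((Num.sqrt (pi / l))%:E *
    (normal_peak s * normal_fun 0 s x)%:E))%E.
  apply: eq_integral => x _; rewrite -EFinM pk.
  rewrite [X in _ = X%:E](_ : _ = normal_fun 0 s x); last first.
    by rewrite mulrA divff ?mul1r// gt_eqF.
  rewrite /normal_fun subr0 s2; congr (expR _)%:E; field.
  by rewrite gt_eqF.
rewrite ge0_integralZl//.
- by rewrite h mule1.
- apply/measurable_EFinP; apply: measurable_funM => //; exact: measurable_normal_fun.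
- by move=> x _; rewrite lee_fin mulr_ge0 ?normal_peak_ge0 ?expR_ge0.
Qed.

Lemma integral_gauss2 l : 0 < l ->
  (\int[m2]_z (expR (- (l * q z)))%:E = (pi / l)%:E)%E.
Proof.
move=> l0; have mE : measurable_fun setT (fun z => (expR (- (l * q z)))%:E).
  exact/measurable_EFinP.
rewrite (lebesgueC_tonelli1 mE) => [|z]; last by rewrite lee_fin expR_ge0.
have mx : measurable_fun setT (fun x : RT => (expR (- (l * (x : R) ^+ 2)))%:E).
  apply/measurable_EFinP; apply: (measurableT_comp (@measurable_expR R)) => //.
  by apply: measurableT_comp => //; apply: measurable_funM => //; exact: measurable_funX.
have p0 : 0 <= pi / l by rewrite divr_ge0 ?pi_ge0// ltW.
transitivity (\int[leb]_x ((expR (- (l * x ^+ 2)))%:E * (Num.sqrt (pi / l))%:E))%E.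
  apply: eq_integral => x _; rewrite -integral_gauss1//.
  rewrite -ge0_integralZl//.
  by apply: eq_integral => y _; rewrite -EFinM -expRD /q /=; congr (expR _)%:E; ring.
rewrite ge0_integralZr//.
by rewrite integral_gauss1// -EFinM -expr2 sqr_sqrtr.
Qed.

(* [1 - exp (- x)] lies between [x * exp (- x)] and [x], so the second moment is
   minus the derivative of [l |-> pi / l]. *)
Lemma integral_gauss2_moment l : 0 < l ->
  (\int[m2]_z (q z * expR (- (l * q z)))%:E = (pi / l ^+ 2)%:E)%E.
Proof.
move=> l0; pose M := (\int[m2]_z (q z * expR (- (l * q z)))%:E)%E.
have mm : measurable_fun setT (fun z => (q z * expR (- (l * q z)))%:E).
  by apply/measurable_EFinP; exact: measurable_funM.
have mE k : measurable_fun setT (fun z => (expR (- (k * q z)))%:E).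
  exact/measurable_EFinP.
have m0 z : (0 <= (q z * expR (- (l * q z)))%:E)%E.
  by rewrite lee_fin mulr_ge0 ?expR_ge0.
have M0 : (0 <= M)%E by apply: integral_ge0 => z _; exact: m0.
have E0 k z : (0 <= (expR (- (k * q z)))%:E)%E by rewrite lee_fin expR_ge0.
(* The case [k = l] integrates the left side of the upper estimate [up], the case [k = l + h] the
   right side of the lower estimate [lo]. *)
have key h k : 0 <= h -> 0 < k ->
    (\int[m2]_z ((h * (q z * expR (- (l * q z))))%:E + (expR (- (k * q z)))%:E) =
     h%:E * M + (pi / k)%:E)%E.
  move=> h0 k0; under eq_integral do rewrite EFinM.
  rewrite ge0_integralD//.
  - by rewrite ge0_integralZl// integral_gauss2.
  - by move=> z _; rewrite mule_ge0// lee_fin.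
  - exact: emeasurable_funM.
have up h : 0 < h -> h < l -> (h%:E * M + (pi / l)%:E <= (pi / (l - h))%:E)%E.
  move=> h0 hl; rewrite -(key h l)//; last exact: ltW.
  rewrite -integral_gauss2 ?subr_gt0//; apply: ge0_le_integral => //.
  - by move=> z _; rewrite EFinM adde_ge0// mule_ge0// lee_fin ltW.
  - by apply: emeasurable_funD => //; under eq_fun do rewrite EFinM; exact: emeasurable_funM.
  move=> z _; rewrite -EFinD lee_fin.
  have -> : - ((l - h) * q z) = - (l * q z) + h * q z by ring.
  rewrite expRD; have := expR_ge1Dx (h * q z); have := expR_gt0 (- (l * q z)).
  by nra.
have lo h : 0 < h -> ((pi / l)%:E <= h%:E * M + (pi / (l + h))%:E)%E.
  move=> h0; rewrite -(key h (l + h)); [|exact: ltW|exact: addr_gt0].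
  rewrite -integral_gauss2//; apply: ge0_le_integral => //.
    by apply: emeasurable_funD => //; under eq_fun do rewrite EFinM; exact: emeasurable_funM.
  move=> z _; rewrite -EFinD lee_fin.
  have -> : - ((l + h) * q z) = - (l * q z) + - (h * q z) by ring.
  rewrite expRD; have := expR_ge1Dx (- (h * q z)); have := expR_gt0 (- (l * q z)).
  by nra.
(* The upper estimate itself, at h = l / 2, shows that the moment is finite. *)
have Mfin : M \is a fin_num.
  have := up (l / 2); rewrite divr_gt0// => /(_ isT).
  have -> : l / 2 < l by rewrite ltr_pdivrMr// ltr_pMr// ltr1n.
  move=> /(_ isT); rewrite fin_numE.
  by case: (M) M0 => [r| |]//; rewrite mulry gtr0_sg ?divr_gt0// mul1e.
rewrite -/M -(fineK Mfin); set x := fine M; congr EFin.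
have x0 : 0 <= x by rewrite fine_ge0.
rewrite -(fineK Mfin) -/x in up lo.
have p0 := pi_gt0 R.
apply/eqP; rewrite eq_le ler_pdivlMr ?ler_pdivrMr ?exprn_gt0//.
(* After clearing denominators each of the two estimates misses the claim by [x * l * h], which is
   made at most [e]. *)
have sm e : 0 < e -> exists2 h, 0 < h & h < l /\ x * l * h <= e.
  move=> e0; exists (Num.min (l / 2) (e / (x * l + 1))).
    by rewrite lt_min !divr_gt0// ltr_wpDl// mulr_ge0// ltW.
  have xl : 0 < x * l + 1 by rewrite ltr_wpDl// mulr_ge0// ltW.
  split; first by rewrite gt_min; apply/orP; left; rewrite ltr_pdivrMr// ltr_pMr// ltr1n.
  apply: (@le_trans _ _ ((x * l + 1) * (e / (x * l + 1)))).
    rewrite ler_pM ?mulr_ge0 ?(ltW l0)//.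
    - by rewrite le_min !divr_ge0 ?(ltW xl) ?(ltW e0) ?(ltW l0).
    - by rewrite lerDl.
    - by rewrite ge_min lexx orbT.
  by rewrite mulrCA divff ?mulr1// gt_eqF.
apply/andP; split; apply/ler_addgt0Pl => e e0.
  have [h h0 [hl hx]] := sm e e0; have := up h h0 hl; rewrite -EFinM -EFinD lee_fin.
  have lh : 0 < l - h by rewrite subr_gt0.
  rewrite -(ler_pM2r (mulr_gt0 l0 lh)).
  have -> : pi / (l - h) * (l * (l - h)) = pi * l by field; rewrite gt_eqF.
  have -> : (h * x + pi / l) * (l * (l - h)) = h * x * l * (l - h) + pi * (l - h).
    by field; rewrite gt_eqF.
  by move: hx h0; nra.
have [h h0 [hl hx]] := sm e e0; have := lo h h0; rewrite -EFinM -EFinD lee_fin.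
have lh : 0 < l + h by rewrite addr_gt0.
rewrite -(ler_pM2r (mulr_gt0 l0 lh)).
have -> : pi / l * (l * (l + h)) = pi * (l + h) by field; rewrite gt_eqF.
have -> : (h * x + pi / (l + h)) * (l * (l + h)) = h * x * l * (l + h) + pi * l.
  by field; rewrite gt_eqF.
by move: hx h0; nra.
Qed.

End PlaneGauss.

Section Cn.
Context (R : realType) (n : nat).
Local Notation Cn := ('rV[R[i]]_n).
Local Notation RT := (measurableTypeR R).
Implicit Types (z w u a : Cn) (t : {posnum R}).
Local Notation leb := (@lebesgueCn R n).
Local Notation mu t := (@gaussCn R n t).

Lemma Cmeas_coord (j : 'I_n) : Cmeas (fun z : Cn => z 0 j).
Proof.
have m12 : measurable_fun setT
    (fun z : Cn => (Re (z 0 j), Im (z 0 j)) : RT * RT).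
  rewrite (_ : (fun z => _) = (@tnth _ (RT * RT)%type ^~ j) \o @to_real R n).
    apply: measurableT_comp; first exact: measurable_tnth.
    exact: measurable_to_real.
  by apply/funext => z /=; rewrite tnth_mktuple.
split; first exact: (measurableT_comp measurable_fst m12).
exact: (measurableT_comp measurable_snd m12).
Qed.

Lemma measurable_toCn d (T : measurableType d) (f : T -> Cn) :
  (forall j, Cmeas (fun x => f x 0 j)) -> measurable_fun setT f.
Proof.
move=> mf _ _ [A mA <-]; rewrite !setTI -comp_preimage.
suff : measurable_fun setT (@to_real R n \o f) by rewrite -[X in measurable X]setTI; exact.
apply/measurable_fun_tnthP => j /=.
rewrite (_ : _ \o _ = fun x => (Re (f x 0 j), Im (f x 0 j))); last first.
  by apply/funext => x /=; rewrite tnth_mktuple.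
by have [? ?] := mf j; exact: measurable_pairR.
Qed.

Definition herm z w : R[i] := \sum_j z 0 j * (w 0 j)^*.

Lemma hermDl z w u : herm (z + w) u = herm z u + herm w u.
Proof. by rewrite -big_split; apply: eq_bigr => j _; rewrite mxE mulrDl. Qed.

Lemma hermDr z w u : herm u (z + w) = herm u z + herm u w.
Proof. by rewrite -big_split; apply: eq_bigr => j _; rewrite mxE rmorphD mulrDr. Qed.

Lemma hermZl (c : R[i]) z w : herm (c *: z) w = c * herm z w.
Proof. by rewrite mulr_sumr; apply: eq_bigr => j _; rewrite mxE mulrA. Qed.

Lemma hermJ z w : (herm z w)^* = herm w z.
Proof.
rewrite /herm rmorph_sum; apply: eq_bigr => j _.
by rewrite rmorphM /= conjcK mulrC.
Qed.

Lemma sqnormE z : sqnorm z = \sum_j normc (z 0 j) ^+ 2.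
Proof. by apply: eq_bigr => j _; rewrite normc_sqr. Qed.

Lemma herm_sqnorm z : herm z z = (sqnorm z)%:C.
Proof.
rewrite sqnormE rmorph_sum; apply: eq_bigr => j _; exact: mulcJ.
Qed.

Lemma sqnorm_ge0 z : 0 <= sqnorm z.
Proof. by rewrite sqnormE sumr_ge0// => j _; rewrite sqr_ge0. Qed.

Lemma sqnormD z w : sqnorm (z + w) = sqnorm z + 2 * Re (herm z w) + sqnorm w.
Proof.
have e x : sqnorm x = Re (herm x x) by rewrite herm_sqnorm.
rewrite !e hermDl !hermDr !ReD -[herm w z]hermJ ReJ; ring.
Qed.

Lemma sqnormN z : sqnorm (- z) = sqnorm z.
Proof. by rewrite !sqnormE; apply: eq_bigr => j _; rewrite mxE normcN. Qed.

Lemma normc_coord_sqr z j : normc (z 0 j) ^+ 2 <= sqnorm z.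
Proof.
by rewrite sqnormE (bigD1 j)//= lerDl sumr_ge0// => k _; rewrite sqr_ge0.
Qed.

Lemma Cmeas_herm d (T : measurableType d) (f g : T -> Cn) :
  measurable_fun setT f -> measurable_fun setT g -> Cmeas (fun x => herm (f x) (g x)).
Proof.
move=> mf mg; apply: Cmeas_sum => j; apply: CmeasM.
  exact: Cmeas_comp mf (Cmeas_coord j).
by apply: CmeasJ; exact: Cmeas_comp mg (Cmeas_coord j).
Qed.

Lemma measurable_sqnorm d (T : measurableType d) (f : T -> Cn) :
  measurable_fun setT f -> measurable_fun setT (fun x => sqnorm (f x)).
Proof.
move=> mf; have [+ _] := Cmeas_herm mf mf.
by under eq_fun do rewrite herm_sqnorm.
Qed.

Lemma measurable_addCn d (T : measurableType d) (f g : T -> Cn) :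
  measurable_fun setT f -> measurable_fun setT g -> measurable_fun setT (fun x => f x + g x).
Proof.
move=> mf mg; apply: measurable_toCn => j; under eq_fun do rewrite mxE.
by apply: CmeasD; exact: Cmeas_comp (Cmeas_coord j).
Qed.

Lemma measurable_oppCn d (T : measurableType d) (f : T -> Cn) :
  measurable_fun setT f -> measurable_fun setT (fun x => - f x).
Proof.
move=> mf; apply: measurable_toCn => j; under eq_fun do rewrite mxE.
by apply: CmeasN; exact: Cmeas_comp (Cmeas_coord j).
Qed.

Lemma measurable_scaleCn d (T : measurableType d) (c : T -> R[i]) (f : T -> Cn) :
  Cmeas c -> measurable_fun setT f -> measurable_fun setT (fun x => c x *: f x).
Proof.
move=> mc mf; apply: measurable_toCn => j; under eq_fun do rewrite mxE.
by apply: CmeasM => //; exact: Cmeas_comp (Cmeas_coord j).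
Qed.

Lemma mpres_of_real : mpres (tuple_power (@lebesgueC R) n) leb (@of_real R n).
Proof.
by apply: mpres_pushforward => //; exact: measurable_of_real.
Qed.

Lemma lebesgueCn_integral (f : Cn -> \bar R) : measurable_fun setT f ->
  (forall z, 0 <= f z)%E ->
  (\int[leb]_z f z = \int[tuple_power (@lebesgueC R) n]_x f (of_real x))%E.
Proof. by have [_ h] := mpres_of_real => mf f0; rewrite h. Qed.

(** The measure of C^n is a transported power of the plane measure, so coordinatewise maps reduce to
    maps of the plane. Translations and multiplications by phases are the two uses. *)
Lemma mpres_coordwise (tau : 'I_n -> R[i] -> R[i]) :
  (forall j, mpres (@lebesgueC R) (@lebesgueC R)
    (fun x : RT * RT => (Re (tau j (x.1 +i* x.2)), Im (tau j (x.1 +i* x.2))))) ->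
  mpres leb leb (fun z => \row_j tau j (z 0 j)).
Proof.
move=> mt; pose T j (x : RT * RT) : RT * RT :=
  (Re (tau j (x.1 +i* x.2)), Im (tau j (x.1 +i* x.2))).
have E : (fun z => \row_j tau j (z 0 j)) = @of_real R n \o tmap T \o @to_real R n.
  apply/funext => z; apply/rowP => j.
  rewrite !mxE /= !tnth_mktuple /T /=.
  by case: (z 0 j) => x y /=; case: (tau j _).
have [mT hT] := mpres_tmap mt.
have mtau : measurable_fun setT (fun z : Cn => \row_j tau j (z 0 j)).
  rewrite E; apply: measurableT_comp; last exact: measurable_to_real.
  by apply: measurableT_comp => //; exact: measurable_of_real.
split=> // f mf f0; rewrite !lebesgueCn_integral//; last exact: measurableT_comp.
have mfo : measurable_fun setT (f \o @of_real R n).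
  exact: measurableT_comp mf (@measurable_of_real R n).
rewrite -(hT (f \o @of_real R n) mfo (fun x => f0 _)).
apply: eq_integral => x _; congr f; apply/rowP => j.
rewrite !mxE /= !tnth_mktuple /T.
by case: (tau j _).
Qed.

Lemma mpres_translationCn a : mpres leb leb (fun z => a + z).
Proof.
have := @mpres_coordwise (fun j x => x + a 0 j) _.
rewrite (_ : (fun z => \row_j (z 0 j + a 0 j)) = (fun z => a + z)); last first.
  by apply/funext => z; apply/rowP => j; rewrite !mxE addrC.
apply=> j; rewrite (_ : (fun _ => _) = (fun x : RT * RT =>
    ((x.1 + Re (a 0 j))%R : RT, (x.2 + Im (a 0 j))%R : RT))).
  exact: mpres_translationC.
by apply/funext => x /=; rewrite ReD ImD.
Qed.

Let mpres_rotC (c : R[i]) : normc c = 1 -> mpres (@lebesgueC R) (@lebesgueC R)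
  (fun x : RT * RT => (Re (c * (x.1 +i* x.2)), Im (c * (x.1 +i* x.2)))).
Proof.
move=> c1; rewrite (_ : (fun _ => _) = (fun x : RT * RT =>
    ((Re c * x.1 - Im c * x.2)%R : RT, (Im c * x.1 + Re c * x.2)%R : RT))).
  by apply: mpres_rotation; rewrite -normc_sqr c1 expr1n.
by apply/funext => x /=; rewrite ReM ImM /=; congr pair; rewrite addrC.
Qed.

Lemma mpres_phases (c : 'I_n -> R[i]) : (forall j, normc (c j) = 1) ->
  mpres leb leb (fun z => \row_j (c j * z 0 j)).
Proof.
move=> c1; apply: (@mpres_coordwise (fun j x => c j * x)) => j.
exact: mpres_rotC.
Qed.

Lemma gauss_transfers t : transfers leb (mu t) id (gauss_density t).
Proof.
split => //; [exact: measurable_gauss_density|exact: gauss_density_ge0|].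
move=> f mf f0; apply: density_integral => //.
- exact: measurable_gauss_density.
- exact: gauss_density_ge0.
Qed.

Lemma gauss_integral t (f : Cn -> \bar R) : measurable_fun setT f ->
  (forall z, 0 <= f z)%E ->
  (\int[mu t]_z f z = \int[leb]_z (f z * (gauss_density t z)%:E))%E.
Proof. by have [_ _ _ h] := gauss_transfers t; exact: h. Qed.

Lemma gauss_density_prod t (x : n.-tuple (RT * RT)) :
  gauss_density t (of_real x) = \prod_(j < n) ((pi * t%:num)^-1 *
    expR (- (t%:num^-1 * (((tnth x j).1 : R) ^+ 2 + ((tnth x j).2 : R) ^+ 2)))).
Proof.
rewrite big_split prodr_const card_ord exprVn; congr *%R.
transitivity (expR (\sum_(j < n) - (t%:num^-1 *
    (((tnth x j).1 : R) ^+ 2 + ((tnth x j).2 : R) ^+ 2)))); last exact: expR_sum.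
congr expR; rewrite /sqnorm -sumrN mulr_suml.
by apply: eq_bigr => j _; rewrite mxE /= mulNr mulrC.
Qed.

Let gauss_prod t (phi : 'I_n -> RT * RT -> R) (c : 'I_n -> R) (F : Cn -> R) :
  measurable_fun setT F -> (forall z, 0 <= F z) ->
  (forall j, measurable_fun setT (phi j)) -> (forall j x, 0 <= phi j x) ->
  (forall x, F (of_real x) = \prod_(j < n) phi j (tnth x j)) ->
  (forall j, \int[@lebesgueC R]_x (phi j x * ((pi * t%:num)^-1 *
    expR (- (t%:num^-1 * ((x.1 : R) ^+ 2 + (x.2 : R) ^+ 2)))))%:E = (c j)%:E)%E ->
  (\int[mu t]_z (F z)%:E = (\prod_(j < n) c j)%:E)%E.
Proof.
move=> mF F0 mphi phi0 FE hc.
have mFE : measurable_fun setT (EFin \o F) by exact/measurable_EFinP.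
have mg := @measurable_gauss_density R n t.
rewrite (gauss_integral t mFE) => [|z]; last by rewrite lee_fin.
rewrite lebesgueCn_integral; last 2 first.
- by apply: emeasurable_funM => //; exact/measurable_EFinP.
- by move=> z; rewrite mule_ge0 ?lee_fin// gauss_density_ge0.
rewrite -(tuple_power_prod (m := @lebesgueC R) _ _ hc).
- apply: eq_integral => x _; rewrite /= -EFinM FE gauss_density_prod.
  by rewrite -big_split.
- move=> j; apply: measurable_funM => //; apply: measurable_funM => //.
  apply: (measurableT_comp (@measurable_expR R)) => //; apply: measurableT_comp => //.
  by apply: measurable_funM => //; apply: measurable_funD; exact: measurable_funX.
- by move=> j x; rewrite !mulr_ge0 ?expR_ge0// invr_ge0 mulr_ge0 ?pi_ge0.
Qed.

Let gauss_one t : (\int[@lebesgueC R]_x (1 * ((pi * t%:num)^-1 *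
    expR (- (t%:num^-1 * ((x.1 : R) ^+ 2 + (x.2 : R) ^+ 2)))))%:E = 1%:E)%E.
Proof.
have pt : 0 < pi * t%:num by rewrite mulr_gt0 ?pi_gt0.
under eq_integral do rewrite mul1r EFinM.
rewrite ge0_integralZl//.
- rewrite (@integral_gauss2 _ (t%:num^-1)) ?invr_gt0// -EFinM invrK mulVf//.
  by rewrite gt_eqF.
- apply/measurable_EFinP.
  apply: (measurableT_comp (@measurable_expR R)) => //; apply: measurableT_comp => //.
  by apply: measurable_funM => //; apply: measurable_funD; exact: measurable_funX.
- by rewrite lee_fin invr_ge0 (ltW pt).
Qed.

Lemma gauss_mass t : mu t setT = 1%E.
Proof.
transitivity (\int[mu t]_z 1%:E)%E; first by rewrite integral_cst// mul1e.
rewrite (gauss_prod (phi := fun _ _ => 1) (c := fun=> 1))//.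
- by rewrite big1.
- by move=> x; rewrite big1.
Qed.

Lemma gauss_moment2 t k : (\int[mu t]_z (normc (z 0 k) ^+ 2)%:E = (t%:num)%:E)%E.
Proof.
pose phi j (x : RT * RT) : R :=
  if j == k then (x.1 : R) ^+ 2 + (x.2 : R) ^+ 2 else 1.
pose c (j : 'I_n) : R := if j == k then t%:num else 1.
have m2 : measurable_fun setT (fun x : RT * RT => (x.1 : R) ^+ 2 + (x.2 : R) ^+ 2).
  by apply: measurable_funD; exact: measurable_funX.
rewrite (gauss_prod (phi := phi) (c := c)).
- by rewrite (bigD1 k)//= big1 ?mulr1 /c ?eqxx// => j /negPf ->.
- by apply: measurable_funX; exact: Cmeas_normc (Cmeas_coord k).
- by move=> z; exact: sqr_ge0.
- by move=> j; rewrite /phi; case: (j == k).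
- by move=> j x; rewrite /phi; case: (j == k) => //; rewrite addr_ge0 ?sqr_ge0.
- move=> x; rewrite (bigD1 k)//= [X in _ * X]big1 ?mulr1 /phi ?eqxx.
    by rewrite normc_sqr mxE.
  by move=> j /negPf ->.
move=> j; rewrite /phi /c; case: (j == k); last exact: gauss_one.
have pt : 0 < pi * t%:num by rewrite mulr_gt0 ?pi_gt0.
have mE : measurable_fun setT (fun x : RT * RT =>
    expR (- (t%:num^-1 * ((x.1 : R) ^+ 2 + (x.2 : R) ^+ 2)))).
  apply: (measurableT_comp (@measurable_expR R)) => //; apply: measurableT_comp => //.
  by apply: measurable_funM.
under eq_integral do rewrite mulrCA EFinM.
rewrite ge0_integralZl//.
- rewrite (@integral_gauss2_moment _ (t%:num^-1)) ?invr_gt0// -EFinM; congr EFin.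
  have p0 : pi != 0 :> R by rewrite gt_eqF ?pi_gt0.
  have t0 : t%:num != 0 :> R by rewrite gt_eqF.
  by rewrite exprVn invrK invfM mulrACA mulVf// mul1r expr2 mulrA mulVf// mul1r.
- by apply/measurable_EFinP; exact: measurable_funM.
- by move=> x _; rewrite lee_fin mulr_ge0 ?expR_ge0// addr_ge0 ?sqr_ge0.
- by rewrite lee_fin invr_ge0 (ltW pt).
Qed.

Lemma mpres_gauss_phases t (c : 'I_n -> R[i]) : (forall j, normc (c j) = 1) ->
  mpres (mu t) (mu t) (fun z => \row_j (c j * z 0 j)).
Proof.
move=> c1; have [mc hc] := mpres_phases c1; split=> // f mf f0.
have mg := @measurable_gauss_density R n t.
rewrite (gauss_integral t mf f0).
rewrite (gauss_integral t (measurableT_comp mf mc) (fun z => f0 _)).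
rewrite -[RHS](hc (fun z => (f z * (gauss_density t z)%:E)%E)).
- apply: eq_integral => z _; rewrite /gauss_density [in RHS](_ : sqnorm _ = sqnorm z)//.
  rewrite !sqnormE; apply: eq_bigr => j _.
  by rewrite mxE Normc.normcM c1 mul1r.
- by apply: emeasurable_funM => //; exact/measurable_EFinP.
- by move=> z; rewrite mule_ge0// lee_fin gauss_density_ge0.
Qed.

(** The factor is the ratio of the Gaussian densities at a + z and at z. In [reproducing_weight] it
    multiplies the kernel, and turns the antiholomorphic dependence of e^{<z, z + u>/t} on u into
    the holomorphic e^{-<u, z>/t}. *)
Lemma gauss_translation t a : transfers (mu t) (mu t) (fun z => a + z)
  (fun z => expR ((sqnorm z - sqnorm (a + z)) / t%:num)).
Proof.
have [mt ht] := mpres_translationCn a.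
have mr : measurable_fun setT (fun z => expR ((sqnorm z - sqnorm (a + z)) / t%:num)).
  apply: (measurableT_comp (@measurable_expR R)) => //; apply: measurable_funM => //.
  apply: measurable_funB; apply: measurable_sqnorm => //.
have mg := @measurable_gauss_density R n t.
split=> // f mf f0.
rewrite (gauss_integral t mf f0).
rewrite -[LHS](ht (fun z => (f z * (gauss_density t z)%:E)%E)); last 2 first.
- by apply: emeasurable_funM => //; exact/measurable_EFinP.
- by move=> z; rewrite mule_ge0// lee_fin gauss_density_ge0.
rewrite gauss_integral; last 2 first.
- apply: emeasurable_funM; first exact: measurableT_comp mf mt.
  exact/measurable_EFinP.
- by move=> z; rewrite mule_ge0// lee_fin expR_ge0.
apply: eq_integral => z _; rewrite -muleA -EFinM.
suff -> : gauss_density t (a + z) =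
  expR ((sqnorm z - sqnorm (a + z)) / t%:num) * gauss_density t z by [].
rewrite /gauss_density mulrCA -expRD -mulrDl.
by rewrite [sqnorm z - _]addrC addrK.
Qed.

End Cn.

Section GaussInstance.
Context (R : realType) (n : nat) (t : {posnum R}).

Let gauss_fin : fin_num_fun (@gaussCn R n t).
Proof.
apply: lty_fin_num_fun; rewrite [X in (X < _)%E](_ : _ = 1%E) ?ltry//.
exact: gauss_mass.
Qed.

HB.instance Definition _ := Measure_isFinite.Build _ _ _ (@gaussCn R n t) gauss_fin.

End GaussInstance.

(** * Mean value and reproducing properties *)

Section CircleMeanComplex.
Context (R : realType).
Local Notation leb := (@lebesgue_measure R).
Local Notation RT := (measurableTypeR R).

(** The restriction to one period is a weight, so that the circle average is an integral over the
    whole line, as [Cfubini] expects. *)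
Definition turn (y : R) : R := \1_`[0 : R, 2 * pi]%classic y.

Lemma turn_ge0 y : 0 <= turn y. Proof. by rewrite /turn indicE. Qed.

Lemma measurable_turn : measurable_fun setT (turn : RT -> RT).
Proof. exact: measurable_indic. Qed.

Let turnE (f : R -> R) : (fun y => turn y * f y) = f \_ `[0 : R, 2 * pi]%classic.
Proof.
apply/funext => y; rewrite patchE /turn indicE.
by case: ifPn; rewrite ?mul1r ?mul0r.
Qed.

Lemma Rintegral_turn (f : R -> R) :
  \int[leb]_y (turn y * f y) = \int[leb]_(y in `[0 : R, 2 * pi]) f y.
Proof. by rewrite [RHS]Rintegral_mkcond turnE. Qed.

Lemma integrable_turn (f : R -> R) : continuous f ->
  leb.-integrable setT (EFin \o (fun y => turn y * f y)).
Proof.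
move=> cf; rewrite turnE -restrict_EFin; apply/integrable_restrict => //.
by rewrite setTI; exact: continuous_integrable_segment.
Qed.

Lemma integral_turn : (\int[leb]_y (turn y)%:E = (2 * pi)%:E)%E.
Proof.
rewrite /turn integral_indic//= setIT lebesgue_measure_itv/= lte_fin.
by rewrite mulr_gt0 ?pi_gt0// oppr0 adde0.
Qed.

(** The imaginary part of [phi] is the real part of - i phi, so [circle_mean] is applied to both
    functions. *)
Lemma circle_meanC (phi : R[i] -> R[i]) : holo phi ->
  Cibl leb (fun y : RT => (turn y)%:C * phi (cexp (0 +i* y))) /\
  Cint leb (fun y : RT => (turn y)%:C * phi (cexp (0 +i* y))) = (2 * pi)%:C * phi 0.
Proof.
move=> hphi; have hpsi : holo (phi \o @cexp R) := holo_comp hphi (@cexp_holo R).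
have hN : holo (fun z => (- 'i%C) * phi z) by apply: holoM => //; exact: holo_cst.
have hpsiN : holo ((fun z => (- 'i%C) * phi z) \o @cexp R) := holo_comp hN (@cexp_holo R).
have ImE (z : R[i]) : Im z = Re ((- 'i%C) * z) by rewrite ReM ReN ImN /=; ring.
have cR : continuous (fun y : R => Re (phi (cexp (0 +i* y)))).
  exact: holo_continuous_Re hpsi.
have cI : continuous (fun y : R => Im (phi (cexp (0 +i* y)))).
  rewrite (_ : (fun y => _) = (fun y => Re ((- 'i%C) * phi (cexp (0 +i* y))))).
    exact: holo_continuous_Re hpsiN.
  by apply/funext => y; rewrite ImE.
have eR y : Re ((turn y)%:C * phi (cexp (0 +i* y))) = turn y * Re (phi (cexp (0 +i* y))).
  by rewrite ReM /= mul0r subr0.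
have eI y : Im ((turn y)%:C * phi (cexp (0 +i* y))) = turn y * Im (phi (cexp (0 +i* y))).
  by rewrite ImM /= mul0r addr0.
split.
  apply: Cibl_parts; first by under eq_fun do rewrite eR; exact: integrable_turn cR.
  by under eq_fun do rewrite eI; exact: integrable_turn cI.
apply: complex_eqP => /=.
  under eq_Rintegral do rewrite eR.
  by rewrite Rintegral_turn circle_mean// ReM /= mul0r subr0.
under eq_Rintegral do rewrite eI ImE.
rewrite Rintegral_turn (circle_mean hN) -ImE ImM /=.
by rewrite mul0r addr0.
Qed.

End CircleMeanComplex.

Section GaussianMeanValue.
Context (R : realType) (n : nat) (t : {posnum R}).
Local Notation Cn := ('rV[R[i]]_n).
Local Notation mu := (@gaussCn R n t).
Local Notation leb := (@lebesgue_measure R).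
Local Notation RT := (measurableTypeR R).
Implicit Types (z w u a : Cn).

(* All circles [th |-> cexp (i th) *: w] are averaged simultaneously, which
   avoids polar coordinates. *)
Lemma gauss_mean_value (rho F : Cn -> R[i]) :
  (forall (c : R[i]) w, normc c = 1 -> rho (c *: w) = rho w) ->
  (forall w, holo (fun c => F (c *: w))) -> Cmeas F ->
  Cibl mu rho -> Cibl mu (fun w => rho w * F w) ->
  Cint mu (fun w => rho w * F w) = F 0 * Cint mu rho.
Proof.
move=> rot hF mF irho iF; set I := Cint mu _.
have mrho := Cibl_meas irho; have mrF := Cibl_meas iF.
pose e (y : R) : R[i] := cexp (0 +i* y).
have e1 y : normc (e y) = 1 by rewrite normc_cexp expR0.
have mp y : mpres mu mu (fun w => e y *: w).
  have := @mpres_gauss_phases R n t (fun=> e y) (fun=> e1 y).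
  by rewrite (_ : (fun z => _) = (fun w => e y *: w))//; apply/funext => w;
    apply/rowP => j; rewrite !mxE.
(* Integrated first in w, G gives [I] for each angle by rotation invariance; integrated first in the
   angle, it gives F 0 by the mean value property on the circle through w. *)
pose G (p : RT * Cn) : R[i] := (turn p.1)%:C * (rho p.2 * F (e p.1 *: p.2)).
have me : Cmeas (fun p : RT * Cn => e p.1).
  apply: Cmeas_cexp; split => /=; first exact: measurable_cst.
  exact: measurable_fst.
have mG : Cmeas G.
  apply: CmeasM.
    by apply: Cmeas_real; exact: measurableT_comp (@measurable_turn R) measurable_fst.
  apply: CmeasM; first exact: Cmeas_comp measurable_snd mrho.
  apply: Cmeas_comp mF; apply: measurable_scaleCn => //; exact: measurable_snd.
have iy y : Cibl mu (fun w => rho w * F (e y *: w)).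
  have /(mpres_Cibl (mp y) mrF) := iF.
  by under eq_fun do rewrite rot//.
have Iy y : Cint mu (fun w => rho w * F (e y *: w)) = I.
  rewrite /I (mpres_Cint (mp y) mrF); apply: eq_Cint => w.
  by rewrite rot.
have i1 y : Cibl mu (fun w => G (y, w)) by exact: (CiblZ (turn y)%:C (iy y)).
have i2 w : Cibl leb (fun y : RT => G (y, w)).
  have [ic _] := circle_meanC (hF w).
  rewrite (_ : (fun y => _) = (fun y : RT => rho w * ((turn y)%:C * F (e y *: w)))).
    exact: (CiblZ (rho w) ic).
  by apply/funext => y; rewrite /G /= mulrCA.
have nI : (\int[leb]_y \int[mu]_w (normc (G (y, w)))%:E < +oo)%E.
  have Ny y : (\int[mu]_w (normc (G (y, w)))%:E =
      (turn y)%:E * \int[mu]_w (normc (rho w * F w))%:E)%E.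
    transitivity (\int[mu]_w ((turn y)%:E * (normc (rho w * F (e y *: w)))%:E))%E.
      by apply: eq_integral => w _; rewrite /G Normc.normcM normc_real ger0_norm ?turn_ge0.
    rewrite ge0_integralZl//; last 3 first.
    - by apply/measurable_EFinP; apply: Cmeas_normc; exact: Cibl_meas (iy y).
    - by move=> w _; rewrite lee_fin normc_ge0.
    - by rewrite lee_fin turn_ge0.
    congr (_ * _)%E.
    have [_ h] := mp y; rewrite -(h (fun w => (normc (rho w * F w))%:E)).
    - by apply: eq_integral => w _; rewrite rot.
    - by apply/measurable_EFinP; exact: Cmeas_normc.
    - by move=> w; rewrite lee_fin normc_ge0.
  under eq_integral do rewrite Ny.
  have N0 : (0 <= \int[mu]_w (normc (rho w * F w))%:E)%E.
    by apply: integral_ge0 => w _; rewrite lee_fin normc_ge0.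
  rewrite ge0_integralZr//; last 2 first.
  - by apply/measurable_EFinP; exact: measurable_turn.
  - by move=> y _; rewrite lee_fin turn_ge0.
  rewrite integral_turn lte_mul_pinfty// ?lee_fin ?mulr_ge0 ?pi_ge0//.
  by case: iF.
have := Cfubini mG nI i1 i2.
have -> : Cint leb (fun y : RT => Cint mu (fun w => G (y, w))) = (2 * pi)%:C * I.
  have [ic hc] := circle_meanC (holo_cst I).
  rewrite -hc; apply: eq_Cint => y.
  by rewrite -[in RHS](Iy y) -CintZ.
have -> : Cint mu (fun w => Cint leb (fun y : RT => G (y, w))) =
    (2 * pi)%:C * (F 0 * Cint mu rho).
  rewrite mulrA -CintZ//; apply: eq_Cint => w.
  have [ic hc] := circle_meanC (hF w).
  rewrite scale0r in hc; rewrite -hc mulrC -CintZ//; apply: eq_Cint => y.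
  by rewrite /G /= mulrCA.
apply: mulfI; apply/eqP => -[/eqP].
by rewrite mulf_eq0 (gt_eqF (pi_gt0 R)) orbF pnatr_eq0.
Qed.

End GaussianMeanValue.

(** * The reproducing kernel and integrability against exponentials *)

Section FockKernel.
Context (R : realType) (n : nat) (t : {posnum R}).
Local Notation Cn := ('rV[R[i]]_n).
Local Notation mu := (@gaussCn R n t).
Local Notation leb := (@lebesgueCn R n).
Local Notation T := (t%:num : R).
Implicit Types (z w u a : Cn) (F G h : Cn -> R[i]) (c k M : R).

Definition enorm z : R := Num.sqrt (sqnorm z).

Lemma enorm_ge0 z : 0 <= enorm z. Proof. exact: sqrtr_ge0. Qed.

Lemma enorm_sqr z : enorm z ^+ 2 = sqnorm z.
Proof. by rewrite sqr_sqrtr// sqnorm_ge0. Qed.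

Lemma normc_coord z j : normc (z 0 j) <= enorm z.
Proof.
rewrite -[leLHS]ger0_norm ?normc_ge0// -sqrtr_sqr ler_sqrt ?sqnorm_ge0//.
exact: normc_coord_sqr.
Qed.

Lemma measurable_enorm d (X : measurableType d) (f : X -> Cn) :
  measurable_fun setT f -> measurable_fun setT (fun x => enorm (f x)).
Proof.
move=> mf; apply: (measurableT_comp (continuous_measurable_fun (@sqrt_continuous R))).
exact: measurable_sqnorm.
Qed.

Lemma measurable_expR_comp d (X : measurableType d) (f : X -> R) :
  measurable_fun setT f -> measurable_fun setT (fun x => expR (f x)).
Proof. exact: (measurableT_comp (@measurable_expR R)). Qed.

(** The l^1 norm bounds <z, w> term by term, giving the exponential growth rate of the kernel in w,
    and is at most n times the sup norm in which differentiability is expressed. *)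
Definition lnorm1 z : R := \sum_j normc (z 0 j).

Lemma lnorm1_ge0 z : 0 <= lnorm1 z.
Proof. by rewrite sumr_ge0// => j _; exact: normc_ge0. Qed.

Lemma normc_herm z w : normc (herm z w) <= lnorm1 z * enorm w.
Proof.
rewrite (le_trans (le_normc_sum _ _ _))// mulr_suml ler_sum// => j _.
by rewrite Normc.normcM normcJ ler_wpM2l ?normc_ge0// normc_coord.
Qed.

Definition fockK z w : R[i] := cexp (herm z w / T%:C).

Lemma Re_divT (x : R[i]) : Re (x / T%:C) = Re x / T.
Proof. by rewrite -rmorphV ?unitfE ?gt_eqF// ReM /= mulr0 subr0. Qed.

Lemma normc_fockK z w : normc (fockK z w) = expR (Re (herm z w) / T).
Proof. by rewrite normc_cexp Re_divT. Qed.

Lemma fockKJ z w : (fockK z w)^* = fockK w z.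
Proof.
have e (x : R[i]) : x / T%:C = x * (T^-1)%:C by rewrite rmorphV ?unitfE ?gt_eqF.
rewrite /fockK cexpJ !e -[herm w z]hermJ; congr cexp.
by apply: complex_eqP; rewrite !ReImE /=; ring.
Qed.

Lemma normc_fockK_le z w : normc (fockK z w) <= expR (lnorm1 z / T * enorm w).
Proof.
rewrite normc_fockK ler_expR mulrAC ler_wpM2r ?invr_ge0//.
exact: le_trans (le_trans (ler_norm _) (normr_Re _)) (normc_herm _ _).
Qed.

Lemma Cmeas_fockK d (X : measurableType d) (f g : X -> Cn) :
  measurable_fun setT f -> measurable_fun setT g ->
  Cmeas (fun x => fockK (f x) (g x)).
Proof.
move=> mf mg; apply: Cmeas_cexp; apply: CmeasM; last exact: Cmeas_cst.
exact: Cmeas_herm.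
Qed.

(* The weight [expR (sqnorm w / (2 t))] is the one used in Schur's test. *)
Lemma fockK_weight z :
  (\int[mu]_w (normc (fockK z w) * expR (sqnorm (w - z) / (4 * T)) *
     expR (sqnorm w / (2 * T)))%:E = (4 ^+ n * expR (sqnorm z / (2 * T)))%:E)%E.
Proof.
have mw : measurable_fun setT (fun w : Cn => w - z).
  by apply: measurable_addCn; [exact: measurable_id|exact: measurable_cst].
have ms (f : Cn -> Cn) k : measurable_fun setT f ->
    measurable_fun setT (fun w => expR (sqnorm (f w) / k)).
  by move=> mf; apply: measurable_expR_comp; apply: measurable_funM => //; exact: measurable_sqnorm.
have mF : measurable_fun setT (fun w => (normc (fockK z w) * expR (sqnorm (w - z) / (4 * T)) *
     expR (sqnorm w / (2 * T)))%:E).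
  apply/measurable_EFinP; apply: measurable_funM; last exact: ms.
  apply: measurable_funM; last exact: ms.
  by apply: Cmeas_normc; apply: Cmeas_fockK; [exact: measurable_cst|exact: measurable_id].
rewrite (gauss_integral t mF) => [|w]; last by rewrite lee_fin !mulr_ge0 ?normc_ge0 ?expR_ge0.
have t4 : 0 < 4 * T by rewrite mulr_gt0.
have tn0 : T != 0 by rewrite gt_eqF.
have pn0 : (pi : R) != 0 by rewrite gt_eqF ?pi_gt0.
(* After completing the square the integrand is a Gaussian of parameter 4 t centred at z. The ratio
   of the two normalizations is the 4^n. *)
pose s : {posnum R} := PosNum t4.
have mg := @measurable_gauss_density R n s.
transitivity (\int[leb]_w ((4 ^+ n * expR (sqnorm z / (2 * T)))%:E *
    (gauss_density s (- z + w))%:E))%E.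
  apply: eq_integral => w _; rewrite -!EFinM; congr EFin.
  have Q0 : 4 ^+ n != 0 :> R by rewrite expf_neq0// pnatr_eq0.
  have e1 : (pi * (4 * T)) ^- n = 4 ^- n * (pi * T) ^- n by rewrite mulrCA exprMn invfM.
  rewrite normc_fockK /gauss_density /= e1.
  rewrite [RHS](_ : _ = (pi * T) ^- n * (expR (sqnorm z / (2 * T)) *
    expR (- sqnorm (- z + w) / (4 * T)))); last first.
    by rewrite mulrACA [4 ^+ n * (_ * _)]mulrA mulfV// mul1r.
  rewrite mulrCA; congr (_ * _); rewrite -!expRD; congr expR.
  rewrite [- z + w]addrC sqnormD sqnormN.
  have -> : Re (herm w (- z)) = - Re (herm z w).
    rewrite -[- z]scaleN1r -hermJ hermZl rmorphM /= hermJ ReM /=.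
    by rewrite !oppr0 mul0r subr0 mulN1r -[herm w z]hermJ ReJ.
  by field.
have m1 : measurable_fun setT (fun w => (gauss_density s (- z + w))%:E).
  apply/measurable_EFinP; apply: (measurableT_comp mg).
  by apply: measurable_addCn; [exact: measurable_cst|exact: measurable_id].
rewrite ge0_integralZl//; last by move=> w _; rewrite lee_fin gauss_density_ge0.
have [_ h] := mpres_translationCn (- z).
rewrite (h (fun w => (gauss_density s w)%:E)).
- have := gauss_mass n s; rewrite /gaussCn => h1.
  by rewrite h1 mule1.
- exact/measurable_EFinP.
- by move=> w; rewrite lee_fin gauss_density_ge0.
Qed.

Lemma expR_quadratic (c x : R) : expR (c * x) <= expR (c ^+ 2 * (2 * T)) * expR (x ^+ 2 / (4 * T)).
Proof.
rewrite -expRD ler_expR.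
have -> : c ^+ 2 * (2 * T) + x ^+ 2 / (4 * T) =
   (c * (2 * T) - x) ^+ 2 / (4 * T) + c ^+ 2 * T + c * x.
  by field; rewrite gt_eqF.
by rewrite lerDr addr_ge0// mulr_ge0 ?sqr_ge0// invr_ge0 mulr_ge0.
Qed.

(** By completing the square e^{c|w|} is at most a constant times e^{|w|^2/4t}, and [fockK_weight]
    at z = 0 integrates this even with the extra factor e^{|w|^2/2t}. *)
Lemma Cibl_expR c : Cibl mu (fun w => (expR (c * enorm w))%:C).
Proof.
have m0 : measurable_fun setT (fun w : Cn => expR (c * enorm w)).
  by apply: measurable_expR_comp; apply: measurable_funM => //; exact: measurable_enorm.
have ms k : measurable_fun setT (fun w : Cn => expR (sqnorm w / k)).
  by apply: measurable_expR_comp; apply: measurable_funM => //; exact: measurable_sqnorm.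
have H := fockK_weight 0.
pose A := expR (c ^+ 2 * (2 * T)).
apply: (@le_Cibl _ _ _ _ _ (fun w => A * (expR (sqnorm w / (4 * T)) * expR (sqnorm w / (2 * T))))).
- exact: Cmeas_real.
- move=> w; rewrite normc_real ger0_norm ?expR_ge0// mulrA.
  rewrite (le_trans (expR_quadratic _ _))// enorm_sqr -/A.
  rewrite ler_peMr ?mulr_ge0 ?expR_ge0// -expR0 ler_expR.
  by rewrite divr_ge0 ?sqnorm_ge0 ?mulr_ge0.
- by apply: measurable_funM => //; exact: measurable_funM.
have m1 : measurable_fun setT (fun w : Cn =>
    (expR (sqnorm w / (4 * T)) * expR (sqnorm w / (2 * T)))%:E).
  by apply/measurable_EFinP; exact: measurable_funM.
under eq_integral do rewrite EFinM.
rewrite ge0_integralZl//; last by rewrite lee_fin expR_ge0.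
rewrite lte_mul_pinfty ?lee_fin ?expR_ge0//.
rewrite (_ : (\int[mu]_w _)%E = (4 ^+ n * expR (sqnorm (0 : Cn) / (2 * T)))%:E) ?ltry//.
rewrite -H; apply: eq_integral => w _; congr (_ * _)%:E.
rewrite subr0 normc_fockK (_ : herm 0 w = 0) ?mul0r ?expR0 ?mul1r//.
by rewrite /herm big1// => j _; rewrite mxE mul0r.
Qed.

(* Integrability against every exponential: this class contains [L^2] and is
   stable under multiplication by coordinates and by [fockK z]. *)
Definition nice F : Prop :=
  Cmeas F /\ forall c, Cibl mu (fun w => (expR (c * enorm w))%:C * F w).

Lemma nice_meas F : nice F -> Cmeas F. Proof. by case. Qed.

Lemma nice_Cibl F : nice F -> Cibl mu F.
Proof.
move=> [_ /(_ 0)]; under eq_fun do rewrite mul0r expR0 mul1r; exact.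
Qed.

Lemma nice_mul F G M k : nice F -> Cmeas G ->
  (forall w, normc (G w) <= M * expR (k * enorm w)) -> nice (fun w => G w * F w).
Proof.
move=> [mF iF] mG GM; split; first exact: CmeasM.
move=> c; apply: (@le_Cibl_normc _ _ _ _ _ (fun w => M%:C * ((expR ((c + k) * enorm w))%:C * F w))).
- apply: CmeasM; last exact: CmeasM.
  apply: Cmeas_real; apply: measurable_expR_comp; apply: measurable_funM => //.
  exact: measurable_enorm.
- move=> w; rewrite !Normc.normcM !normc_real !mulrA.
  rewrite ler_wpM2r ?normc_ge0// !(ger0_norm (expR_ge0 _)) mulrDl expRD.
  have M0 : 0 <= M.
    by have := le_trans (normc_ge0 _) (GM w); rewrite pmulr_lge0 ?expR_gt0.
  rewrite (ger0_norm M0) mulrA [M * _]mulrC -mulrA ler_wpM2l ?expR_ge0//.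
- exact: CiblZ (iF _).
Qed.

Lemma niceD F G : nice F -> nice G -> nice (fun w => F w + G w).
Proof.
move=> [mF iF] [mG iG]; split; first exact: CmeasD.
by move=> c; under eq_fun do rewrite mulrDr; exact: CiblD.
Qed.

Lemma niceZ (a : R[i]) F : nice F -> nice (fun w => a * F w).
Proof.
move=> [mF iF]; split; first by apply: CmeasM => //; exact: Cmeas_cst.
by move=> c; under eq_fun do rewrite mulrCA; exact: CiblZ.
Qed.

Lemma nice_one : nice (fun=> 1).
Proof.
split; first exact: Cmeas_cst.
by move=> c; under eq_fun do rewrite mulr1; exact: Cibl_expR.
Qed.

(** Because e^{c|w|} |F| <= e^{2c|w|} + |F|^2. *)
Lemma nice_sqr F : Cmeas F -> (\int[mu]_w (normc (F w) ^+ 2)%:E < +oo)%E -> nice F.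
Proof.
move=> mF iF; split=> // c.
have [mE iE] := Cibl_expR (2 * c).
have mexp k : measurable_fun setT (fun w : Cn => expR (k * enorm w)).
  by apply: measurable_expR_comp; apply: measurable_funM => //; exact: measurable_enorm.
have mN : measurable_fun setT (fun w => normc (F w) ^+ 2).
  by apply: measurable_funX; exact: Cmeas_normc.
apply: (@le_Cibl _ _ _ _ _ (fun w => expR (2 * c * enorm w) + normc (F w) ^+ 2)).
- by apply: CmeasM => //; exact: Cmeas_real.
- move=> w; rewrite Normc.normcM normc_real (ger0_norm (expR_ge0 _)).
  rewrite -mulrA expRM_natl.
  move: (expR _) (normc _) (expR_ge0 (c * enorm w)) (normc_ge0 (F w)) => x y x0 y0.
  by have := sqr_ge0 (x - y); have := mulr_ge0 x0 y0; nra.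
- exact: measurable_funD.
under eq_integral do rewrite EFinD.
rewrite ge0_integralD//; last 3 first.
- exact/measurable_EFinP.
- by move=> w _; rewrite lee_fin sqr_ge0.
- exact/measurable_EFinP.
rewrite lte_add_pinfty//.
rewrite (_ : (\int[mu]_x (expR _)%:E)%E =
  (\int[mu]_x (normc (expR (2 * c * enorm x))%:C)%:E)%E)//.
by apply: eq_integral => x _; rewrite normc_real ger0_norm ?expR_ge0.
Qed.

Lemma expR_ge_id (x : R) : x <= expR x.
Proof. by rewrite (le_trans _ (expR_ge1Dx x))// lerDr. Qed.

Lemma nice_coord F (b : R[i]) j : nice F -> nice (fun w => (w 0 j - b) * F w).
Proof.
move=> nF; apply: (@nice_mul _ _ (1 + normc b) 1) => //.
  by apply: CmeasB; [exact: Cmeas_coord|exact: Cmeas_cst].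
move=> w; rewrite mul1r (le_trans (le_normcB _ _))// mulrDl mul1r lerD//.
  exact: le_trans (normc_coord _ _) (expR_ge_id _).
rewrite ler_peMr ?normc_ge0// -expR0 ler_expR enorm_ge0//.
Qed.

Lemma nice_coordJ F (b : R[i]) j : nice F -> nice (fun w => (w 0 j - b)^* * F w).
Proof.
move=> nF; apply: (@nice_mul _ _ (1 + normc b) 1) => //.
  by apply: CmeasJ; apply: CmeasB; [exact: Cmeas_coord|exact: Cmeas_cst].
move=> w; rewrite mul1r normcJ (le_trans (le_normcB _ _))// mulrDl mul1r lerD//.
  exact: le_trans (normc_coord _ _) (expR_ge_id _).
rewrite ler_peMr ?normc_ge0// -expR0 ler_expR enorm_ge0//.
Qed.

Lemma nice_bounded F G M : nice F -> Cmeas G -> (forall w, normc (G w) <= M) ->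
  nice (fun w => G w * F w).
Proof.
move=> nF mG GM; apply: (@nice_mul _ _ M 0) => // w.
by rewrite mul0r expR0 mulr1.
Qed.

Lemma nice_fockK F z : nice F -> nice (fun w => fockK z w * F w).
Proof.
move=> nF; apply: (@nice_mul _ _ 1 (lnorm1 z / T)) => //.
  by apply: Cmeas_fockK; [exact: measurable_cst|exact: measurable_id].
by move=> w; rewrite mul1r normc_fockK_le.
Qed.

Lemma Cibl_fockK F z : nice F -> Cibl mu (fun w => F w * fockK z w).
Proof.
by move=> nF; under eq_fun do rewrite mulrC; exact/nice_Cibl/nice_fockK.
Qed.

End FockKernel.

Section Reproducing.
Context (R : realType) (n : nat) (t : {posnum R}).
Local Notation Cn := ('rV[R[i]]_n).
Local Notation mu := (@gaussCn R n t).
Local Notation T := (t%:num : R).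
Implicit Types (z w u a : Cn) (F G h : Cn -> R[i]).

(** Holomorphy on complex lines is what the mean value property consumes. It passes to products with
    coordinates and to exponentials by one-variable rules. *)
Definition line_holo h : Prop := forall z w, holo (fun c => h (z + c *: w)).

Lemma entire_line_holo h : entire h -> line_holo h.
Proof.
move=> eh z w a.
apply: (@differentiable_comp _ R[i]^o 'rV[R[i]^o]_n R[i]^o (fun c => z + c *: w) h) => //.
Qed.

Lemma line_holo_coord h (b : R[i]) j : line_holo h ->
  line_holo (fun w => (w 0 j - b) * h w).
Proof.
move=> hh z w; apply: holoM; last exact: hh.
rewrite (_ : (fun c => _) = (fun c => (z 0 j - b) + c * w 0 j)).
  by apply: holoD; [exact: holo_cst|apply: holoM; [exact: holo_id|exact: holo_cst]].
by apply/funext => c; rewrite !mxE; ring.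
Qed.

Lemma Cint_one : Cint mu (fun=> 1) = 1.
Proof.
apply: complex_eqP; rewrite /= Rintegral_cst//= ?mul0r// gauss_mass.
by rewrite mul1r.
Qed.

Lemma nice_mono k j : nice t (fun w => w 0 k * (w 0 j)^*).
Proof.
have := nice_coord 0 k (nice_coordJ 0 j (nice_one n t)).
by under eq_fun do rewrite !subr0 mulr1.
Qed.

Lemma Cint_moment2 k j : Cint mu (fun w => w 0 k * (w 0 j)^*) =
  if k == j then T%:C else 0.
Proof.
case: eqVneq => [->|kj].
  rewrite -[RHS]complexr0; under [LHS]eq_Cint do rewrite mulcJ.
  apply: complex_eqP => /=; last by rewrite Rintegral_cst//= mul0r.
  by rewrite /Rintegral gauss_moment2.
(* Changing the sign of the [k]-th coordinate alone preserves the measure and negates the integrand,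
   as j differs from k. *)
pose c (i : 'I_n) : R[i] := if i == k then -1 else 1.
have c1 i : normc (c i) = 1.
  by rewrite /c; case: ifP; rewrite ?normcN Normc.normc1.
have nm := nice_mono k j.
have := mpres_Cint (mpres_gauss_phases t c1) (nice_meas nm).
have -> : (fun z => (\row_j0 (c j0 * z 0 j0)) 0 k * ((\row_j0 (c j0 * z 0 j0)) 0 j)^*) =
    (fun z : Cn => - (z 0 k * (z 0 j)^*)).
  apply/funext => z; rewrite !mxE /c eqxx eq_sym (negPf kj) mul1r.
  by rewrite mulN1r mulNr.
rewrite CintN; last exact: nice_Cibl nm.
move: (Cint _ _) => x xN; apply/eqP; rewrite -[_ == 0](mulrn_eq0 x 2).
by rewrite mulr2n [X in X + _]xN addNr.
Qed.

(** Translating by z replaces h times the kernel by G u = h (z + u) e^{-<u, z>/t}, which is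
    holomorphic on lines through 0 and equals h z at 0; the mean value property then applies with
    weight [rho]. The weight 1 gives the reproducing formula, the weight w_k conj(w_j) the second
    moments. *)
Lemma reproducing_weight (rho h : Cn -> R[i]) z :
  (forall (c : R[i]) w, normc c = 1 -> rho (c *: w) = rho w) ->
  Cibl mu rho -> line_holo h -> Cmeas h ->
  Cibl mu (fun w => rho (w - z) * (h w * fockK t z w)) ->
  Cint mu (fun w => rho (w - z) * (h w * fockK t z w)) = h z * Cint mu rho.
Proof.
move=> rot irho hh mh iF; have mF := Cibl_meas iF.
have tr := gauss_translation t z.
pose G u := h (z + u) * cexp (- herm u z / T%:C).
have FG u : rho (z + u - z) * (h (z + u) * fockK t z (z + u)) *
    (expR ((sqnorm u - sqnorm (z + u)) / T))%:C = rho u * G u.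
  rewrite addrAC subrr add0r /G -!mulrA; congr (_ * (_ * _)).
  rewrite -cexp_real -cexpD; congr cexp.
  have e (x : R[i]) : x / T%:C = x * (T^-1)%:C by rewrite rmorphV ?unitfE ?gt_eqF.
  rewrite !e hermDr herm_sqnorm sqnormD -[herm u z]hermJ.
  by apply: complex_eqP; rewrite !ReImE /=; ring.
have iG : Cibl mu (fun u => rho u * G u).
  have /(transfers_Cibl tr mF) := iF.
  by under eq_fun do rewrite FG.
rewrite (transfers_Cint tr mF) (eq_Cint _ FG).
have G0 : h z = G 0.
  rewrite /G addr0 (_ : herm 0 z = 0) ?oppr0 ?mul0r ?cexp0 ?mulr1//.
  by rewrite /herm big1// => j _; rewrite mxE mul0r.
rewrite G0; apply: gauss_mean_value => //.
- move=> w; rewrite /G; apply: holoM; first exact: hh.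
  rewrite (_ : (fun c => _) = @cexp R \o (fun c => c * (- herm w z / T%:C))).
    apply: holo_comp; first exact: cexp_holo.
    by apply: holoM; [exact: holo_id|exact: holo_cst].
  by apply/funext => c /=; rewrite hermZl; congr cexp; rewrite -mulrN mulrA.
- apply: CmeasM.
    apply: Cmeas_comp mh; apply: measurable_addCn; first exact: measurable_cst.
    exact: measurable_id.
  apply: Cmeas_cexp; apply: CmeasM; last exact: Cmeas_cst.
  apply: CmeasN; apply: Cmeas_herm; first exact: measurable_id.
  exact: measurable_cst.
Qed.

Lemma reproducing h z : nice t h -> line_holo h ->
  Cint mu (fun w => h w * fockK t z w) = h z.
Proof.
move=> nh hh; have := @reproducing_weight (fun=> 1) h z (fun _ _ _ => erefl)
  (nice_Cibl (nice_one n t)) hh (nice_meas nh).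
under eq_fun do rewrite mul1r.
by rewrite Cint_one mulr1; apply; exact: Cibl_fockK.
Qed.

(** The function (w_k - z_k) h is again reproduced, and it vanishes at z. *)
Lemma reproducing_coord h z k : nice t h -> line_holo h ->
  Cint mu (fun w => (w 0 k - z 0 k) * h w * fockK t z w) = 0.
Proof.
move=> nh hh; have := @reproducing _ z (nice_coord (z 0 k) k nh) (line_holo_coord _ _ hh).
by rewrite subrr mul0r.
Qed.

Lemma reproducing_moment2 h z k j : nice t h -> line_holo h ->
  Cint mu (fun w => (w 0 k - z 0 k) * (w 0 j - z 0 j)^* * h w * fockK t z w) =
  h z * (if k == j then T%:C else 0).
Proof.
move=> nh hh; rewrite -Cint_moment2.
have nm := nice_coord (z 0 k) k (nice_coordJ (z 0 j) j nh).
have := @reproducing_weight (fun w => w 0 k * (w 0 j)^*) h z _ _ hh (nice_meas nh).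
have e w : ((w - z) 0 k * ((w - z) 0 j)^*) * (h w * fockK t z w) =
   (w 0 k - z 0 k) * (w 0 j - z 0 j)^* * h w * fockK t z w by rewrite !mxE mulrA.
rewrite (eq_Cint _ e); apply => //.
- move=> c w c1; rewrite !mxE rmorphM /= mulrACA mulcJ c1 expr1n mul1r//.
- exact: nice_Cibl (nice_mono k j).
rewrite (_ : (fun w => _) = (fun w =>
  ((w 0 k - z 0 k) * ((w 0 j - z 0 j)^* * h w)) * fockK t z w)).
  exact: Cibl_fockK.
by apply/funext => w; rewrite e !mulrA.
Qed.

End Reproducing.

(** * Schur's test *)

Lemma quadratic_discriminant (R : realFieldType) (X A B : R) :
  0 <= X -> 0 <= A -> 0 <= B ->
  (forall s : R, 0 <= s -> 2 * s * X <= s ^+ 2 * A + B) -> X ^+ 2 <= A * B.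
Proof.
move=> X0 A0 B0 h; have [A00|An0] := eqVneq A 0.
  rewrite A00 in h *.
  have [->|Xn0] := eqVneq X 0; first by rewrite expr0n mul0r.
  have Xp : 0 < X by rewrite lt_neqAle eq_sym Xn0.
  (* When A = 0 this value of s would give 2 (B + 1) <= B; otherwise the minimizing s = X / A is
     used below. *)
  have := h ((B + 1) / X); rewrite divr_ge0 ?addr_ge0// => /(_ isT).
  by rewrite -mulrA divfK// mulr0 add0r; lra.
have Ap : 0 < A by rewrite lt_neqAle eq_sym An0.
have := h (X / A) (divr_ge0 X0 A0).
have -> : 2 * (X / A) * X = 2 * (X ^+ 2 / A) by field.
have -> : (X / A) ^+ 2 * A = X ^+ 2 / A by field.
have -> : X ^+ 2 <= A * B = (X ^+ 2 / A <= B) by rewrite ler_pdivrMr// mulrC.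
by move: (X ^+ 2 / A) => Y; lra.
Qed.

Section WeightedCauchySchwarz.
Local Open Scope ereal_scope.
Context d (T : measurableType d) (R : realType) (m : {measure set T -> \bar R}).

(** The pointwise hypothesis for all s >= 0 encodes W^2 <= U V in a form that can be integrated; the
    discriminant is taken after integration. The value s = 1 shows that the integral of W is
    finite. *)
Lemma weighted_cauchy_schwarz (U V W : T -> R) (A B : R) :
  measurable_fun setT U -> measurable_fun setT V -> measurable_fun setT W ->
  (forall x, 0 <= U x)%R -> (forall x, 0 <= V x)%R -> (forall x, 0 <= W x)%R ->
  (forall x s, 0 <= s -> 2 * s * W x <= s ^+ 2 * U x + V x)%R ->
  (0 <= A)%R -> (0 <= B)%R ->
  \int[m]_x (U x)%:E <= A%:E -> \int[m]_x (V x)%:E <= B%:E ->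
  \int[m]_x (W x)%:E <= (Num.sqrt (A * B))%:E.
Proof.
move=> mU mV mW U0 V0 W0 h A0 B0 iU iV.
have key (s : R) : (0 <= s)%R ->
    (2 * s)%:E * \int[m]_x (W x)%:E <= (s ^+ 2 * A + B)%:E.
  move=> s0; rewrite -ge0_integralZl//; last 3 first.
  - exact/measurable_EFinP.
  - by move=> x _; rewrite lee_fin.
  - by rewrite lee_fin mulr_ge0.
  apply: (@le_trans _ _ (\int[m]_x ((s ^+ 2)%:E * (U x)%:E + (V x)%:E))).
    apply: ge0_le_integral => //.
    - by move=> x _; rewrite -EFinM lee_fin !mulr_ge0.
    - by apply/measurable_EFinP; exact: measurable_funM.
    - by apply/measurable_EFinP; apply: measurable_funD => //; exact: measurable_funM.
    - by move=> x _; rewrite -EFinM -EFinD lee_fin h.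
  rewrite ge0_integralD//; last 4 first.
  - by move=> x _; rewrite -EFinM lee_fin mulr_ge0// sqr_ge0.
  - by apply/measurable_EFinP; exact: measurable_funM.
  - by move=> x _; rewrite lee_fin.
  - exact/measurable_EFinP.
  rewrite ge0_integralZl//; last 3 first.
  - exact/measurable_EFinP.
  - by move=> x _; rewrite lee_fin.
  - by rewrite lee_fin sqr_ge0.
  by rewrite EFinD [(s ^+ 2 * A)%:E]EFinM leeD// lee_wpmul2l// lee_fin sqr_ge0.
have I0 : 0 <= \int[m]_x (W x)%:E by apply: integral_ge0 => x _; rewrite lee_fin.
have Ifin : \int[m]_x (W x)%:E \is a fin_num.
  rewrite ge0_fin_numE// ltey; apply/eqP => Iy; have := key 1%R ler01.
  by rewrite Iy mulr1 mulry gtr0_sg// mul1e.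
rewrite -(fineK Ifin) lee_fin -[leLHS]ger0_norm ?fine_ge0// -sqrtr_sqr.
rewrite ler_sqrt ?mulr_ge0//; apply: quadratic_discriminant => //.
  exact: fine_ge0.
by move=> s s0; have := key s s0; rewrite -{1}(fineK Ifin) -EFinM lee_fin.
Qed.

End WeightedCauchySchwarz.

Section L2Bounds.
Context (R : realType) (n : nat) (t : {posnum R}).
Local Notation Cn := ('rV[R[i]]_n).
Local Notation mu := (@gaussCn R n t).
Implicit Types (F G H : Cn -> R[i]) (a b c : R).

(** A norm bound with a real constant, stated on squares: the estimates stay in [R], and [L2norm]
    with its root only returns through [L2norm_le]. *)
Definition L2le F c : Prop :=
  [/\ Cmeas F, 0 <= c & (\int[mu]_w (normc (F w) ^+ 2)%:E <= (c ^+ 2)%:E)%E].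

Let msqr F : Cmeas F -> measurable_fun setT (fun w => normc (F w) ^+ 2).
Proof. by move=> mF; apply: measurable_funX; exact: Cmeas_normc. Qed.

Lemma L2le_nice F c : L2le F c -> nice t F.
Proof. by move=> [mF c0 iF]; apply: nice_sqr => //; apply: le_lt_trans iF _; exact: ltry. Qed.

Lemma L2le_CS F G a b : L2le F a -> L2le G b ->
  (\int[mu]_w (normc (F w) * normc (G w))%:E <= (a * b)%:E)%E.
Proof.
move=> [mF a0 iF] [mG b0 iG].
have := @weighted_cauchy_schwarz _ _ _ mu (fun w => normc (F w) ^+ 2)
  (fun w => normc (G w) ^+ 2) (fun w => normc (F w) * normc (G w)) (a ^+ 2) (b ^+ 2).
rewrite -exprMn sqrtr_sqr ger0_norm ?mulr_ge0//; apply => //; try exact: msqr;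
  try exact: sqr_ge0; last first.
- move=> w s s0; have := sqr_ge0 (s * normc (F w) - normc (G w)); nra.
- by move=> w; rewrite mulr_ge0 ?normc_ge0.
- by move=> w; exact: sqr_ge0.
- by move=> w; exact: sqr_ge0.
- by apply: measurable_funM; exact: Cmeas_normc.
Qed.

Lemma L2le_Cibl F G a b : L2le F a -> L2le G b ->
  Cibl mu (fun w => F w * (G w)^*).
Proof.
move=> hF hG; have [mF _ _] := hF; have [mG _ _] := hG.
split; first by apply: CmeasM => //; exact: CmeasJ.
under eq_integral do rewrite Normc.normcM normcJ.
by apply: le_lt_trans (L2le_CS hF hG) _; exact: ltry.
Qed.

Lemma L2le_inner F G a b : L2le F a -> L2le G b ->
  normc (Cint mu (fun w => F w * (G w)^*)) <= a * b.
Proof.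
move=> hF hG; rewrite -lee_fin (le_trans (le_normc_CintE (L2le_Cibl hF hG)))//.
under eq_integral do rewrite Normc.normcM normcJ.
exact: L2le_CS.
Qed.

Lemma le_L2le F G c : Cmeas F -> (forall w, normc (F w) <= normc (G w)) ->
  L2le G c -> L2le F c.
Proof.
move=> mF FG [mG c0 iG]; split=> //; apply: le_trans iG.
apply: ge0_le_integral => //.
- by move=> w _; rewrite lee_fin sqr_ge0.
- by apply/measurable_EFinP; exact: msqr.
- by apply/measurable_EFinP; exact: msqr.
- by move=> w _; rewrite lee_fin ler_pXn2r ?nnegrE ?normc_ge0.
Qed.

Lemma L2leZ (k : R[i]) F c : L2le F c -> L2le (fun w => k * F w) (normc k * c).
Proof.
move=> [mF c0 iF]; split; rewrite ?mulr_ge0 ?normc_ge0//.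
  by apply: CmeasM => //; exact: Cmeas_cst.
under eq_integral do rewrite Normc.normcM exprMn EFinM.
rewrite ge0_integralZl//; last 3 first.
- by apply/measurable_EFinP; exact: msqr.
- by move=> w _; rewrite lee_fin sqr_ge0.
- by rewrite lee_fin sqr_ge0.
by rewrite exprMn [leRHS]EFinM lee_wpmul2l// lee_fin sqr_ge0.
Qed.

Lemma L2leM G M F c : 0 <= M -> Cmeas G -> (forall w, normc (G w) <= M) ->
  L2le F c -> L2le (fun w => G w * F w) (M * c).
Proof.
move=> M0 mG GM hF; have [mF _ _] := hF.
have := L2leZ M%:C hF; rewrite normc_real ger0_norm//; apply: le_L2le.
  exact: CmeasM.
by move=> w; rewrite !Normc.normcM normc_real ger0_norm// ler_wpM2r// normc_ge0.
Qed.

Lemma L2leD F G a b : L2le F a -> L2le G b -> L2le (fun w => F w + G w) (a + b).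
Proof.
move=> hF hG; have [mF a0 iF] := hF; have [mG b0 iG] := hG.
split; rewrite ?addr_ge0//; first exact: CmeasD.
have mFG : measurable_fun setT (fun w => normc (F w) * normc (G w)).
  by apply: measurable_funM; exact: Cmeas_normc.
apply: (@le_trans _ _ (\int[mu]_w ((normc (F w) ^+ 2)%:E +
    (2%:E * (normc (F w) * normc (G w))%:E + (normc (G w) ^+ 2)%:E)))%E).
  apply: ge0_le_integral => //.
  - by move=> w _; rewrite lee_fin sqr_ge0.
  - by apply/measurable_EFinP; apply: msqr; exact: CmeasD.
  - apply/measurable_EFinP; apply: measurable_funD; first exact: msqr.
    by apply: measurable_funD; [exact: measurable_funM|exact: msqr].
  move=> w _; rewrite -EFinM -!EFinD lee_fin.
  apply: (@le_trans _ _ ((normc (F w) + normc (G w)) ^+ 2)).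
    by rewrite ler_pXn2r ?nnegrE ?addr_ge0 ?normc_ge0// le_normcD.
  by rewrite le_eqVlt; apply/orP; left; apply/eqP; ring.
have n0 w : (0 <= 2%:E * (normc (F w) * normc (G w))%:E)%E.
  by rewrite -EFinM lee_fin !mulr_ge0 ?normc_ge0.
have s0 H w : (0 <= (normc (H w) ^+ 2)%:E)%E by rewrite lee_fin sqr_ge0.
rewrite ge0_integralD//; last 3 first.
- by apply/measurable_EFinP; exact: msqr.
- by move=> w _; rewrite adde_ge0.
- apply/measurable_EFinP; apply: measurable_funD; last exact: msqr.
  exact: measurable_funM.
rewrite ge0_integralD//; last 2 first.
- by apply/measurable_EFinP; exact: measurable_funM.
- by apply/measurable_EFinP; exact: msqr.
rewrite ge0_integralZl//; last 2 first.
- exact/measurable_EFinP.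
- by move=> w _; rewrite lee_fin mulr_ge0 ?normc_ge0.
have -> : (a + b) ^+ 2 = a ^+ 2 + (2 * (a * b) + b ^+ 2) by ring.
rewrite [leRHS](_ : _ = (a ^+ 2)%:E + (2%:E * (a * b)%:E + (b ^+ 2)%:E))%E; last first.
  by rewrite -EFinM -!EFinD.
apply: leeD => //; apply: leeD => //.
by apply: lee_wpmul2l => //; exact: L2le_CS hF hG.
Qed.

Lemma L2le0 : L2le (fun=> 0) 0.
Proof.
split=> //.
by under eq_integral do rewrite Normc.normc0 expr0n; rewrite integral0 expr0n.
Qed.

Lemma L2leN F c : L2le F c -> L2le (fun w => - F w) c.
Proof. move=> hF; have [mF _ _] := hF; apply: le_L2le hF; first exact: CmeasN.
by move=> w; rewrite normcN. Qed.

Lemma L2leB F G a b : L2le F a -> L2le G b -> L2le (fun w => F w - G w) (a + b).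
Proof. by move=> hF hG; apply: L2leD => //; exact: L2leN. Qed.

Lemma L2le_sum I (s : seq I) (F : I -> Cn -> R[i]) (c : I -> R) :
  (forall i, L2le (F i) (c i)) ->
  L2le (fun w => \sum_(i <- s) F i w) (\sum_(i <- s) c i).
Proof.
move=> h; elim: s => [|i s ih].
  by under eq_fun do rewrite big_nil; rewrite big_nil; exact: L2le0.
by under eq_fun do rewrite big_cons; rewrite big_cons; exact: L2leD.
Qed.

Lemma L2le_weaken F a b : a <= b -> L2le F a -> L2le F b.
Proof.
move=> ab [mF a0 iF]; have b0 := le_trans a0 ab; split=> //.
by rewrite (le_trans iF)// lee_fin ler_pXn2r ?nnegrE.
Qed.

Lemma L2normE F : L2norm t F =
  ((\int[mu]_w (normc (F w) ^+ 2)%:E) `^ (2^-1))%E.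
Proof.
rewrite /L2norm unlock; congr (_ `^ _)%E; apply: eq_integral => w _.
by rewrite /= ger0_norm ?normc_ge0// powR_mulrn ?normc_ge0.
Qed.

Lemma L2norm_le F c : 0 <= c -> Cmeas F -> (L2norm t F <= c%:E)%E <-> L2le F c.
Proof.
move=> c0 mF; rewrite L2normE; set I := (\int[mu]_w _)%E.
have I0 : (0 <= I)%E by apply: integral_ge0 => w _; rewrite lee_fin sqr_ge0.
have cE : (c%:E = (c ^+ 2)%:E `^ 2^-1)%E.
  by rewrite poweR_EFin -powR_mulrn// -powRrM mulfV ?pnatr_eq0// powRr1.
split=> [h|[_ _ h]].
  split=> //; rewrite -/I.
  have : ((I `^ 2^-1) `^ 2 <= c%:E `^ 2)%E.
    apply: gt0_ler_poweR => //; rewrite in_itv/= ?leey ?andbT ?lee_fin//.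
    exact: poweR_ge0.
  by rewrite -poweRrM mulVf ?pnatr_eq0// poweRe1// poweR_EFin powR_mulrn.
rewrite cE; apply: gt0_ler_poweR => //.
  by rewrite in_itv/= I0 leey.
by rewrite in_itv/= lee_fin sqr_ge0 leey.
Qed.

Lemma L2_L2le F : L2 t F -> exists c, L2le F c.
Proof.
move=> [m1 m2 Fy]; have mF : Cmeas F by [].
have F0 : (0 <= L2norm t F)%E by exact: Lnorm_ge0.
have Ffin : L2norm t F \is a fin_num by rewrite ge0_fin_numE.
exists (fine (L2norm t F)); apply/L2norm_le => //; first exact: fine_ge0.
by rewrite fineK.
Qed.

Lemma L2le_L2 F c : L2le F c -> L2 t F.
Proof.
move=> h; have [[m1 m2] c0 _] := h; split => //.
by apply: le_lt_trans (ltry c); apply/L2norm_le.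
Qed.

End L2Bounds.

(* [x^*] is parsed as [Num.conj x] or as [conjc x] depending on the scope. *)
Lemma num_conjE (R : realType) (x : R[i]) : Num.conj x = conjc x.
Proof. by []. Qed.

Lemma conjcM (R : realType) (x y : R[i]) : conjc (x * y) = conjc x * conjc y.
Proof. exact: (rmorphM (@conjc R)). Qed.

Section SchurTest.
Context (R : realType) (n : nat) (t : {posnum R}).
Local Notation Cn := ('rV[R[i]]_n).
Local Notation mu := (@gaussCn R n t).
Local Notation T := (t%:num : R).
Implicit Types (z w u : Cn) (F G H : Cn -> R[i]) (a b c M : R).

Definition schur_kernel z w : R :=
  normc (fockK t z w) * expR (sqnorm (w - z) / (4 * T)).
Definition schur_weight w : R := expR (sqnorm w / (2 * T)).

Local Notation k0 := schur_kernel.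
Local Notation p := schur_weight.

Lemma schur_kernel_ge0 z w : 0 <= k0 z w.
Proof. by rewrite mulr_ge0 ?normc_ge0 ?expR_ge0. Qed.

Lemma schur_kernelC z w : k0 z w = k0 w z.
Proof. by rewrite /k0 -fockKJ normcJ -sqnormN opprB. Qed.

Lemma sqnormB z w : sqnorm (w - z) = sqnorm w - 2 * Re (herm z w) + sqnorm z.
Proof.
rewrite sqnormD sqnormN (_ : herm w (- z) = - herm w z).
  by rewrite ReN -[herm w z]hermJ ReJ mulrN.
by rewrite /herm -sumrN; apply: eq_bigr => j _; rewrite mxE rmorphN mulrN.
Qed.

(** The exponents differ by exactly |w - z|^2/4t. This crude bound makes the integrals of Schur's
    test finite at every z, before their size is estimated. *)
Lemma schur_kernel_le z w : k0 z w <= p z * p w.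
Proof.
rewrite /k0 normc_fockK -!expRD ler_expR -subr_ge0.
rewrite (_ : _ - _ = sqnorm (w - z) / (4 * T)); first by rewrite divr_ge0 ?sqnorm_ge0 ?mulr_ge0.
by rewrite sqnormB; field; rewrite gt_eqF.
Qed.

Let p_gt0 w : 0 < p w. Proof. exact: expR_gt0. Qed.

Let p_ge0 w : 0 <= p w. Proof. exact: expR_ge0. Qed.

Let mp : measurable_fun setT p.
Proof.
by apply: measurable_expR_comp; apply: measurable_funM => //; exact: measurable_sqnorm.
Qed.

Let mk0 : measurable_fun setT (fun x : Cn * Cn => k0 x.1 x.2).
Proof.
apply: measurable_funM.
  by apply: Cmeas_normc; apply: Cmeas_fockK; [exact: measurable_fst|exact: measurable_snd].
apply: measurable_expR_comp; apply: measurable_funM => //; apply: measurable_sqnorm.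
apply: measurable_addCn; first exact: measurable_snd.
by apply: measurable_oppCn; exact: measurable_fst.
Qed.

Let mk1 z : measurable_fun setT (k0 z).
Proof. exact: (measurableT_comp mk0 (pair1_measurable z)). Qed.

Lemma schur_kernel_weight z :
  (\int[mu]_w (k0 z w * p w)%:E = (4 ^+ n * p z)%:E)%E.
Proof. exact: fockK_weight. Qed.

Section Function.
Variables (F : Cn -> R[i]) (c : R).
Hypothesis hF : L2le t F c.

Let mF : Cmeas F. Proof. by case: hF. Qed.
Let c0 : 0 <= c. Proof. by case: hF. Qed.
Let mN : measurable_fun setT (fun w => normc (F w)). Proof. exact: Cmeas_normc. Qed.

Definition schur_op z : R := \int[mu]_w (k0 z w * normc (F w)).

Let V z w := k0 z w * (normc (F w) ^+ 2 / p w).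

Let mpV : measurable_fun setT (fun w => (p w)^-1).
Proof.
rewrite (_ : (fun w => _) = (fun w => expR (- (sqnorm w / (2 * T))))); last first.
  by apply/funext => w; rewrite expRN.
by apply: measurable_expR_comp; apply: measurableT_comp => //;
  apply: measurable_funM => //; exact: measurable_sqnorm.
Qed.

Let mV : measurable_fun setT (fun x : Cn * Cn => V x.1 x.2).
Proof.
apply: measurable_funM => //.
have m2 : measurable_fun setT (fun w => normc (F w) ^+ 2 / p w).
  by apply: measurable_funM => //; exact: measurable_funX.
exact: (measurableT_comp m2 measurable_snd).
Qed.

Let V0 z w : 0 <= V z w.
Proof. by rewrite mulr_ge0 ?schur_kernel_ge0// divr_ge0 ?sqr_ge0// ltW. Qed.

Let mV1 z : measurable_fun setT (V z).
Proof. exact: (measurableT_comp mV (pair1_measurable z)). Qed.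

Let I z := (\int[mu]_w (V z w)%:E)%E.

Let I0 z : (0 <= I z)%E.
Proof. by apply: integral_ge0 => w _; rewrite lee_fin. Qed.

Let Ifin z : I z \is a fin_num.
Proof.
rewrite ge0_fin_numE// (@le_lt_trans _ _ ((p z * c ^+ 2)%:E))%E ?ltry//.
have [_ _ iF] := hF.
apply: (@le_trans _ _ (\int[mu]_w ((p z)%:E * (normc (F w) ^+ 2)%:E))%E).
  apply: ge0_le_integral => //.
  - by move=> w _; rewrite lee_fin.
  - exact/measurable_EFinP.
  - by apply/measurable_EFinP; apply: measurable_funM => //; exact: measurable_funX.
  move=> w _; rewrite -EFinM lee_fin /V mulrCA [leRHS]mulrC ler_wpM2l ?sqr_ge0//.
  by rewrite ler_pdivrMr// schur_kernel_le.
rewrite ge0_integralZl//; last 3 first.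
- by apply/measurable_EFinP; exact: measurable_funX.
- by move=> w _; rewrite lee_fin sqr_ge0.
- by rewrite lee_fin.
by rewrite [leRHS]EFinM lee_wpmul2l// lee_fin.
Qed.

(** Cauchy-Schwarz for k |F| as the geometric mean of k p and k |F|^2 / p, where k is the kernel and
    p the weight. *)
Let schur_pointwiseE z :
  (\int[mu]_w (k0 z w * normc (F w))%:E <= (Num.sqrt (4 ^+ n * p z * fine (I z)))%:E)%E.
Proof.
apply: (weighted_cauchy_schwarz (U := fun w => k0 z w * p w) (V := V z)) => //.
- exact: measurable_funM.
- exact: measurable_funM.
- by move=> w; rewrite mulr_ge0 ?schur_kernel_ge0// ltW.
- by move=> w; rewrite mulr_ge0 ?schur_kernel_ge0 ?normc_ge0.
- move=> w s s0.
  have -> : s ^+ 2 * (k0 z w * p w) + V z w =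
      k0 z w * ((s * p w - normc (F w)) ^+ 2 / p w) + 2 * s * (k0 z w * normc (F w)).
    by rewrite /V; field; rewrite gt_eqF.
  rewrite lerDr mulr_ge0 ?schur_kernel_ge0// divr_ge0 ?sqr_ge0// ltW//.
- by rewrite mulr_ge0 ?exprn_ge0// ltW.
- exact: fine_ge0.
- by rewrite schur_kernel_weight.
- by rewrite (fineK (Ifin z)).
Qed.

Lemma schur_opE z : (schur_op z)%:E = (\int[mu]_w (k0 z w * normc (F w))%:E)%E.
Proof.
rewrite /schur_op /Rintegral fineK// ge0_fin_numE.
  exact: le_lt_trans (schur_pointwiseE z) (ltry _).
by apply: integral_ge0 => w _; rewrite lee_fin mulr_ge0 ?schur_kernel_ge0 ?normc_ge0.
Qed.

Lemma schur_op_ge0 z : 0 <= schur_op z.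
Proof.
by apply: Rintegral_ge0 => w _; rewrite mulr_ge0 ?schur_kernel_ge0 ?normc_ge0.
Qed.

Lemma measurable_schur_op : measurable_fun setT schur_op.
Proof.
apply: (@measurable_Rintegral _ _ _ _ _ mu (fun x => k0 x.1 x.2 * normc (F x.2))).
apply: measurable_funM => //.
exact: (measurableT_comp mN measurable_snd).
Qed.

(** The pointwise bound is squared and integrated in z. After Tonelli the symmetry of the kernel
    allows a second use of [schur_kernel_weight], so the squared bound has the constant 4^n 4^n =
    16^n. *)
Lemma schur_test : L2le t (fun z => (schur_op z)%:C) (4 ^+ n * c).
Proof.
have mS := measurable_schur_op.
split; [exact: Cmeas_real|by rewrite mulr_ge0// exprn_ge0|].
apply: (@le_trans _ _ (\int[mu]_z \int[mu]_w ((4 ^+ n)%:E * (p z * V z w)%:E)))%E.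
  apply: ge0_le_integral => //.
  - by move=> z _; rewrite lee_fin sqr_ge0.
  - by apply/measurable_EFinP; apply: measurable_funX; apply: Cmeas_normc; exact: Cmeas_real.
  - apply: (measurable_fun_fubini_tonelli_F (fun x : Cn * Cn =>
      ((4 ^+ n)%:E * (p x.1 * V x.1 x.2)%:E)%E)).
      apply/measurable_EFinP; apply: measurable_funM => //; apply: measurable_funM => //.
      exact: (measurableT_comp mp measurable_fst).
    by move=> x; rewrite -EFinM lee_fin mulr_ge0 ?exprn_ge0// mulr_ge0.
  move=> z _; rewrite normc_real ger0_norm ?schur_op_ge0//.
  have q0 : 0 <= 4 ^+ n * p z by rewrite mulr_ge0 ?exprn_ge0// ltW.
  apply: (@le_trans _ _ ((4 ^+ n * p z)%:E * I z)%E).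
    rewrite -(fineK (Ifin z)) -EFinM lee_fin.
    have h : schur_op z <= Num.sqrt (4 ^+ n * p z * fine (I z)).
      by rewrite -lee_fin schur_opE; exact: schur_pointwiseE.
    have f0 : 0 <= fine (I z) by exact: fine_ge0.
    rewrite -[leRHS]sqr_sqrtr; last by rewrite mulr_ge0.
    by rewrite ler_pXn2r ?nnegrE ?schur_op_ge0 ?sqrtr_ge0.
  rewrite /I -ge0_integralZl//; last 2 first.
  - by apply/measurable_EFinP.
  - by move=> w _; rewrite lee_fin.
  rewrite le_eqVlt; apply/orP; left; apply/eqP; apply: eq_integral => w _.
  exact: (congr1 EFin (esym (mulrA (4 ^+ n) (p z) (V z w)))).
rewrite (fubini_tonelli (m1 := mu) (m2 := mu) (fun x : Cn * Cn =>
      ((4 ^+ n)%:E * (p x.1 * V x.1 x.2)%:E)%E)); last 2 first.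
- apply/measurable_EFinP; apply: measurable_funM => //; apply: measurable_funM => //.
  exact: (measurableT_comp mp measurable_fst).
- by move=> x; rewrite -EFinM lee_fin mulr_ge0 ?exprn_ge0// mulr_ge0.
have [_ _ iF] := hF.
apply: (@le_trans _ _ (\int[mu]_w ((16 ^+ n)%:E * (normc (F w) ^+ 2)%:E))%E).
  rewrite le_eqVlt; apply/orP; left; apply/eqP; apply: eq_integral => w _ /=.
  transitivity (\int[mu]_z ((4 ^+ n * (normc (F w) ^+ 2 / p w))%:E * (k0 w z * p z)%:E))%E.
    apply: eq_integral => z _; rewrite -!EFinM /V [k0 z w]schur_kernelC; congr EFin.
    by ring.
  rewrite ge0_integralZl//; last 3 first.
  - by apply/measurable_EFinP; exact: measurable_funM.
  - by move=> z _; rewrite lee_fin mulr_ge0 ?schur_kernel_ge0// ltW.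
  - by rewrite lee_fin mulr_ge0 ?exprn_ge0// divr_ge0 ?sqr_ge0// ltW.
  rewrite schur_kernel_weight -!EFinM; congr EFin.
  have -> : 16 ^+ n = 4 ^+ n * 4 ^+ n :> R by rewrite -exprMn -natrM.
  by field; rewrite gt_eqF.
rewrite ge0_integralZl//; last 2 first.
- by apply/measurable_EFinP; exact: measurable_funX.
- by move=> w _; rewrite lee_fin sqr_ge0.
have -> : (4 ^+ n * c) ^+ 2 = 16 ^+ n * c ^+ 2.
  have -> : 16 ^+ n = 4 ^+ n * 4 ^+ n :> R by rewrite -exprMn -natrM.
  by ring.
by rewrite [leRHS]EFinM lee_wpmul2l// lee_fin exprn_ge0.
Qed.

End Function.

Section Operator.
Variables (m : Cn * Cn -> R[i]) (M : R).
Hypothesis mm : Cmeas m.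
Hypothesis M0 : 0 <= M.
Hypothesis mM : forall z w, normc (m (z, w)) <= M * expR (sqnorm (w - z) / (4 * T)).

Definition kernel_op F z : R[i] :=
  Cint mu (fun w => m (z, w) * (fockK t z w * F w)).

Lemma kernel_bound F z w :
  normc (m (z, w) * (fockK t z w * F w)) <= M * (k0 z w * normc (F w)).
Proof.
rewrite !Normc.normcM /k0 [_ * expR _]mulrC !mulrA ler_wpM2r ?normc_ge0//.
by rewrite ler_wpM2r ?normc_ge0// mM.
Qed.

Let mker F : Cmeas F -> Cmeas (fun x : Cn * Cn => m x * (fockK t x.1 x.2 * F x.2)).
Proof.
move=> mF; apply: CmeasM => //; apply: CmeasM.
  by apply: Cmeas_fockK; [exact: measurable_fst|exact: measurable_snd].
exact: Cmeas_comp measurable_snd mF.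
Qed.

Let mk2 F z : Cmeas F -> measurable_fun setT (fun w => k0 z w * normc (F w)).
Proof. by move=> mF; apply: measurable_funM => //; exact: Cmeas_normc. Qed.

Lemma kernel_op_Cibl F c z : L2le t F c ->
  Cibl mu (fun w => m (z, w) * (fockK t z w * F w)).
Proof.
move=> hF; have [mF _ _] := hF.
apply: (@le_Cibl _ _ _ _ _ (fun w => M * (k0 z w * normc (F w)))).
- exact: (Cmeas_comp (pair1_measurable z) (mker mF)).
- by move=> w; exact: kernel_bound.
- by apply: measurable_funM => //; exact: mk2.
under eq_integral do rewrite EFinM.
rewrite ge0_integralZl//; last 2 first.
- by apply/measurable_EFinP; exact: mk2.
- by move=> w _; rewrite lee_fin mulr_ge0 ?schur_kernel_ge0 ?normc_ge0.
by rewrite -(schur_opE hF) -EFinM ltry.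
Qed.

Lemma kernel_op_le F c z : L2le t F c ->
  (\int[mu]_w (normc (m (z, w) * (fockK t z w * F w)))%:E <= (M * schur_op F z)%:E)%E.
Proof.
move=> hF; have [mF _ _] := hF.
rewrite EFinM (schur_opE hF) -ge0_integralZl//; last 2 first.
- by apply/measurable_EFinP; exact: mk2.
- by move=> w _; rewrite lee_fin mulr_ge0 ?schur_kernel_ge0 ?normc_ge0.
apply: ge0_le_integral => //.
- by move=> w _; rewrite lee_fin normc_ge0.
- by apply/measurable_EFinP; apply: Cmeas_normc; exact: Cibl_meas (kernel_op_Cibl z hF).
- by apply/measurable_EFinP; apply: measurable_funM => //; exact: mk2.
- by move=> w _; rewrite -EFinM lee_fin kernel_bound.
Qed.

Lemma kernel_op_meas F : Cmeas F -> Cmeas (kernel_op F).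
Proof. by move=> mF; exact: (Cmeas_Cint mu (mker mF)). Qed.

Lemma kernel_op_L2le F c : L2le t F c -> L2le t (kernel_op F) (M * (4 ^+ n * c)).
Proof.
move=> hF; have [mF _ _] := hF.
have := L2leZ M%:C (schur_test hF); rewrite normc_real ger0_norm//; apply: le_L2le.
  exact: kernel_op_meas.
move=> z; rewrite Normc.normcM !normc_real !ger0_norm ?schur_op_ge0//.
rewrite -lee_fin (le_trans (le_normc_CintE (kernel_op_Cibl z hF)))//.
exact: kernel_op_le hF.
Qed.

End Operator.

(** Fubini, with the kernel [fockK] Hermitian, so that only the symbol is transposed and conjugated.
    Absolute integrability comes from [schur_test] paired with H. *)
Lemma kernel_op_adjoint (m : Cn * Cn -> R[i]) M F H a b : Cmeas m -> 0 <= M ->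
  (forall z w, normc (m (z, w)) <= M * expR (sqnorm (w - z) / (4 * T))) ->
  L2le t F a -> L2le t H b ->
  Cint mu (fun z => kernel_op m F z * (H z)^*) =
  Cint mu (fun w => F w * (kernel_op (fun x => (m (x.2, x.1))^*) H w)^*).
Proof.
move=> mm M0 mM hF hH; have [mF _ _] := hF; have [mH _ _] := hH.
pose m' (x : Cn * Cn) := (m (x.2, x.1))^*.
have mm' : Cmeas m'.
  apply: CmeasJ; apply: Cmeas_comp mm.
  by apply/measurable_fun_pairP; split; [exact: measurable_snd|exact: measurable_fst].
have mM' z w : normc (m' (z, w)) <= M * expR (sqnorm (w - z) / (4 * T)).
  by rewrite /m' normcJ -(sqnormN (w - z)) opprB mM.
pose G (x : Cn * Cn) := m x * (fockK t x.1 x.2 * F x.2) * (H x.1)^*.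
have mG : Cmeas G.
  apply: CmeasM; last by apply: CmeasJ; exact: Cmeas_comp measurable_fst mH.
  apply: CmeasM => //; apply: CmeasM.
    by apply: Cmeas_fockK; [exact: measurable_fst|exact: measurable_snd].
  exact: Cmeas_comp measurable_snd mF.
have i1 z : Cibl mu (fun w => G (z, w)).
  rewrite /G; under eq_fun do rewrite /= mulrC.
  exact: (CiblZ _ (kernel_op_Cibl mm M0 mM z hF)).
have e2 w z : G (z, w) = F w * (m' (w, z) * (fockK t w z * H z))^*.
  have -> : G (z, w) = m (z, w) * (fockK t z w * F w) * (H z)^* by [].
  have -> : m' (w, z) = (m (z, w))^* by [].
  by rewrite -fockKJ ?num_conjE !conjcM !conjcK; ring.
have i2 w : Cibl mu (fun z => G (z, w)).
  under eq_fun do rewrite e2.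
  by apply: CiblZ; apply: CiblJ; exact: (kernel_op_Cibl mm' M0 mM' w hH).
have nI : (\int[mu]_z \int[mu]_w (normc (G (z, w)))%:E < +oo)%E.
  apply: (@le_lt_trans _ _ (\int[mu]_z (M%:E * (normc (schur_op F z)%:C * normc (H z))%:E))%E).
    apply: ge0_le_integral => //.
    - by move=> z _; apply: integral_ge0 => w _; rewrite lee_fin normc_ge0.
    - apply: (measurable_fun_fubini_tonelli_F (fun x : Cn * Cn => (normc (G x))%:E)).
        by apply/measurable_EFinP; exact: Cmeas_normc.
      by move=> x; rewrite lee_fin normc_ge0.
    - apply/measurable_EFinP; apply: measurable_funM => //; apply: measurable_funM.
        by apply: Cmeas_normc; apply: Cmeas_real; exact: measurable_schur_op hF.
      exact: Cmeas_normc.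
    move=> z _.
    apply: (@le_trans _ _ ((normc (H z))%:E * (M * schur_op F z)%:E)%E); last first.
      rewrite -!EFinM lee_fin normc_real ger0_norm ?schur_op_ge0//.
      by rewrite mulrCA [normc _ * _]mulrC.
    rewrite (_ : (\int[mu]_w _)%E = ((normc (H z))%:E *
      \int[mu]_w (normc (m (z, w) * (fockK t z w * F w)))%:E)%E); last first.
      rewrite -ge0_integralZl//; last 3 first.
      - apply/measurable_EFinP; apply: Cmeas_normc.
        exact: Cibl_meas (kernel_op_Cibl mm M0 mM z hF).
      - by move=> w _; rewrite lee_fin normc_ge0.
      - by rewrite lee_fin normc_ge0.
      by apply: eq_integral => w _; rewrite -EFinM /G /= mulrC Normc.normcM normcJ.
    by apply: lee_wpmul2l; [rewrite lee_fin normc_ge0|exact: kernel_op_le hF].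
  rewrite ge0_integralZl//; last 2 first.
  - apply/measurable_EFinP; apply: measurable_funM.
      by apply: Cmeas_normc; apply: Cmeas_real; exact: measurable_schur_op hF.
    exact: Cmeas_normc.
  - by move=> z _; rewrite lee_fin mulr_ge0 ?normc_ge0.
  rewrite lte_mul_pinfty ?lee_fin//.
  by apply: le_lt_trans (L2le_CS (schur_test hF) hH) _; exact: ltry.
have := Cfubini mG nI i1 i2.
have -> : Cint mu (fun z => Cint mu (fun w => G (z, w))) =
    Cint mu (fun z => kernel_op m F z * (H z)^*).
  apply: eq_Cint => z; rewrite /kernel_op -CintZr//.
  exact: (kernel_op_Cibl mm M0 mM z hF).
move=> ->; apply: eq_Cint => w; under eq_Cint do rewrite e2.
have ik := kernel_op_Cibl mm' M0 mM' w hH.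
by rewrite CintZ ?CintJ//; exact: CiblJ.
Qed.

End SchurTest.

(** * The Bergman projection *)

Section Entire.
Context (R : realType) (n : nat).
Local Notation Cn := ('rV[R[i]]_n).

Definition coord_form (c : 'I_n -> R[i]) (h : 'rV[R[i]^o]_n) : R[i]^o :=
  \sum_j c j * h 0 j.

Lemma coord_form_linear c : linear (coord_form c).
Proof.
move=> a u v; rewrite /coord_form scaler_sumr -big_split; apply: eq_bigr => j _.
by rewrite !mxE /GRing.scale /=; ring.
Qed.

HB.instance Definition _ c := GRing.isLinear.Build R[i] 'rV[R[i]^o]_n R[i]^o _
  (coord_form c) (coord_form_linear c).

Lemma coord_form_continuous c : continuous (coord_form c).
Proof.
move=> z; apply: cvg_big => [||j _].
- exact: add_continuous.
- exact: nbhs_filter.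
have hz : {for z, continuous (fun h : 'rV[R[i]^o]_n => h 0 j)} by exact: coord_continuous.
have H : {for z, continuous (fun h : 'rV[R[i]^o]_n => c j * h 0 j : R[i]^o)}.
  exact: (@continuousM R[i] _ (fun=> c j : R[i]^o) _ z (@cst_continuous _ _ _ _) hz).
exact: H.
Qed.

Lemma normr_coord (h : 'rV[R[i]^o]_n) j : `|h 0 j| <= `|h|.
Proof.
rewrite [leRHS]/Num.norm /= mx_normE.
have := @le_bigmax _ _ _ (widen_itv 0%:itv)
  (fun i : 'I_1 * 'I_n => widen_itv (`|h i.1 i.2|%:itv) : {nonneg R[i]^o}) (0, j).
by move=> H; apply: H.
Qed.

Lemma lnorm1_normr (h : 'rV[R[i]^o]_n) : (lnorm1 (h : Cn))%:C <= n%:R * `|h|.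
Proof.
rewrite rmorph_sum (@le_trans _ _ (\sum_(j < n) `|h|))//.
  by apply: ler_sum => j _; rewrite [leLHS](_ : _ = `|h 0 j|) ?normr_coord// normr_normc.
by rewrite sumr_const card_ord mulr_natl.
Qed.

(** A quadratic remainder near z is o(h). The condition [lnorm1 h <= 1] holds in a neighbourhood of
    0, since [lnorm1] is at most n times the sup norm. *)
Lemma coord_form_differentiable (F : Cn -> R[i]) (z : 'rV[R[i]^o]_n) (c : 'I_n -> R[i])
    (M : R) : 0 <= M ->
  (forall h : Cn, lnorm1 h <= 1 ->
    normc (F (h + z) - F z - \sum_j c j * h 0 j) <= M * lnorm1 h ^+ 2) ->
  differentiable (F : 'rV[R[i]^o]_n -> R[i]^o) z.
Proof.
move=> M0 hF; pose G : 'rV[R[i]^o]_n -> R[i]^o := F.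
have exp : G \o shift z = cst (G z) + coord_form c +o_ (0 : 'rV[R[i]^o]_n) id.
  apply/eqaddoP => e e0.
  pose N := (n%:R : R[i]); have N0 : 0 <= N by exact: ler0n.
  have K0 : 0 < M%:C * N ^+ 2 + 1 by rewrite ltr_wpDl// mulr_ge0 ?lecR ?exprn_ge0.
  have d0 : 0 < e / (M%:C * N ^+ 2 + 1) by rewrite divr_gt0.
  have d1 : 0 < (N + 1)^-1 by rewrite invr_gt0 ltr_wpDl.
  have nl (r : R[i]) : 0 < r -> \forall h \near (0 : 'rV[R[i]^o]_n), `|h| <= r.
    by move=> r0; have := @nbhs0_le R[i] 'rV[R[i]^o]_n r r0.
  near=> h.
  have hl := lnorm1_normr h.
  have h1 : lnorm1 (h : Cn) <= 1.
    rewrite -lecR (le_trans hl)//.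
    have : `|h| <= (N + 1)^-1 by near: h; exact: nl.
    rewrite -(ler_pM2l (_ : 0 < N + 1)) ?ltr_wpDl// mulfV; last first.
      by rewrite gt_eqF// ltr_wpDl.
    by apply: le_trans; rewrite ler_wpM2r// lerDl.
  have h2 : `|h| <= e / (M%:C * N ^+ 2 + 1) by near: h; exact: nl.
  rewrite [X in `|X|](_ : _ = F (h + z) - F z - \sum_j c j * h 0 j); last first.
    by rewrite /coord_form /= opprD addrA.
  rewrite normr_normc (@le_trans _ _ (M * lnorm1 (h : Cn) ^+ 2)%:C)//.
    by rewrite lecR hF.
  rewrite rmorphM rmorphXn /= (@le_trans _ _ (M%:C * (N * `|h|) ^+ 2))//.
    rewrite ler_wpM2l ?lecR// ler_pXn2r ?nnegrE ?lecR ?lnorm1_ge0//.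
    by rewrite mulr_ge0.
  have -> : M%:C * (N * `|h|) ^+ 2 = (M%:C * N ^+ 2 * `|h|) * `|h| by ring.
  rewrite ler_wpM2r//.
  move: h2; rewrite ler_pdivlMr// mulrC; apply: le_trans.
  by rewrite ler_wpM2r// lerDl.
have cc := @coord_form_continuous c.
have dE : 'd G z = coord_form c :> (_ -> _) by exact: (diff_unique cc exp).
by apply/diff_locallyP; rewrite dE.
Unshelve. all: by end_near. Qed.

End Entire.

Section Bergman.
Context (R : realType) (n : nat) (t : {posnum R}).
Local Notation Cn := ('rV[R[i]]_n).
Local Notation mu := (@gaussCn R n t).
Local Notation T := (t%:num : R).
Implicit Types (z w u : Cn) (F G H h : Cn -> R[i]) (a b c : R).

Definition bergman F z : R[i] := Cint mu (fun w => fockK t z w * F w).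

Lemma fockK_addl (h z w : Cn) : fockK t (h + z) w = cexp (herm h w / T%:C) * fockK t z w.
Proof. by rewrite /fockK hermDl mulrDl cexpD. Qed.

(** With y = |w|/t, the bound of [cexp_taylor] has a factor y^2 e^y; y <= e^y turns it into e^{3y},
    an exponential of the kind that [nice] integrates. The other 3 is that of [cexp_taylor]. *)
Lemma cexp_remainder_bound (h w : Cn) :
  let x := herm h w / T%:C in lnorm1 h <= 1 ->
  normc (cexp x - 1 - x) <= 3 * lnorm1 h ^+ 2 * expR (3 / T * enorm w).
Proof.
move=> x h1; have l0 := lnorm1_ge0 h; have e0 := enorm_ge0 w.
pose y := enorm w / T; have y0 : 0 <= y by rewrite divr_ge0.
have xy : normc x <= lnorm1 h * y.
  rewrite /x /y mulrA -[_ / T%:C]/(herm h w * T%:C^-1).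
  have -> : T%:C^-1 = (T^-1)%:C :> R[i] by rewrite rmorphV ?unitfE ?gt_eqF.
  rewrite Normc.normcM normc_real ger0_norm ?invr_ge0//.
  by rewrite ler_wpM2r ?invr_ge0// normc_herm.
apply: le_trans (cexp_taylor x) _.
have -> : expR (3 / T * enorm w) = (expR y) ^+ 2 * expR y.
  by rewrite -exprSr -expRM_natl; congr expR; rewrite /y; ring.
have -> : 3 * lnorm1 h ^+ 2 * (expR y ^+ 2 * expR y) =
    3 * ((lnorm1 h * expR y) ^+ 2 * expR y) by ring.
rewrite -mulrA ler_wpM2l// ler_pM ?expR_ge0 ?sqr_ge0//.
  rewrite ler_pXn2r ?nnegrE ?normc_ge0 ?mulr_ge0 ?expR_ge0//.
  by rewrite (le_trans xy)// ler_wpM2l// expR_ge_id.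
by rewrite ler_expR (le_trans xy)// ler_piMl.
Qed.

(** The factor e^{<h, w>/t} is expanded to first order under the integral sign. The partial
    derivatives are the integrals against conj(w_j) / t, and the remainder is dominated by a
    multiple of [E]. *)
Lemma bergman_entire G : nice t G -> entire (bergman G).
Proof.
move=> nG z; have nK u := nice_fockK u nG.
pose c j := Cint mu (fun w => (T^-1)%:C * ((w 0 j - 0)^* * (fockK t z w * G w))).
have ic j : Cibl mu (fun w => (T^-1)%:C * ((w 0 j - 0)^* * (fockK t z w * G w))).
  by apply: nice_Cibl; apply: niceZ; apply: nice_coordJ.
pose E w : R[i] := (expR (3 / T * enorm w))%:C * (fockK t z w * G w).
have iE : Cibl mu E by have [_] := nK z; apply.
pose M := 3 * \int[mu]_w normc (E w).
have M0 : 0 <= M by rewrite mulr_ge0// Rintegral_ge0// => w _; exact: normc_ge0.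
apply: (@coord_form_differentiable _ _ _ _ c M M0) => h h1.
pose x w := herm h w / T%:C.
have ix : Cibl mu (fun w => \sum_j h 0 j * ((T^-1)%:C * ((w 0 j - 0)^* * (fockK t z w * G w)))).
  by apply: Cibl_sum => j; exact: CiblZ.
have xE w : \sum_j h 0 j * ((T^-1)%:C * ((w 0 j - 0)^* * (fockK t z w * G w))) =
    x w * (fockK t z w * G w).
  rewrite /x /herm !mulr_suml; apply: eq_bigr => j _.
  rewrite subr0 (_ : T%:C^-1 = (T^-1)%:C :> R[i]); last by rewrite rmorphV ?unitfE ?gt_eqF.
  by ring.
have -> : bergman G (h + z) - bergman G z - \sum_j c j * h 0 j =
    Cint mu (fun w => (cexp (x w) - 1 - x w) * (fockK t z w * G w)).
  have -> : \sum_j c j * h 0 j = Cint mu (fun w => \sum_j h 0 j *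
      ((T^-1)%:C * ((w 0 j - 0)^* * (fockK t z w * G w)))).
    rewrite Cint_sum; last by move=> j; exact: CiblZ.
    by apply: eq_bigr => j _; rewrite CintZ// mulrC.
  rewrite /bergman -!CintB//; try (by apply: nice_Cibl); last first.
    by apply: CiblB; exact: nice_Cibl.
  by apply: eq_Cint => w; rewrite xE fockK_addl; ring.
have iD : Cibl mu (fun w => (cexp (x w) - 1 - x w) * (fockK t z w * G w)).
  have : Cibl mu (fun w => fockK t (h + z) w * G w - fockK t z w * G w -
     \sum_j h 0 j * ((T^-1)%:C * ((w 0 j - 0)^* * (fockK t z w * G w)))).
    by apply: CiblB => //; apply: CiblB; exact: nice_Cibl.
  rewrite (_ : (fun w => _) = (fun w => (cexp (x w) - 1 - x w) * (fockK t z w * G w)))//.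
  by apply/funext => w; rewrite xE fockK_addl; ring.
have l0 := lnorm1_ge0 h.
apply: le_trans (le_normc_Cint iD) _.
rewrite (_ : M * _ = \int[mu]_w (3 * lnorm1 h ^+ 2 * normc (E w))); last first.
  rewrite RintegralZl//; last exact: Cibl_normc.
  by rewrite /M; ring.
apply: le_Rintegral => //.
- exact: Cibl_normc.
- exact: (integrableZl measurableT (3 * lnorm1 h ^+ 2) (Cibl_normc iE)).
move=> w _; rewrite !Normc.normcM normc_real ger0_norm ?expR_ge0//.
rewrite [leRHS]mulrA ler_wpM2r ?mulr_ge0 ?normc_ge0//.
exact: cexp_remainder_bound.
Qed.

Let M1 z w : normc (1 : R[i]) <= 1 * expR (sqnorm (w - z) / (4 * T)).
Proof.
by rewrite Normc.normc1 mul1r -[leLHS]expR0 ler_expR divr_ge0 ?sqnorm_ge0 ?mulr_ge0.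
Qed.

Let m1 : Cmeas ((fun=> 1) : Cn * Cn -> R[i]). Proof. exact: Cmeas_cst. Qed.

Lemma bergmanE F : bergman F = kernel_op t (fun=> 1) F.
Proof. by apply/funext => z; apply: eq_Cint => w; rewrite mul1r. Qed.

Lemma bergman_L2le F c : L2le t F c -> L2le t (bergman F) (4 ^+ n * c).
Proof.
by move=> hF; rewrite bergmanE -[_ * c]mul1r; exact: kernel_op_L2le m1 ler01 M1 _ _ hF.
Qed.

Lemma bergman_fock F c : L2le t F c -> fock t (bergman F).
Proof.
move=> hF; split; first by apply: bergman_entire; exact: L2le_nice hF.
exact: L2le_L2 (bergman_L2le hF).
Qed.

Lemma bergman_adjoint F H a b : L2le t F a -> L2le t H b ->
  Cint mu (fun z => bergman F z * (H z)^*) = Cint mu (fun w => F w * (bergman H w)^*).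
Proof.
move=> hF hH; rewrite !bergmanE (kernel_op_adjoint m1 ler01 M1 hF hH).
by rewrite (_ : (fun=> 1^*) = fun=> 1)//; apply/funext => x; rewrite rmorph1.
Qed.

Lemma bergman_id h : nice t h -> line_holo h -> bergman h = h.
Proof.
move=> nh hh; apply/funext => z; rewrite -[RHS](reproducing z nh hh).
by apply: eq_Cint => w; rewrite mulrC.
Qed.

Lemma fock_L2le h : fock t h -> exists c, L2le t h c.
Proof. by move=> [_ /L2_L2le]. Qed.

Lemma fock_nice h : fock t h -> nice t h.
Proof. by move=> /fock_L2le[c]; exact: L2le_nice. Qed.

Lemma fock_line_holo h : fock t h -> line_holo h.
Proof. by move=> [/entire_line_holo]. Qed.

Lemma fock_bergman h : fock t h -> bergman h = h.
Proof. by move=> fh; apply: bergman_id; [exact: fock_nice|exact: fock_line_holo]. Qed.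

Lemma fockK_L2le u : exists c, L2le t (fun z => fockK t z u) c.
Proof.
apply: L2_L2le; have mK : Cmeas (fun z => fockK t z u).
  by apply: Cmeas_fockK; [exact: measurable_id|exact: measurable_cst].
have [m2 i2] := Cibl_expR n t (2 * (lnorm1 u / T)).
pose I := (\int[mu]_w (normc (fockK t w u) ^+ 2)%:E)%E.
have I0 : (0 <= I)%E by apply: integral_ge0 => w _; rewrite lee_fin sqr_ge0.
have If : I \is a fin_num.
  rewrite ge0_fin_numE//; apply: le_lt_trans i2; apply: ge0_le_integral => //.
  - by move=> w _; rewrite lee_fin sqr_ge0.
  - by apply/measurable_EFinP; apply: measurable_funX; exact: Cmeas_normc.
  - by apply/measurable_EFinP; exact: Cmeas_normc.
  move=> w _; rewrite lee_fin normc_real ger0_norm ?expR_ge0//.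
  rewrite -mulrA expRM_natl ler_pXn2r ?nnegrE ?normc_ge0 ?expR_ge0//.
  by rewrite -fockKJ normcJ normc_fockK_le.
apply: (@L2le_L2 _ _ _ _ (Num.sqrt (fine I))); split => //.
by rewrite sqr_sqrtr ?fine_ge0// fineK.
Qed.

Lemma fockK_nice u : nice t (fun z => fockK t z u).
Proof. by have [c] := fockK_L2le u; exact: L2le_nice. Qed.

Lemma fockK_line_holo u : line_holo (fun z => fockK t z u).
Proof.
move=> z w; rewrite (_ : (fun s => _) =
    @cexp R \o (fun s => herm z u / T%:C + s * (herm w u / T%:C))).
  apply: holo_comp; first exact: cexp_holo.
  apply: holoD; first exact: holo_cst.
  by apply: holoM; [exact: holo_id|exact: holo_cst].
by apply/funext => s /=; rewrite /fockK hermDl hermZl mulrDl mulrA.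
Qed.

(** The kernel section equals its own Bergman integral, and such integrals are entire; by hand one
    only checks holomorphy on lines. *)
Lemma fockK_fock u : fock t (fun z => fockK t z u).
Proof.
have [c hc] := fockK_L2le u; have := bergman_fock hc.
by rewrite bergman_id//; [exact: fockK_nice|exact: fockK_line_holo].
Qed.

Lemma bergman_inner F z : bergman F z = Cint mu (fun w => F w * (fockK t w z)^*).
Proof. by apply: eq_Cint => w; rewrite num_conjE fockKJ mulrC. Qed.

Lemma bergman_is_fock_proj F c : L2le t F c -> is_fock_proj t F (bergman F).
Proof.
move=> hF; split=> [|h fh]; first exact: bergman_fock hF.
have [b hb] := fock_L2le fh; have hP := bergman_L2le hF.
rewrite /L2inner -[Cintegral _ _]/(Cint mu _).
under eq_Cint do rewrite mulrBl.
rewrite CintB; [|exact: L2le_Cibl hF hb|exact: L2le_Cibl hP hb].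
by rewrite (bergman_adjoint hF hb) fock_bergman// subrr.
Qed.

(** The kernel sections lie in the Fock space, and pairing F - G with the section at z gives G z =
    bergman F z for every z. *)
Lemma is_fock_proj_bergman F G c : L2le t F c -> is_fock_proj t F G -> G = bergman F.
Proof.
move=> hF [fG hG]; rewrite -[G]fock_bergman//; apply/funext => z.
have [b hb] := fock_L2le fG; have [k hk] := fockK_L2le z.
have := hG _ (fockK_fock z); rewrite /L2inner -[Cintegral _ _]/(Cint mu _).
under eq_Cint do rewrite mulrBl.
rewrite CintB; [|exact: L2le_Cibl hF hk|exact: L2le_Cibl hb hk].
by rewrite !bergman_inner => /eqP; rewrite subr_eq0 => /eqP ->.
Qed.

(** The Bergman integral witnesses existence, so the default value of [xget] is not taken, and
    uniqueness holds pointwise. From here on Toeplitz operators are integral operators. *)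
Lemma fock_projE F c : L2le t F c -> fock_proj t F = bergman F.
Proof.
move=> hF; apply: (is_fock_proj_bergman hF); rewrite /fock_proj.
by case: xgetP => // h; case: (h (bergman F)); exact: bergman_is_fock_proj hF.
Qed.

Lemma bergmanZ (k : R[i]) F a : L2le t F a ->
  bergman (fun w => k * F w) = fun z => k * bergman F z.
Proof.
move=> hF; apply/funext => z; rewrite /bergman -CintZ.
- by apply: eq_Cint => w; rewrite mulrCA.
- by apply: nice_Cibl; apply: nice_fockK; exact: L2le_nice hF.
Qed.

Lemma bergmanB F G a b : L2le t F a -> L2le t G b ->
  bergman (fun w => F w - G w) = fun z => bergman F z - bergman G z.
Proof.
move=> hF hG; apply/funext => z; rewrite /bergman -CintB.
- by apply: eq_Cint => w; rewrite mulrBr.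
- by apply: nice_Cibl; apply: nice_fockK; exact: L2le_nice hF.
- by apply: nice_Cibl; apply: nice_fockK; exact: L2le_nice hG.
Qed.

End Bergman.

(** * First order Taylor expansion *)

Lemma mean_value_at0 (R : realType) (phi : R -> R) s :
  (forall c, derivable phi c 1) ->
  exists2 c, `|c| <= `|s| & phi s - phi 0 = s * derive1 phi c.
Proof.
move=> dphi.
have cphi (A : set R) : {within A, continuous phi}.
  apply: continuous_subspaceT => x; apply: differentiable_continuous.
  exact/derivable1_diffP.
have dd (x : R) : is_derive x 1 phi (derive1 phi x).
  by rewrite derive1E; exact: derivableP.
have [s0|/ltW s0] := lerP 0 s.
  have [c /itvP cs e] := MVT_segment s0 (fun x _ => dd x) (cphi _).
  by exists c; rewrite ?ger0_norm ?cs// e subr0 mulrC.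
have [c /itvP cs e] := MVT_segment s0 (fun x _ => dd x) (cphi _).
exists c; first by rewrite !ler0_norm ?cs// lerN2 cs.
by rewrite -opprB e sub0r; ring.
Qed.

Section Directional.
Context (R : realType) (n : nat).
Local Notation Cn := ('rV[R[i]]_n).
Implicit Types (g : Cn -> R[i]) (v z w : Cn) (B C : R).

Lemma shiftZD z v (c s : R) : z + c%:C *: v + s%:C *: v = z + (s + c)%:C *: v.
Proof. by rewrite -addrA -scalerDl [s + c]addrC rmorphD. Qed.

Lemma shift_derivable (phi : R -> R) c :
  derivable (fun s => phi (s + c)) 0 1 -> derivable phi c 1.
Proof.
move=> d; have E : (fun h : R => h^-1 *: (((fun s => phi (s + c)) \o shift 0) (h *: 1) -
    phi (0 + c))) = (fun h => h^-1 *: ((phi \o shift c) (h *: 1) - phi c)).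
  by apply/funext => h /=; rewrite !addr0 add0r.
by rewrite /derivable -E; exact: d.
Qed.

Lemma shift_derive1 (phi : R -> R) c :
  derive1 (fun s => phi (s + c)) 0 = derive1 phi c.
Proof.
have E : (fun h : R => h^-1 *: (phi (h + 0 + c) - phi (0 + c))) =
    (fun h => h^-1 *: (phi (h + c) - phi c)).
  by apply/funext => h /=; rewrite !addr0 add0r.
by rewrite /derive1 E.
Qed.

(** Real and imaginary parts have different intermediate points, which costs the factor 2 in the
    next two lemmas. [Rderivable] speaks of parameter 0 only; moving the base point along the line
    gives derivability at every parameter. *)
Lemma directional_mean_value g v z s : (forall z, Rderivable v g z) ->
  (exists2 c : R, `|c| <= `|s| &
    Re (g (z + s%:C *: v)) - Re (g z) = s * Re (Rderive v g (z + c%:C *: v))) /\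
  (exists2 c : R, `|c| <= `|s| &
    Im (g (z + s%:C *: v)) - Im (g z) = s * Im (Rderive v g (z + c%:C *: v))).
Proof.
move=> dg; have z0 : z + (0 : R)%:C *: v = z by rewrite rmorph0 scale0r addr0.
split.
  pose phi (s : R) := Re (g (z + s%:C *: v)).
  have e c : (fun s : R => Re (g (z + c%:C *: v + s%:C *: v))) = (fun s => phi (s + c)).
    by apply/funext => x; rewrite shiftZD.
  have d c : derivable phi c 1.
    by have [+ _] := dg (z + c%:C *: v); rewrite e; exact: shift_derivable.
  have [c cs h] := mean_value_at0 s d; exists c; first exact: cs.
  by rewrite /Rderive e /= shift_derive1 -h /phi z0.
pose phi (s : R) := Im (g (z + s%:C *: v)).
have e c : (fun s : R => Im (g (z + c%:C *: v + s%:C *: v))) = (fun s => phi (s + c)).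
  by apply/funext => x; rewrite shiftZD.
have d c : derivable phi c 1.
  by have [_] := dg (z + c%:C *: v); rewrite e; exact: shift_derivable.
have [c cs h] := mean_value_at0 s d; exists c; first exact: cs.
by rewrite /Rderive e /= shift_derive1 -h /phi z0.
Qed.

Lemma directional_lipschitz g v B z s : (forall z, Rderivable v g z) ->
  (forall z, normc (Rderive v g z) <= B) ->
  normc (g (z + s%:C *: v) - g z) <= 2 * B * `|s|.
Proof.
move=> dg gB; have [[c1 _ e1] [c2 _ e2]] := directional_mean_value z s dg.
apply: le_trans (normc_ReIm _) _; rewrite ReD ReN ImD ImN e1 e2 !normrM.
have h1 : `|Re (Rderive v g (z + c1%:C *: v))| <= B := le_trans (normr_Re _) (gB _).
have h2 : `|Im (Rderive v g (z + c2%:C *: v))| <= B := le_trans (normr_Im _) (gB _).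
have -> : 2 * B * `|s| = `|s| * B + `|s| * B by ring.
by rewrite lerD// ler_wpM2l.
Qed.

Lemma directional_taylor g v B z s : 0 <= B -> (forall z, Rderivable v g z) ->
  (forall z (c : R), normc (Rderive v g (z + c%:C *: v) - Rderive v g z) <= B * `|c|) ->
  normc (g (z + s%:C *: v) - g z - s%:C * Rderive v g z) <= 2 * B * `|s| ^+ 2.
Proof.
move=> B0 dg gB; have [[c1 b1 e1] [c2 b2 e2]] := directional_mean_value z s dg.
have h c : `|c| <= `|s| -> normc (Rderive v g (z + c%:C *: v) - Rderive v g z) <= B * `|s|.
  by move=> cs; apply: le_trans (gB _ _) _; rewrite ler_wpM2l.
apply: le_trans (normc_ReIm _) _.
have -> : Re (g (z + s%:C *: v) - g z - s%:C * Rderive v g z) =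
    s * Re (Rderive v g (z + c1%:C *: v) - Rderive v g z).
  by rewrite !ReImE /= mul0r subr0 e1 mulrBr.
have -> : Im (g (z + s%:C *: v) - g z - s%:C * Rderive v g z) =
    s * Im (Rderive v g (z + c2%:C *: v) - Rderive v g z).
  by rewrite !ReImE /= mul0r addr0 e2 mulrBr.
have -> : 2 * B * `|s| ^+ 2 = `|s| * (B * `|s|) + `|s| * (B * `|s|) by ring.
rewrite !normrM lerD// ler_wpM2l//.
  exact: le_trans (normr_Re _) (h _ b1).
exact: le_trans (normr_Im _) (h _ b2).
Qed.

Implicit Types (l : seq (R * ('I_n * bool))).

(** The displacement of a path whose edges are moves (length, coordinate direction). Derivatives are
    given in the coordinate directions, so increments are estimated edge by edge along such a
    path. *)
Definition polyline l : Cn := \sum_(x <- l) x.1%:C *: dir R x.2.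

Definition polyline_length l : R := \sum_(x <- l) `|x.1|.

Lemma polyline_length_ge0 l : 0 <= polyline_length l.
Proof. by rewrite sumr_ge0. Qed.

Lemma polyline_lipschitz g B w l : (forall k z, Rderivable (dir R k) g z) ->
  (forall k z, normc (Rderive (dir R k) g z) <= B) ->
  normc (g (w + polyline l) - g w) <= 2 * B * polyline_length l.
Proof.
move=> dg gB; rewrite /polyline /polyline_length; elim: l w => [|[s k] l ih] w.
  by rewrite !big_nil addr0 subrr Normc.normc0 mulr0.
rewrite !big_cons /= addrA.
rewrite (_ : _ - _ = (g (w + s%:C *: dir R k + \sum_(j <- l) j.1%:C *: dir R j.2) -
  g (w + s%:C *: dir R k)) + (g (w + s%:C *: dir R k) - g w)); last by rewrite addrA subrK.
apply: le_trans (le_normcD _ _) _; rewrite addrC mulrDr lerD//.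
exact: directional_lipschitz.
Qed.

Lemma polyline_taylor g B w l : 0 <= B -> (forall k z, Rderivable (dir R k) g z) ->
  (forall k z l, normc (Rderive (dir R k) g (z + polyline l) - Rderive (dir R k) g z)
     <= B * polyline_length l) ->
  normc (g (w + polyline l) - g w - \sum_(x <- l) x.1%:C * Rderive (dir R x.2) g w)
    <= 2 * B * polyline_length l ^+ 2.
Proof.
move=> B0 dg gB.
have gB1 k z (c : R) : normc (Rderive (dir R k) g (z + c%:C *: dir R k) -
    Rderive (dir R k) g z) <= B * `|c|.
  by have := gB k z [:: (c, k)]; rewrite /polyline /polyline_length !big_seq1.
have gB2 k' k z (c : R) : normc (Rderive (dir R k') g (z + c%:C *: dir R k) -
    Rderive (dir R k') g z) <= B * `|c|.
  by have := gB k' z [:: (c, k)]; rewrite /polyline /polyline_length !big_seq1.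
elim: l w => [|[s k] l ih] w.
  rewrite /polyline /polyline_length !big_nil addr0 !subrr Normc.normc0.
  by rewrite expr0n mulr0.
have := ih (w + s%:C *: dir R k).
have := polyline_length_ge0 l.
rewrite /polyline /polyline_length !big_cons /= addrA.
set p := \sum_(x <- l) x.1%:C *: dir R x.2; set L := \sum_(x <- l) `|x.1|.
set w' := w + s%:C *: dir R k; set S' := \sum_(x <- l) _ * _; set S := \sum_(x <- l) _ * _.
move=> L0 ihw.
have SS : normc (S' - S) <= L * (B * `|s|).
  rewrite /S' /S -sumrB /L mulr_suml; apply: le_trans (le_normc_sum _ _ _) _.
  apply: ler_sum => x _; rewrite -mulrBr Normc.normcM normc_real.
  by rewrite ler_wpM2l// gB2.
have one := directional_taylor w s B0 (dg k) (gB1 k).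
rewrite -/w' in one.
(* Three errors: the remaining path expanded at w', the change of its derivatives from w' to w, and
   the first edge expanded at w. *)
have -> : g (w' + p) - g w - (s%:C * Rderive (dir R k) g w + S) =
   (g (w' + p) - g w' - S') + (S' - S) + (g w' - g w - s%:C * Rderive (dir R k) g w).
  by ring.
apply: le_trans (le_normcD _ _) _.
apply: le_trans (lerD (le_normcD _ _) one) _.
apply: le_trans (lerD (lerD ihw SS) (lexx _)) _.
have s0 := normr_ge0 s.
(* Of the cross term 4 B L |s| in 2 B (|s| + L)^2, the change of derivatives uses B L |s|. *)
rewrite -subr_ge0 (_ : _ - _ = 3 * B * (L * `|s|)); last by ring.
by rewrite !mulr_ge0.
Qed.

Definition path_to w : seq (R * ('I_n * bool)) :=
  [seq ((if k.2 then Im (w 0 k.1) else Re (w 0 k.1)), k) | k : 'I_n * bool].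

Lemma path_toE (V : nmodType) (F : R -> 'I_n * bool -> V) w :
  \sum_(x <- path_to w) F x.1 x.2 =
  \sum_j (F (Re (w 0 j)) (j, false) + F (Im (w 0 j)) (j, true)).
Proof.
rewrite /path_to big_image /=.
transitivity (\sum_(p : 'I_n * bool) F (if p.2 then Im (w 0 p.1) else Re (w 0 p.1)) (p.1, p.2)).
  by apply: eq_big => // -[j b].
rewrite -(pair_bigA _ (fun j b => F (if b then Im (w 0 j) else Re (w 0 j)) (j, b))).
by apply: eq_bigr => j _; rewrite big_bool addrC.
Qed.

Lemma polyline_path w : polyline (path_to w) = w.
Proof.
rewrite /polyline (path_toE (fun s k => s%:C *: dir R k)).
rewrite [RHS]row_sum_delta; apply: eq_bigr => j _.
rewrite /dir /= /ydir /xdir scalerA -scalerDl; congr (_ *: _).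
by rewrite mulrC -complexE.
Qed.

Lemma polyline_length_path w : polyline_length (path_to w) <= 2 * n%:R * enorm w.
Proof.
rewrite /polyline_length (path_toE (fun s _ => `|s|)).
have -> : 2 * n%:R * enorm w = \sum_(j < n) 2 * enorm w.
  by rewrite sumr_const card_ord -mulr_natl; ring.
apply: ler_sum => j _; rewrite mulr_natl mulr2n lerD//.
  exact: le_trans (normr_Re _) (normc_coord _ _).
exact: le_trans (normr_Im _) (normc_coord _ _).
Qed.

Lemma wirtinger_sum g z w :
  \sum_(x <- path_to w) x.1%:C * Rderive (dir R x.2) g z =
  \sum_j (wirtinger j g z * w 0 j + wirtinger_bar j g z * (w 0 j)^*).
Proof.
rewrite (path_toE (fun s k => s%:C * Rderive (dir R k) g z)); apply: eq_bigr => j _.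
rewrite /wirtinger /wirtinger_bar /dir /=.
set X := Rderive _ g z; set Y := Rderive _ g z.
case: (w 0 j) => x y; rewrite num_conjE /=.
have -> : x +i* (- y) = x%:C - 'i * y%:C :> R[i].
  by apply: complex_eqP; rewrite ?num_conjE !ReImE /=; ring.
have -> : x +i* y = x%:C + 'i * y%:C :> R[i] by apply: complex_eqP; rewrite !ReImE /=; ring.
have i2 : 'i * 'i = -1 :> R[i] by rewrite -expr2 sqr_i.
have -> : (X - 'i * Y) / 2 * (x%:C + 'i * y%:C) + (X + 'i * Y) / 2 * (x%:C - 'i * y%:C) =
  x%:C * X - ('i * 'i) * (y%:C * Y) by field.
by rewrite i2 mulN1r opprK.
Qed.

End Directional.

Lemma measurable_countable_comp d (X : measurableType d) (I : countType) (R : realType)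
    (p : X -> I) (g : I -> R) :
  (forall i, measurable (p @^-1` [set i])) -> measurable_fun setT (fun x => g (p x)).
Proof.
move=> mp _ Y _; rewrite setTI.
pose A k := if unpickle k is Some i then (if g i \in Y then p @^-1` [set i] else set0) else set0.
rewrite [X in measurable X](_ : _ = \bigcup_k A k); last first.
  apply/seteqP; split=> [x Yx|x [k _]].
    by exists (pickle (p x)) => //; rewrite /A pickleK mem_set.
  rewrite /A; case: unpickle => // i; case: ifPn => // /[!inE] Yi.
  by rewrite /preimage /= => ->.
apply: bigcupT_measurable => k; rewrite /A; case: unpickle => // i.
by case: ifP => // _; exact: mp.
Qed.

Section LipschitzMeasurable.
Context (R : realType) (n : nat).
Local Notation Cn := ('rV[R[i]]_n).

(* A Lipschitz function is the limit of its discretizations, which take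
   countably many values. *)
Definition grid (m : nat) (z : Cn) : {ffun 'I_n -> int * int} :=
  [ffun j => (Num.floor (m.+1%:R * Re (z 0 j)), Num.floor (m.+1%:R * Im (z 0 j)))].

Definition grid_point (m : nat) (x : {ffun 'I_n -> int * int}) : Cn :=
  \row_j ((m.+1%:R^-1 * (x j).1%:~R) +i* (m.+1%:R^-1 * (x j).2%:~R)).

Lemma measurable_floor_eq d (X : measurableType d) (f : X -> R) (a : int) :
  measurable_fun setT f -> measurable [set x | Num.floor (f x) = a].
Proof.
move=> mf; rewrite [X in measurable X](_ : _ = f @^-1` `[a%:~R, (a + 1)%:~R[%classic).
  by rewrite -[X in measurable X]setTI; apply: mf.
apply/seteqP; split=> x /=; rewrite in_itv /=.
  by move=> <-; exact: floor_itv.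
by move=> /floor_def.
Qed.

Lemma measurable_grid m x : measurable (grid m @^-1` [set x]).
Proof.
rewrite (_ : grid m @^-1` [set x] = \bigcap_(j in [set: 'I_n])
  ([set z : Cn | Num.floor (m.+1%:R * Re (z 0 j)) = (x j).1] `&`
   [set z : Cn | Num.floor (m.+1%:R * Im (z 0 j)) = (x j).2])).
  apply: fin_bigcap_measurable => [|j _]; first exact: finite_finset.
  have [mR mI] := @Cmeas_coord R n j.
  by apply: measurableI; apply: measurable_floor_eq; exact: measurable_funM.
apply/seteqP; split=> [z /= <- j _|z h]; first by rewrite ffunE.
by apply/ffunP => j; rewrite ffunE; have [-> ->] := h j I; case: (x j).
Qed.

Lemma floor_approx m (a : R) :
  `|m.+1%:R^-1 * (Num.floor (m.+1%:R * a))%:~R - a| <= m.+1%:R^-1.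
Proof.
have p : 0 < m.+1%:R :> R by rewrite ltr0n.
have /andP[h1 h2] := floor_itv (m.+1%:R * a).
have -> : m.+1%:R^-1 * (Num.floor (m.+1%:R * a))%:~R - a =
  m.+1%:R^-1 * ((Num.floor (m.+1%:R * a))%:~R - m.+1%:R * a).
  by rewrite mulrBr mulrA mulVf ?mul1r ?gt_eqF.
rewrite normrM gtr0_norm ?invr_gt0// -[leRHS]mulr1 ler_wpM2l ?invr_ge0//.
by move: h1 h2; rewrite intrD ler_norml; lra.
Qed.

Lemma enorm_lnorm1 (z : Cn) : enorm z <= lnorm1 z.
Proof.
rewrite -[leRHS]ger0_norm ?lnorm1_ge0// -sqrtr_sqr ler_sqrt ?sqr_ge0//.
rewrite sqnormE [leRHS]expr2 {1}/lnorm1 mulr_suml ler_sum// => j _.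
rewrite expr2 ler_wpM2l ?normc_ge0// /lnorm1 (bigD1 j)//= lerDl sumr_ge0// => k _.
exact: normc_ge0.
Qed.

Lemma grid_approx m z : enorm (grid_point m (grid m z) - z) <= 2 * n%:R * m.+1%:R^-1.
Proof.
apply: le_trans (enorm_lnorm1 _) _.
have -> : 2 * n%:R * m.+1%:R^-1 = \sum_(j < n) (2 * m.+1%:R^-1) :> R.
  by rewrite sumr_const card_ord -[RHS]mulr_natl [RHS]mulrA [n%:R * 2]mulrC.
apply: ler_sum => j _; apply: le_trans (normc_ReIm _) _.
rewrite !mxE ffunE !ReImE /= [leRHS]mulr_natl [leRHS]mulr2n.
by apply: lerD; exact: floor_approx.
Qed.

(** The source of measurability for the symbols and their Wirtinger derivatives, with respect to the
    transported sigma-algebra of C^n. *)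
Lemma lipschitz_measurable (f : Cn -> R) C :
  (forall z w, `|f z - f w| <= C * enorm (z - w)) -> measurable_fun setT f.
Proof.
move=> hf; apply: (@measurable_fun_cvg _ _ _ _ (fun m z => f (grid_point m (grid m z)))).
  move=> m; apply: (@measurable_countable_comp _ _ _ _ (grid m) (fun x => f (grid_point m x))).
  exact: measurable_grid.
move=> z _; apply/cvgrPdist_le => e e0.
pose D := `|C| * (2 * n%:R) + 1.
have D0 : 0 < D by rewrite ltr_wpDl// mulr_ge0.
have h : (harmonic : R^nat) @ \oo --> 0 by exact: cvg_harmonic.
have /cvgrPdist_le /(_ (e / D)) := h.
rewrite divr_gt0// => /(_ isT) [N _ hN]; exists N => // m /hN.
rewrite /= sub0r normrN ger0_norm ?invr_ge0// => hm.
rewrite distrC; apply: le_trans (hf _ _) _.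
apply: le_trans (ler_wpM2r (enorm_ge0 _) (ler_norm C)) _.
apply: le_trans (ler_wpM2l (normr_ge0 _) (grid_approx m z)) _.
move: hm; rewrite ler_pdivlMr// mulrC; apply: le_trans.
by rewrite [leLHS]mulrA ler_wpM2r ?invr_ge0// lerDl.
Qed.

Lemma lipschitz_Cmeas (f : Cn -> R[i]) C :
  (forall z w, normc (f z - f w) <= C * enorm (z - w)) -> Cmeas f.
Proof.
move=> hf; split; apply: (@lipschitz_measurable _ C) => z w.
  by rewrite -ReN -ReD (le_trans (normr_Re _)).
by rewrite -ImN -ImD (le_trans (normr_Im _)).
Qed.

End LipschitzMeasurable.

(** * Symbols with a first order expansion *)

Section FirstOrder.
Context (R : realType) (n : nat).
Local Notation Cn := ('rV[R[i]]_n).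
Implicit Types (f : Cn -> R[i]) (a b : 'I_n -> Cn -> R[i]) (C : R).

Definition bounded_lipschitz C f : Prop :=
  (forall z, normc (f z) <= C) /\ (forall z w, normc (f z - f w) <= C * enorm (z - w)).

(** What the commutator estimate uses of a symbol, with one constant for all bounds. Keeping the
    derivatives [a] and [b] as parameters lets complex conjugation act by exchanging them, in
    [first_orderJ]. *)
Definition first_order C f a b : Prop :=
  [/\ bounded_lipschitz C f,
      forall j, bounded_lipschitz C (a j) /\ bounded_lipschitz C (b j) &
      forall u w, normc (f u - f w - \sum_j (a j w * (u - w) 0 j + b j w * ((u - w) 0 j)^*))
        <= C * enorm (u - w) ^+ 2 ].

Lemma bounded_lipschitz_ge0 C f : bounded_lipschitz C f -> 0 <= C.
Proof. by move=> [/(_ 0) h _]; exact: le_trans (normc_ge0 _) h. Qed.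

Lemma bounded_lipschitz_Cmeas C f : bounded_lipschitz C f -> Cmeas f.
Proof. by move=> [_ /lipschitz_Cmeas]. Qed.

Lemma bounded_lipschitz_weaken C D f : C <= D -> bounded_lipschitz C f ->
  bounded_lipschitz D f.
Proof.
move=> CD [h1 h2]; split=> [z|z w]; first exact: le_trans (h1 z) CD.
by apply: le_trans (h2 z w) _; rewrite ler_wpM2r ?enorm_ge0.
Qed.

Lemma bounded_lipschitzJ C f : bounded_lipschitz C f -> bounded_lipschitz C (fun z => (f z)^*).
Proof.
move=> [h1 h2]; split=> [z|z w]; first by rewrite normcJ.
by rewrite -rmorphB normcJ.
Qed.

Lemma bounded_lipschitz_half C f g (k : R[i]) : normc k = 1 ->
  bounded_lipschitz C f -> bounded_lipschitz C g ->
  bounded_lipschitz C (fun z => (f z + k * g z) / 2).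
Proof.
move=> k1 [f1 f2] [g1 g2].
have e (x : R[i]) : normc (x / 2) = normc x / 2.
  have -> : 2^-1 = (2^-1 : R)%:C by rewrite rmorphV ?unitfE// rmorph_nat.
  by rewrite Normc.normcM normc_real ger0_norm.
split=> [z|z w]; rewrite ?e.
  rewrite ler_pdivrMr// mulr_natr mulr2n (le_trans (le_normcD _ _))//.
  by rewrite lerD// Normc.normcM k1 mul1r.
rewrite -mulrBl e ler_pdivrMr// mulr_natr mulr2n.
have -> : f z + k * g z - (f w + k * g w) = (f z - f w) + k * (g z - g w) by ring.
by rewrite (le_trans (le_normcD _ _))// lerD// Normc.normcM k1 mul1r.
Qed.

Lemma buc_bounded f : buc f -> exists2 B : R, 0 <= B & forall z, normc (f z) <= B.
Proof.
move=> [[M [Mr hM]] _].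
have h z : `|f z : R[i]| <= M + 1 by apply: (hM (M + 1)) => //; rewrite ltrDl.
have B z : normc (f z) <= Re (M + 1).
  by have := h z; rewrite normr_normc lecE /= => /andP[].
by exists (Re (M + 1)) => //; exact: le_trans (normc_ge0 _) (B 0).
Qed.

Lemma finite_bound (I : finType) (P : I -> R -> Prop) :
  (forall i (C D : R), C <= D -> P i C -> P i D) ->
  (forall i, exists2 C, 0 <= C & P i C) -> exists2 C, 0 <= C & forall i, P i C.
Proof.
move=> mono h.
have [B hB] := @choice _ _ (fun i C => 0 <= C /\ P i C) (fun i => let: ex_intro2 C a b := h i in ex_intro _ C (conj a b)).
exists (\sum_i B i); first by rewrite sumr_ge0// => i _; case: (hB i).
move=> i; apply: mono (hB i).2; rewrite (bigD1 i)//= lerDl sumr_ge0// => j _.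
by case: (hB j).
Qed.

(** Bounded second derivatives make the first ones Lipschitz along coordinate paths, which gives the
    quadratic remainder. C is a sum of all the bounds obtained, so it dominates each of them. *)
Lemma C2buc_first_order f : C2buc f ->
  exists C, first_order C f (fun j => wirtinger j f) (fun j => wirtinger_bar j f).
Proof.
move=> [bf df ddf].
have [B0 B00 hB0] := buc_bounded bf.
have [B1 B10 hB1] : exists2 C : R, 0 <= C & forall k z, normc (Rderive (dir R k) f z) <= C.
  apply: (@finite_bound _ (fun k C => forall z, normc (Rderive (dir R k) f z) <= C)).
    by move=> k C D CD h z; exact: le_trans (h z) CD.
  by move=> k; have [_ /buc_bounded] := df k.
have [B2 B20 hB2] : exists2 C : R, 0 <= C & forall x z,
    normc (Rderive (dir R x.2) (Rderive (dir R x.1) f) z) <= C.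
  apply: (@finite_bound _ (fun x C => forall z,
    normc (Rderive (dir R x.2) (Rderive (dir R x.1) f) z) <= C)).
    by move=> x C D CD h z; exact: le_trans (h z) CD.
  by move=> [k l]; have [_ /buc_bounded] := ddf k l.
pose N : R := 2 * n%:R; have N0 : 0 <= N by rewrite mulr_ge0.
have len w : polyline_length (path_to w) <= N * enorm w := polyline_length_path w.
have lipf z w : normc (f z - f w) <= 2 * B1 * N * enorm (z - w).
  have := polyline_lipschitz w (path_to (z - w)) (fun k => (df k).1) hB1.
  rewrite polyline_path [w + _]addrC subrK => h; apply: le_trans h _.
  by rewrite -[leRHS]mulrA ler_wpM2l// mulr_ge0.
have lipd0 k z l : normc (Rderive (dir R k) f (z + polyline l) - Rderive (dir R k) f z)
    <= 2 * B2 * polyline_length l.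
  by apply: polyline_lipschitz => [k' z'|k' z']; [exact: (ddf k k').1|exact: (hB2 (k, k'))].
have lipd k z w : normc (Rderive (dir R k) f z - Rderive (dir R k) f w) <=
    2 * B2 * N * enorm (z - w).
  have := lipd0 k w (path_to (z - w)).
  rewrite polyline_path [w + _]addrC subrK => h; apply: le_trans h _.
  by rewrite -[leRHS]mulrA ler_wpM2l// mulr_ge0.
have tay u w : normc (f u - f w - \sum_j (wirtinger j f w * (u - w) 0 j +
    wirtinger_bar j f w * ((u - w) 0 j)^*)) <= 4 * B2 * N ^+ 2 * enorm (u - w) ^+ 2.
  have B2' : 0 <= 2 * B2 by rewrite mulr_ge0.
  have := polyline_taylor w (path_to (u - w)) B2' (fun k => (df k).1) lipd0.
  rewrite polyline_path wirtinger_sum [w + _]addrC subrK => h; apply: le_trans h _.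
  have -> : 4 * B2 * N ^+ 2 * enorm (u - w) ^+ 2 = 2 * (2 * B2) * (N * enorm (u - w)) ^+ 2.
    by ring.
  rewrite ler_wpM2l ?mulr_ge0// ler_pXn2r ?nnegrE ?polyline_length_ge0//.
  by rewrite mulr_ge0 ?enorm_ge0.
pose C := B0 + (B1 + (2 * B1 * N + (2 * B2 * N + 4 * B2 * N ^+ 2))).
have p1 : 0 <= 2 * B1 * N by rewrite !mulr_ge0.
have p2 : 0 <= 2 * B2 * N by rewrite !mulr_ge0.
have p3 : 0 <= 4 * B2 * N ^+ 2 by rewrite !mulr_ge0// exprn_ge0.
have e0 (x : Cn) := enorm_ge0 x.
have bd k : bounded_lipschitz C (Rderive (dir R k) f).
  split=> [z|z w]; first by apply: le_trans (hB1 k z) _; rewrite /C; lra.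
  by apply: le_trans (lipd k z w) _; rewrite ler_wpM2r// /C; lra.
exists C; split.
- split=> [z|z w]; first by apply: le_trans (hB0 z) _; rewrite /C; lra.
  by apply: le_trans (lipf z w) _; rewrite ler_wpM2r// /C; lra.
- move=> j; split.
    have := @bounded_lipschitz_half C _ _ (- 'i) _ (bd (j, false)) (bd (j, true)).
    rewrite normcN normc_i => /(_ erefl).
    by under eq_fun do rewrite mulNr.
  by apply: bounded_lipschitz_half; [exact: normc_i|exact: (bd (j, false))|exact: (bd (j, true))].
- move=> u w; apply: le_trans (tay u w) _.
  by rewrite ler_wpM2r ?sqr_ge0// /C; lra.
Qed.

Lemma first_orderJ C f a b : first_order C f a b ->
  first_order C (fun z => (f z)^*) (fun j z => (b j z)^*) (fun j z => (a j z)^*).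
Proof.
move=> [hf hab ht]; split; first exact: bounded_lipschitzJ.
  by move=> j; have [ha hb] := hab j; split; exact: bounded_lipschitzJ.
move=> u w; rewrite -normcJ; apply: le_trans (ht u w).
rewrite le_eqVlt; apply/orP; left; apply/eqP; congr normc.
rewrite !rmorphB !rmorph_sum /= !conjcK; congr (_ - _).
by apply: eq_bigr => j _; rewrite !rmorphD !rmorphM /= !conjcK addrC.
Qed.

End FirstOrder.

(** * The commutator estimate *)

Section Inner.
Context (R : realType) (n : nat) (t : {posnum R}).
Local Notation Cn := ('rV[R[i]]_n).
Local Notation mu := (@gaussCn R n t).
Implicit Types (F G H : Cn -> R[i]) (a b c C : R).

Definition inner F G : R[i] := Cint mu (fun w => F w * (G w)^*).

Definition sqint F : Prop := exists c, L2le t F c.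

Lemma sqintD F G : sqint F -> sqint G -> sqint (fun w => F w + G w).
Proof. by move=> [a hF] [b hG]; exists (a + b); exact: L2leD. Qed.

Lemma sqintB F G : sqint F -> sqint G -> sqint (fun w => F w - G w).
Proof. by move=> [a hF] [b hG]; exists (a + b); exact: L2leB. Qed.

Lemma sqintZ (k : R[i]) F : sqint F -> sqint (fun w => k * F w).
Proof. by move=> [a hF]; exists (normc k * a); exact: L2leZ. Qed.

Lemma sqint_sum I (s : seq I) (F : I -> Cn -> R[i]) : (forall i, sqint (F i)) ->
  sqint (fun w => \sum_(i <- s) F i w).
Proof.
move=> h; elim: s => [|i s ih].
  by exists 0; under eq_fun do rewrite big_nil; exact: L2le0.
by under eq_fun do rewrite big_cons; exact: sqintD.
Qed.

Lemma sqint_bergman F : sqint F -> sqint (bergman t F).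
Proof. by move=> [a hF]; exists (4 ^+ n * a); exact: bergman_L2le. Qed.

Lemma bounded_lipschitz_L2le C G F c : bounded_lipschitz C G -> L2le t F c ->
  L2le t (fun w => G w * F w) (C * c).
Proof.
move=> hG; apply: L2leM; first exact: bounded_lipschitz_ge0 hG.
  exact: bounded_lipschitz_Cmeas hG.
by case: hG.
Qed.

Lemma bounded_lipschitz_sqint C G F : bounded_lipschitz C G -> sqint F ->
  sqint (fun w => G w * F w).
Proof. by move=> hG [c hF]; exists (C * c); exact: bounded_lipschitz_L2le. Qed.

Lemma inner_le F G a b : L2le t F a -> L2le t G b -> normc (inner F G) <= a * b.
Proof. exact: L2le_inner. Qed.

Let inner_Cibl F G : sqint F -> sqint G -> Cibl mu (fun w => F w * (G w)^*).
Proof. by move=> [a hF] [b hG]; exact: L2le_Cibl hF hG. Qed.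

Lemma innerBl F G H : sqint F -> sqint G -> sqint H ->
  inner (fun w => F w - G w) H = inner F H - inner G H.
Proof.
move=> hF hG hH; rewrite /inner -CintB; [|exact: inner_Cibl|exact: inner_Cibl].
by apply: eq_Cint => w; rewrite mulrBl.
Qed.

Lemma innerBr F G H : sqint F -> sqint G -> sqint H ->
  inner F (fun w => G w - H w) = inner F G - inner F H.
Proof.
move=> hF hG hH; rewrite /inner -CintB; [|exact: inner_Cibl|exact: inner_Cibl].
by apply: eq_Cint => w; rewrite rmorphB mulrBr.
Qed.

Lemma innerZl (k : R[i]) F G : sqint F -> sqint G ->
  inner (fun w => k * F w) G = k * inner F G.
Proof.
move=> hF hG; rewrite /inner -CintZ; last exact: inner_Cibl.
by apply: eq_Cint => w; rewrite mulrA.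
Qed.

Lemma inner_suml (I : Type) (s : seq I) (F : I -> Cn -> R[i]) G :
  (forall i, sqint (F i)) -> sqint G ->
  inner (fun w => \sum_(i <- s) F i w) G = \sum_(i <- s) inner (F i) G.
Proof.
move=> hF hG; rewrite /inner -Cint_sum => [|i]; last exact: inner_Cibl.
by apply: eq_Cint => w; rewrite mulr_suml.
Qed.

Lemma inner_sumr (I : Type) (s : seq I) F (G : I -> Cn -> R[i]) :
  sqint F -> (forall i, sqint (G i)) ->
  inner F (fun w => \sum_(i <- s) G i w) = \sum_(i <- s) inner F (G i).
Proof.
move=> hF hG; rewrite /inner -Cint_sum => [|i]; last exact: inner_Cibl.
by apply: eq_Cint => w; rewrite rmorph_sum mulr_sumr.
Qed.

Lemma inner_mull (G : Cn -> R[i]) F H :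
  inner (fun w => G w * F w) H = inner F (fun w => (G w)^* * H w).
Proof.
by apply: eq_Cint => w; rewrite !num_conjE conjcM conjcK mulrA [G w * F w]mulrC.
Qed.

Lemma eq_inner F F' G G' : F =1 F' -> G =1 G' -> inner F G = inner F' G'.
Proof. by move=> hF hG; apply: eq_Cint => w; rewrite hF hG. Qed.

Lemma inner_bergman F G : sqint F -> sqint G -> inner (bergman t F) G = inner F (bergman t G).
Proof. by move=> [a hF] [b hG]; exact: bergman_adjoint hF hG. Qed.

Lemma fock_sqint F : fock t F -> sqint F.
Proof. exact: fock_L2le. Qed.

(* [F] is tested against itself: [|F|^2 = <F, F> <= B |F|]. *)
Lemma L2le_self F B : sqint F -> (forall c, L2le t F c -> normc (inner F F) <= B * c) ->
  0 <= B -> L2le t F B.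
Proof.
move=> [c hF] h B0; have [mF c0 iF] := hF.
pose I := (\int[mu]_w (normc (F w) ^+ 2)%:E)%E.
have I0 : (0 <= I)%E by apply: integral_ge0 => w _; rewrite lee_fin sqr_ge0.
have If : I \is a fin_num by rewrite ge0_fin_numE// (le_lt_trans iF)// ltry.
pose N := Num.sqrt (fine I).
have NI : N ^+ 2 = fine I by rewrite sqr_sqrtr// fine_ge0.
have hN : L2le t F N by split=> //; rewrite ?sqrtr_ge0// NI fineK.
have := h N hN; have -> : inner F F = (N ^+ 2)%:C.
  rewrite /inner; under eq_Cint do rewrite num_conjE mulcJ.
  by apply: complex_eqP; rewrite /= ?Rintegral_cst//= ?mul0r// NI /Rintegral.
rewrite normc_real ger0_norm ?sqr_ge0// => hNB.
have NB : N <= B.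
  have [N0|] := ltP 0 N; last by move=> /le_trans; apply.
  by move: hNB; rewrite expr2 ler_pM2r.
exact: L2le_weaken NB hN.
Qed.

End Inner.

(** * The operators R_j and Q_g, and their sizes in powers of t *)

Section KernelExpansion.
Context (R : realType) (n : nat) (t : {posnum R}).
Local Notation Cn := ('rV[R[i]]_n).
Local Notation mu := (@gaussCn R n t).
Local Notation T := (t%:num : R).
Local Notation A := (4 ^+ n : R).
Implicit Types (z w u : Cn) (f g h F G H phi : Cn -> R[i]) (c C : R).

Lemma sqnorm_weight z : sqnorm z <= 4 * T * expR (sqnorm z / (4 * T)).
Proof.
rewrite -[leLHS](_ : 4 * T * (sqnorm z / (4 * T)) = _); last by field; rewrite gt_eqF.
by rewrite ler_wpM2l ?mulr_ge0// expR_ge_id.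
Qed.

(** From y <= 1 + y^2 <= e^{y^2} with y = |z| / (2 sqrt t). Together with [sqnorm_weight] it
    converts powers of |w - z| in a symbol into powers of sqrt t. *)
Lemma enorm_weight z : enorm z <= 2 * Num.sqrt T * expR (sqnorm z / (4 * T)).
Proof.
have s0 : 0 < Num.sqrt T by rewrite sqrtr_gt0.
pose y := enorm z / (2 * Num.sqrt T).
have yE : y ^+ 2 = sqnorm z / (4 * T).
  rewrite /y expr_div_n enorm_sqr exprMn sqr_sqrtr// expr2.
  by rewrite (_ : 2 * 2 = 4 :> R)// -natrM.
have -> : enorm z = 2 * Num.sqrt T * y by rewrite /y; field; rewrite gt_eqF.
apply: ler_wpM2l; first by rewrite mulr_ge0 ?ltW.
rewrite -yE; apply: le_trans (expR_ge1Dx _).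
by have := sqr_ge0 (y - 1); have := sqr_ge0 y; nra.
Qed.

Let mdiff k : Cmeas (fun x : Cn * Cn => (x.2 - x.1) 0 k).
Proof.
under eq_fun do rewrite !mxE.
apply: CmeasB; first exact: Cmeas_comp measurable_snd (@Cmeas_coord R n k).
exact: Cmeas_comp measurable_fst (@Cmeas_coord R n k).
Qed.

(* R_k in the notation of the header *)
Definition conj_shift k F : Cn -> R[i] :=
  kernel_op t (fun x : Cn * Cn => ((x.2 - x.1) 0 k)^*) F.

Let mconj k : Cmeas (fun x : Cn * Cn => ((x.2 - x.1) 0 k)^*).
Proof. by apply: CmeasJ; exact: mdiff. Qed.

Let s0 : 0 <= 2 * Num.sqrt T. Proof. by rewrite mulr_ge0 ?sqrtr_ge0. Qed.

Let conj_le k z w : normc (((w - z) 0 k)^*) <=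
  2 * Num.sqrt T * expR (sqnorm (w - z) / (4 * T)).
Proof. by rewrite normcJ (le_trans (normc_coord _ _))// enorm_weight. Qed.

Lemma conj_shift_L2le k F c : L2le t F c ->
  L2le t (conj_shift k F) (2 * Num.sqrt T * (A * c)).
Proof. exact: kernel_op_L2le (mconj k) s0 (conj_le k) _ _. Qed.

Lemma conj_shift_sqint k F : sqint t F -> sqint t (conj_shift k F).
Proof. by move=> [c hF]; exists (2 * Num.sqrt T * (A * c)); exact: conj_shift_L2le. Qed.

Lemma conj_shift_comm C phi k F c : bounded_lipschitz C phi -> L2le t F c ->
  L2le t (fun z => phi z * conj_shift k F z - conj_shift k (fun w => phi w * F w) z)
    (4 * C * T * (A * c)).
Proof.
move=> hphi hF; have C0 := bounded_lipschitz_ge0 hphi; have mphi := bounded_lipschitz_Cmeas hphi.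
(* The difference of values of [phi] contributes a second factor |w - z| to the symbol, hence t in
   place of sqrt t. *)
pose m (x : Cn * Cn) := (phi x.1 - phi x.2) * ((x.2 - x.1) 0 k)^*.
have mm : Cmeas m.
  rewrite /m; apply: CmeasM; last exact: mconj.
  apply: CmeasB; first exact: Cmeas_comp measurable_fst mphi.
  exact: Cmeas_comp measurable_snd mphi.
have M0 : 0 <= 4 * C * T by rewrite !mulr_ge0.
have hm z w : normc (m (z, w)) <= 4 * C * T * expR (sqnorm (w - z) / (4 * T)).
  rewrite /m Normc.normcM normcJ /= -[phi z - _]opprB normcN.
  apply: (@le_trans _ _ (C * enorm (w - z) * enorm (w - z))).
    by rewrite ler_pM ?normc_ge0// ?normc_coord//; case: hphi.
  rewrite -mulrA -expr2 enorm_sqr.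
  rewrite (_ : 4 * C * T * _ = C * (4 * T * expR (sqnorm (w - z) / (4 * T)))); last by ring.
  by rewrite ler_wpM2l// sqnorm_weight.
have := kernel_op_L2le mm M0 hm hF.
rewrite (_ : kernel_op t m F = fun z => phi z * conj_shift k F z -
  conj_shift k (fun w => phi w * F w) z)//.
apply/funext => z; rewrite /conj_shift /kernel_op -CintZ; last first.
  exact: (kernel_op_Cibl (mconj k) s0 (conj_le k) z hF).
rewrite -CintB.
- by apply: eq_Cint => w; rewrite /m /=; ring.
- by apply: CiblZ; exact: (kernel_op_Cibl (mconj k) s0 (conj_le k) z hF).
- exact: (kernel_op_Cibl (mconj k) s0 (conj_le k) z (bounded_lipschitz_L2le hphi hF)).
Qed.

(* Q_g h in the notation of the header *)
Definition defect g h : Cn -> R[i] :=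
  fun z => bergman t (fun w => g w * h w) z - g z * h z.

(* The holomorphic part of the Taylor expansion of [g] reproduces to [0]. *)
Lemma defect_expansion C g a b h c : first_order C g a b -> L2le t h c -> line_holo h ->
  L2le t (fun z => defect g h z - \sum_j b j z * conj_shift j h z) (4 * C * T * (A * c)).
Proof.
move=> [hg hab ht] hh lh; have nh := L2le_nice hh.
have C0 := bounded_lipschitz_ge0 hg; have mg := bounded_lipschitz_Cmeas hg.
have ma j : Cmeas (a j) by have [/bounded_lipschitz_Cmeas] := hab j.
have mb j : Cmeas (b j) by have [_ /bounded_lipschitz_Cmeas] := hab j.
(* The expansion is taken at z, the outer variable, so that its coefficients come out of the
   integral in w. *)
pose m (x : Cn * Cn) := g x.2 - g x.1 -
  \sum_j (a j x.1 * (x.2 - x.1) 0 j + b j x.1 * ((x.2 - x.1) 0 j)^*).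
have mm : Cmeas m.
  rewrite /m; apply: CmeasB.
    apply: CmeasB; first exact: Cmeas_comp measurable_snd mg.
    exact: Cmeas_comp measurable_fst mg.
  apply: Cmeas_sum => j; apply: CmeasD.
    by apply: CmeasM; [exact: Cmeas_comp measurable_fst (ma j)|exact: mdiff].
  by apply: CmeasM; [exact: Cmeas_comp measurable_fst (mb j)|exact: mconj].
have M0 : 0 <= 4 * C * T by rewrite !mulr_ge0.
have hm z w : normc (m (z, w)) <= 4 * C * T * expR (sqnorm (w - z) / (4 * T)).
  apply: le_trans (ht w z) _; rewrite enorm_sqr.
  rewrite (_ : 4 * C * T * _ = C * (4 * T * expR (sqnorm (w - z) / (4 * T)))); last by ring.
  by rewrite ler_wpM2l// sqnorm_weight.
have := kernel_op_L2le mm M0 hm hh.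
rewrite (_ : kernel_op t m h = fun z => defect g h z - \sum_j b j z * conj_shift j h z)//.
apply/funext => z; have nK := nice_fockK z nh.
have iK := nice_Cibl nK.
have ig : Cibl mu (fun w => g w * (fockK t z w * h w)).
  by apply: nice_Cibl; apply: (nice_bounded nK mg); case: hg.
have ic j : Cibl mu (fun w => (w - z) 0 j * (fockK t z w * h w)).
  have := nice_Cibl (nice_coord (z 0 j) j nK).
  rewrite (_ : (fun w => (w - z) 0 j * _) = (fun w => (w 0 j - z 0 j) * (fockK t z w * h w)))//.
  by apply/funext => w; rewrite !mxE.
have icJ j : Cibl mu (fun w => ((w - z) 0 j)^* * (fockK t z w * h w)).
  exact: (kernel_op_Cibl (mconj j) s0 (conj_le j) z hh).
have c0 j : Cint mu (fun w => (w - z) 0 j * (fockK t z w * h w)) = 0.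
  rewrite -[RHS](reproducing_coord z j nh lh); apply: eq_Cint => w.
  by rewrite !mxE; ring.
transitivity (Cint mu (fun w => g w * (fockK t z w * h w) - g z * (fockK t z w * h w) -
    \sum_j (a j z * ((w - z) 0 j * (fockK t z w * h w)) +
            b j z * (((w - z) 0 j)^* * (fockK t z w * h w))))).
  apply: eq_Cint => w; rewrite /m [fst _]/= [snd _]/= mulrBl mulrBl mulr_suml.
  by congr (_ - _); apply: eq_bigr => j _; rewrite mulrDl !mulrA.
have iab j : Cibl mu (fun w => a j z * ((w - z) 0 j * (fockK t z w * h w)) +
    b j z * (((w - z) 0 j)^* * (fockK t z w * h w))).
  by apply: CiblD; apply: CiblZ.
rewrite CintB; last 2 first.
- by apply: CiblB => //; exact: CiblZ.
- exact: Cibl_sum.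
rewrite CintB//; last exact: CiblZ.
rewrite CintZ// Cint_sum//; congr (_ - _ - _).
- by apply: eq_Cint => w; rewrite mulrCA.
- by congr (_ * _); rewrite -[h in RHS](bergman_id nh lh).
apply: eq_bigr => j _; rewrite CintD; [|exact: CiblZ|exact: CiblZ].
by rewrite !CintZ// c0 mulr0 add0r.
Qed.

Lemma conj_shift_coord h j z : nice t h ->
  conj_shift j h z = bergman t (fun u => (u 0 j - 0)^* * h u) z - (z 0 j)^* * bergman t h z.
Proof.
move=> nh; have nK := nice_fockK z nh; have nJ := nice_coordJ 0 j nh.
rewrite /bergman -CintZ; last exact: nice_Cibl.
rewrite -CintB.
- by apply: eq_Cint => w; rewrite /= !mxE subr0 !num_conjE rmorphB /=; ring.
- by apply: nice_Cibl; exact: nice_fockK.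
- by apply: CiblZ; exact: nice_Cibl.
Qed.

(** The adjoint of R_k has the symbol w_k - u_k, holomorphic in the integration variable u. Applied
    to R_j h = D - conj(u_j) h, it annihilates the entire function D, and the other term yields the
    second moment. The identity is exact, and F is any square integrable function, such as a
    multiplier times a Fock function. *)
Lemma conj_shift_inner F h k j : sqint t F -> fock t h ->
  inner t (conj_shift k F) (conj_shift j h) = (if k == j then T%:C else 0) * inner t F h.
Proof.
move=> [c hF] fh; have [b hh] := fock_L2le fh.
have nh := fock_nice fh; have lh := fock_line_holo fh.
pose H := conj_shift j h; have hH := conj_shift_L2le j hh.
pose D := bergman t (fun u => (u 0 j - 0)^* * h u).
have HE z : H z = D z - (z 0 j)^* * h z.
  by rewrite /H conj_shift_coord// [bergman t h]fock_bergman.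
have nJ := nice_coordJ 0 j nh.
have lD : line_holo D by apply: entire_line_holo; exact: bergman_entire.
(* D is the Bergman integral of a function not known to be square integrable, so Schur's test does
   not apply to it. Instead D is recovered as R_j h plus conj(z_j) h. *)
have nD : nice t D.
  have := niceD (L2le_nice hH) nJ.
  by under eq_fun do rewrite -/(H _) HE subr0 subrK.
rewrite {1}/inner (kernel_op_adjoint (mconj k) s0 (conj_le k) hF hH) /inner -CintZ; last first.
  exact: L2le_Cibl hF hh.
apply: eq_Cint => w; rewrite mulrCA; congr (_ * _).
rewrite (_ : kernel_op _ _ _ w = (if k == j then T%:C else 0) * h w).
  by case: ifP => _; rewrite !num_conjE conjcM ?conjc_real ?conjc0.
rewrite -[LHS]/(Cint mu _).
have nK G : nice t G -> nice t (fun u => fockK t w u * G u) := @nice_fockK _ _ _ G w.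
have i1 := nice_Cibl (nice_coord (w 0 k) k (nK _ nD)).
have i2 := nice_Cibl (nice_coord (w 0 k) k (nice_coordJ (w 0 j) j (nK _ nh))).
have i3 := nice_Cibl (nice_coord (w 0 k) k (nK _ nh)).
(* Here conj(u_j) is split into conj(u_j - w_j), which gives the second moment, and conj(w_j),
   constant in u, whose term reproduces to 0. *)
transitivity (- Cint mu (fun u => (u 0 k - w 0 k) * (fockK t w u * D u)) +
   (Cint mu (fun u => (u 0 k - w 0 k) * ((u 0 j - w 0 j)^* * (fockK t w u * h u))) +
    (w 0 j)^* * Cint mu (fun u => (u 0 k - w 0 k) * (fockK t w u * h u)))).
  rewrite -CintN// -CintZ// -CintD//; last exact: CiblZ.
  rewrite -CintD//; [|exact: CiblN|by apply: CiblD => //; exact: CiblZ].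
  apply: eq_Cint => u; rewrite /= -/(H u) HE !mxE !num_conjE conjcK rmorphB /=; ring.
have e1 : Cint mu (fun u => (u 0 k - w 0 k) * (fockK t w u * D u)) = 0.
  rewrite -[RHS](reproducing_coord w k nD lD); apply: eq_Cint => u; ring.
have e3 : Cint mu (fun u => (u 0 k - w 0 k) * (fockK t w u * h u)) = 0.
  rewrite -[RHS](reproducing_coord w k nh lh); apply: eq_Cint => u; ring.
rewrite e1 e3 oppr0 mulr0 add0r addr0 mulrC -(reproducing_moment2 w k j nh lh).
by apply: eq_Cint => u; ring.
Qed.

End KernelExpansion.

Section Commutator.
Context (R : realType) (n : nat) (t : {posnum R}).
Local Notation Cn := ('rV[R[i]]_n).
Local Notation T := (t%:num : R).
Local Notation A := (4 ^+ n : R).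
Local Notation s := (Num.sqrt T).
Implicit Types (f g h k F G : Cn -> R[i]) (a b : 'I_n -> Cn -> R[i]) (c C : R).

Lemma first_order_weaken C D f a b : C <= D -> first_order C f a b -> first_order D f a b.
Proof.
move=> CD [hf hab ht]; split; first exact: bounded_lipschitz_weaken CD hf.
  by move=> j; have [ha hb] := hab j; split; exact: bounded_lipschitz_weaken CD _.
by move=> u w; apply: le_trans (ht u w) _; rewrite ler_wpM2r ?sqr_ge0.
Qed.

Lemma bounded_lipschitzM C f g : bounded_lipschitz C f -> bounded_lipschitz C g ->
  bounded_lipschitz (2 * C ^+ 2) (fun z => f z * g z).
Proof.
move=> hf hg; have C0 := bounded_lipschitz_ge0 hf; have [f1 f2] := hf; have [g1 g2] := hg.
split=> [z|z w].
  rewrite Normc.normcM; apply: (@le_trans _ _ (C * C)).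
    by apply: ler_pM; rewrite ?normc_ge0.
  by rewrite -expr2 mulr_natl mulr2n lerDl sqr_ge0.
rewrite (_ : f z * g z - f w * g w = f z * (g z - g w) + (f z - f w) * g w); last by ring.
apply: le_trans (le_normcD _ _) _; rewrite !Normc.normcM.
rewrite (_ : 2 * C ^+ 2 * enorm (z - w) = C * (C * enorm (z - w)) + (C * enorm (z - w)) * C); last by ring.
by rewrite lerD// ler_pM ?normc_ge0.
Qed.

Lemma defect_sqint C g h : bounded_lipschitz C g -> sqint t h -> sqint t (defect t g h).
Proof.
move=> hg hh; apply: sqintB; last exact: bounded_lipschitz_sqint hg hh.
by apply: sqint_bergman; exact: bounded_lipschitz_sqint hg hh.
Qed.

(* [defect g h] is orthogonal to the Fock space, and [f^* k] differs from a
   function of the Fock space by [defect f^* k]. *)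
Lemma inner_defect C f g h k : bounded_lipschitz C f -> bounded_lipschitz C g ->
  sqint t h -> fock t k ->
  inner t (fun w => f w * defect t g h w) k =
  - inner t (defect t g h) (defect t (fun z => (f z)^*) k).
Proof.
move=> hf hg hh fk; have hk := fock_sqint fk; have hfJ := bounded_lipschitzJ hf.
have hQ := defect_sqint hg hh; have hgh := bounded_lipschitz_sqint hg hh.
have hfk := bounded_lipschitz_sqint hfJ hk.
rewrite inner_mull (innerBr hQ (sqint_bergman hfk) hfk) -inner_bergman//.
have -> : bergman t (defect t g h) = fun=> 0.
  have [d1 h1] := sqint_bergman hgh; have [d2 h2] := hgh.
  rewrite /defect (bergmanB h1 h2) (fock_bergman (bergman_fock h2)).
  by apply/funext => z; rewrite subrr.
have -> : inner t (fun=> 0) (fun w => (f w)^* * k w) = 0.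
  by rewrite /inner; under eq_Cint do rewrite mul0r; exact: Cint0.
by rewrite sub0r opprK.
Qed.

(** The multiplier is first moved inside R_i, after which the pairing is exact. The 8 is the 4 of
    [conj_shift_comm] times the 2 of [conj_shift_L2le]. *)
Lemma conj_shift_pairing C phi h k i j c d : bounded_lipschitz C phi ->
  L2le t h c -> fock t k -> L2le t k d ->
  normc (inner t (fun z => phi z * conj_shift t i h z) (conj_shift t j k) -
    (if i == j then T%:C else 0) * inner t (fun z => phi z * h z) k) <=
  8 * C * A ^+ 2 * (T * s) * (c * d).
Proof.
move=> hphi hh fk hk; have sh : sqint t h by exists c.
have sph := bounded_lipschitz_sqint hphi sh; have sk : sqint t k by exists d.
rewrite -(conj_shift_inner i j sph fk) -innerBl.
- apply: le_trans (inner_le (conj_shift_comm i hphi hh) (conj_shift_L2le j hk)) _.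
  by rewrite le_eqVlt; apply/orP; left; apply/eqP; ring.
- exact: bounded_lipschitz_sqint hphi (conj_shift_sqint i sh).
- exact: conj_shift_sqint.
- exact: conj_shift_sqint.
Qed.

(** The summand 16 n collects the two cross terms between leading part and remainder, 16 the product
    of the remainders, and 16 n^2 the n^2 pairs of [conj_shift_pairing], whose multiplier has
    constant 2 C^2. *)
Definition defect_constant C : R := C ^+ 2 * A ^+ 2 * (16 * n%:R + 16 + 16 * n%:R ^+ 2).

Lemma defect_constant_ge0 C : 0 <= defect_constant C.
Proof.
have n0 : 0 <= n%:R :> R by rewrite ler0n.
apply: mulr_ge0; first by rewrite mulr_ge0 ?sqr_ge0.
by rewrite !addr_ge0 ?mulr_ge0 ?sqr_ge0.
Qed.

Lemma defect_pairing C f a b g a' b' h k c d : T <= 1 ->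
  first_order C f a b -> first_order C g a' b' ->
  fock t h -> L2le t h c -> fock t k -> L2le t k d ->
  normc (inner t (fun w => f w * defect t g h w) k +
    T%:C * \sum_j inner t (fun w => (a j w * b' j w) * h w) k) <=
  defect_constant C * (T * s) * (c * d).
Proof.
move=> T1 hf hg fh hh fk hk.
have [lf lab _] := hf; have [lg lab' _] := hg; have C0 := bounded_lipschitz_ge0 lf.
have s0 : 0 <= s := sqrtr_ge0 _; have s2 : s ^+ 2 = T by rewrite sqr_sqrtr.
have s1 : s <= 1 by rewrite -sqrtr1 ler_sqrt.
have [_ c0 _] := hh; have [_ d0 _] := hk.
have sh : sqint t h by exists c. have sk : sqint t k by exists d.
pose X z := \sum_i b' i z * conj_shift t i h z.
pose Y z := \sum_j (a j z)^* * conj_shift t j k z.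
have la j : bounded_lipschitz C (fun z => (a j z)^*).
  by apply: bounded_lipschitzJ; case: (lab j).
have lb j : bounded_lipschitz C (b' j) by case: (lab' j).
have hX : L2le t X (\sum_(i < n) C * (2 * s * (A * c))).
  by apply: L2le_sum => i; apply: bounded_lipschitz_L2le => //; exact: conj_shift_L2le.
have hY : L2le t Y (\sum_(i < n) C * (2 * s * (A * d))).
  apply: L2le_sum => j; apply: bounded_lipschitz_L2le; first exact: la.
  exact: conj_shift_L2le.
have sX : sqint t X by exists (\sum_(i < n) C * (2 * s * (A * c))).
have sY : sqint t Y by exists (\sum_(i < n) C * (2 * s * (A * d))).
have hQ := defect_expansion hg hh (fock_line_holo fh).
have hQ' := defect_expansion (first_orderJ hf) hk (fock_line_holo fk).
have sQ := defect_sqint lg sh.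
have sQ' := defect_sqint (bounded_lipschitzJ lf) sk.
rewrite (inner_defect lf lg sh fk).
set Q := defect t g h in sQ hQ *; set Q' := defect t _ k in sQ' hQ' *.
(* X and Y are the leading parts, of order sqrt t, and the differences are of order t. So only the
   pairing of X with Y can be of order t. *)
have e1 : inner t Q Q' = inner t X Y + inner t (fun z => Q z - X z) Y +
   inner t X (fun z => Q' z - Y z) + inner t (fun z => Q z - X z) (fun z => Q' z - Y z).
  have sQX := sqintB sQ sX.
  rewrite (innerBr sQX sQ' sY) (innerBr sX sQ' sY) !(innerBl sQ sX)//; ring.
pose I i j := inner t (fun z => (a j z * b' i z) * h z) k.
pose J i j := inner t (fun z => (a j z * b' i z) * conj_shift t i h z) (conj_shift t j k).
have e2 : inner t X Y = \sum_i \sum_j J i j.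
  have sRh i : sqint t (fun z => b' i z * conj_shift t i h z).
    exact: bounded_lipschitz_sqint (lb i) (conj_shift_sqint i sh).
  have sRk j : sqint t (fun z => (a j z)^* * conj_shift t j k z).
    exact: bounded_lipschitz_sqint (la j) (conj_shift_sqint j sk).
  rewrite (inner_suml _ sRh sY); apply: eq_bigr => i _.
  rewrite (inner_sumr _ (sRh i) sRk); apply: eq_bigr => j _.
  rewrite /J -inner_mull; apply: eq_inner => // z; by rewrite mulrA.
have e3 : T%:C * \sum_j I j j = \sum_i \sum_j (if i == j then T%:C else 0) * I i j.
  rewrite mulr_sumr; apply: eq_bigr => i _.
  rewrite (bigD1 i)//= eqxx big1 ?addr0// => j /negPf ji.
  by rewrite eq_sym ji mul0r.
rewrite -[\sum_j inner _ _ _]/(\sum_j I j j) e1 e2 e3.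
have -> : - (\sum_i \sum_j J i j + inner t (fun z => Q z - X z) Y +
   inner t X (fun z => Q' z - Y z) + inner t (fun z => Q z - X z) (fun z => Q' z - Y z)) +
   \sum_i \sum_j (if i == j then T%:C else 0) * I i j =
   - (\sum_i \sum_j (J i j - (if i == j then T%:C else 0) * I i j) +
     (inner t (fun z => Q z - X z) Y + inner t X (fun z => Q' z - Y z) +
      inner t (fun z => Q z - X z) (fun z => Q' z - Y z))).
  under [in RHS]eq_bigr do rewrite sumrB.
  by rewrite sumrB; ring.
rewrite normcN.
have b1 : normc (\sum_i \sum_j (J i j - (if i == j then T%:C else 0) * I i j)) <=
    n%:R ^+ 2 * (8 * (2 * C ^+ 2) * A ^+ 2 * (T * s) * (c * d)).
  have -> : n%:R ^+ 2 * (8 * (2 * C ^+ 2) * A ^+ 2 * (T * s) * (c * d)) =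
     \sum_(i < n) \sum_(j < n) (8 * (2 * C ^+ 2) * A ^+ 2 * (T * s) * (c * d)) :> R.
    by rewrite !sumr_const !card_ord -mulrnA -[RHS]mulr_natl natrM expr2.
  apply: le_trans (le_normc_sum _ _ _) _; apply: ler_sum => i _.
  apply: le_trans (le_normc_sum _ _ _) _; apply: ler_sum => j _.
  apply: (@conj_shift_pairing (2 * C ^+ 2)) => //.
  by apply: bounded_lipschitzM => //; case: (lab j).
have b2 := inner_le hQ hY; have b3 := inner_le hX hQ'; have b4 := inner_le hQ hQ'.
have sumE (x : R) : \sum_(i < n) x = n%:R * x by rewrite sumr_const card_ord mulr_natl.
rewrite sumE in b2; rewrite sumE in b3.
apply: le_trans (le_normcD _ _) _.
apply: le_trans (lerD b1 (le_trans (le_normcD _ _) (lerD (le_trans (le_normcD _ _) (lerD b2 b3)) b4))) _.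
rewrite /defect_constant.
(* The product of the two remainders is of order t^2, which is absorbed in t^{3/2} because t <=
   1. *)
have TT : T * T <= T * s.
  by rewrite ler_wpM2l// -{1}s2 expr2 ler_piMl.
have p : 0 <= C ^+ 2 * A ^+ 2 * (c * d).
  by rewrite !mulr_ge0 ?sqr_ge0.
have := ler_wpM2l p TT; set S := s; lra.
Qed.

Lemma commutator_estimate C f a b g a' b' h c : T <= 1 ->
  first_order C f a b -> first_order C g a' b' -> fock t h -> L2le t h c ->
  let p z := 'i * \sum_j (a j z * b' j z - b j z * a' j z) in
  L2le t (fun z => commutator (toeplitz t f) (toeplitz t g) h z -
      'i * T%:C * toeplitz t p h z)
    (2 * defect_constant C * (T * s) * c).
Proof.
move=> T1 hf hg fh hh p; have sh : sqint t h by exists c.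
have [lf lab _] := hf; have [lg lab' _] := hg; have C0 := bounded_lipschitz_ge0 lf.
have [_ c0 _] := hh.
have sf F : sqint t F -> sqint t (fun w => f w * F w) := bounded_lipschitz_sqint lf.
have sg F : sqint t F -> sqint t (fun w => g w * F w) := bounded_lipschitz_sqint lg.
have sab j : sqint t (fun w => (a j w * b' j w) * h w).
  apply: bounded_lipschitz_sqint sh.
  exact: bounded_lipschitzM (lab j).1 (lab' j).2.
have sba j : sqint t (fun w => (a' j w * b j w) * h w).
  apply: bounded_lipschitz_sqint sh.
  exact: bounded_lipschitzM (lab' j).1 (lab j).2.
have pE w : p w * h w = 'i * \sum_j ((a j w * b' j w) * h w - (a' j w * b j w) * h w).
  rewrite /p -mulrA mulr_suml; congr (_ * _); apply: eq_bigr => j _; ring.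
have sp : sqint t (fun w => p w * h w).
  under eq_fun do rewrite pE.
  by apply: sqintZ; apply: sqint_sum => j; exact: sqintB.
have tE F G : sqint t (fun w => F w * G w) ->
    toeplitz t F G = bergman t (fun w => F w * G w).
  by move=> [e he]; exact: fock_projE he.
have sBf := sqint_bergman (sf _ sh); have sBg := sqint_bergman (sg _ sh).
have sQf := defect_sqint lf sh; have sQg := defect_sqint lg sh.
(* Replacing the projections of g h and f h by defects changes nothing: the added terms f g h and g
   f h cancel. *)
pose U w := f w * defect t g h w - g w * defect t f h w - ('i * T%:C) * (p w * h w).
have sU : sqint t U by apply: sqintB; [apply: sqintB; [exact: sf|exact: sg]|exact: sqintZ].
pose D z := commutator (toeplitz t f) (toeplitz t g) h z - 'i * T%:C * toeplitz t p h z.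
have DE : D = bergman t U.
  have UE : U = fun w => f w * bergman t (fun w => g w * h w) w -
      g w * bergman t (fun w => f w * h w) w - ('i * T%:C) * (p w * h w).
    by apply/funext => w; rewrite /U /defect; ring.
  have [d1 h1] := sf _ sBg; have [d2 h2] := sg _ sBf; have [d3 h3] := sp.
  rewrite UE (bergmanB (L2leB h1 h2) (L2leZ ('i * T%:C) h3)) (bergmanB h1 h2) (bergmanZ _ h3).
  apply/funext => z; rewrite /D /commutator.
  rewrite (tE g h (sg _ sh)) (tE f h (sf _ sh)) (tE p h sp).
  by rewrite (tE f _ (sf _ sBg)) (tE g _ (sg _ sBf)).
have [u hU] := sU.
have fD : fock t D by rewrite DE; exact: bergman_fock hU.
rewrite -/D; apply: L2le_self.
- exact: fock_sqint.
- move=> d hD.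
  have -> : inner t D D = inner t U D.
    by rewrite {1}DE inner_bergman//; [rewrite fock_bergman|exact: fock_sqint].
  have sD := fock_sqint fD.
  have I1 := defect_pairing T1 hf hg fh hh fD hD.
  have I2 := defect_pairing T1 hg hf fh hh fD hD.
  (* The i of the Poisson bracket and the i in front of t multiply to -1, so the bracket term
     becomes t times the difference of the two sums, exactly the corrections in [I1] and [I2]. *)
  have -> : inner t U D =
     (inner t (fun w => f w * defect t g h w) D +
       T%:C * \sum_j inner t (fun w => (a j w * b' j w) * h w) D) -
     (inner t (fun w => g w * defect t f h w) D +
       T%:C * \sum_j inner t (fun w => (a' j w * b j w) * h w) D).
    rewrite /U innerBl//; last 2 first.
    - by apply: sqintB; [exact: sf|exact: sg].
    - exact: sqintZ.
    rewrite innerBl//; [|exact: sf|exact: sg].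
    rewrite innerZl// (eq_inner t (F' := fun w => 'i *
      \sum_j ((a j w * b' j w) * h w - (a' j w * b j w) * h w)) pE (fun _ => erefl)).
    rewrite innerZl//; last by apply: sqint_sum => j; exact: sqintB.
    rewrite inner_suml//; last by move=> j; exact: sqintB.
    under eq_bigr do rewrite innerBl//.
    rewrite sumrB; move: (inner _ _ _) (inner _ _ _) (\sum_j _) (\sum_j _) => y x S2 S1.
    have i2 : 'i * 'i = -1 :> R[i] by rewrite -expr2 sqr_i.
    transitivity (x - y - ('i * 'i) * (T%:C * (S1 - S2))); first by ring.
    by rewrite i2; ring.
  apply: le_trans (le_normcB _ _) _; apply: le_trans (lerD I1 I2) _.
  by rewrite le_eqVlt; apply/orP; left; apply/eqP; ring.
by rewrite !mulr_ge0 ?sqrtr_ge0 ?defect_constant_ge0.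
Qed.

End Commutator.

Theorem corollary2 (R : realType) (n : nat) (hn : (1 <= n)%N)
    (f g : 'rV[R[i]]_n -> R[i]) (hf : C2buc f) (hg : C2buc g) :
  forall eps : R, 0 < eps ->
  exists2 delta : R, 0 < delta &
    forall t : {posnum R}, t%:num < delta ->
      let D := fun h z =>
        commutator (toeplitz t f) (toeplitz t g) h z
        - 'i * (t%:num)%:C * toeplitz t (poisson f g) h z in
      (opnorm t D <= (eps * t%:num)%:E)%E.
Proof.
move=> eps eps0.
have [C1 hC1] := C2buc_first_order hf; have [C2 hC2] := C2buc_first_order hg.
pose C := Num.max C1 C2.
have h1 : first_order C f (fun j => wirtinger j f) (fun j => wirtinger_bar j f).
  by apply: first_order_weaken hC1; rewrite le_max lexx.
have h2 : first_order C g (fun j => wirtinger j g) (fun j => wirtinger_bar j g).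
  by apply: first_order_weaken hC2; rewrite le_max lexx orbT.
(* The 1 makes [K] positive, so that dividing by it is allowed. *)
pose K := 2 * defect_constant n C + 1.
have K0 : 0 < K by rewrite ltr_wpDl// mulr_ge0 ?defect_constant_ge0.
(* The estimate is K t sqrt t at most: t < 1 is what it requires, and t < (eps / K)^2 makes K sqrt t
   at most eps. *)
exists (Num.min 1 ((eps / K) ^+ 2)); first by rewrite lt_min ltr01 exprn_gt0 ?divr_gt0.
move=> t tlt /=; move: tlt; rewrite lt_min => /andP[/ltW t1 te].
apply: ge_ereal_sup => _ [h [fh nh] <-].
have mh : Cmeas h by case: fh => _ [].
have hh : L2le t h 1 by apply/L2norm_le.
have hD := commutator_estimate t1 h1 h2 fh hh.
have [mD _ _] := hD; apply/L2norm_le => //; first by rewrite mulr_ge0 ?ltW.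
apply: L2le_weaken hD; rewrite mulr1.
have s0 : 0 <= Num.sqrt (t%:num : R) := sqrtr_ge0 _.
have sK : Num.sqrt (t%:num : R) * K <= eps.
  rewrite -ler_pdivlMr// -[leRHS]ger0_norm; last by apply: ltW; rewrite divr_gt0.
  by rewrite -sqrtr_sqr ler_sqrt ?sqr_ge0//; exact: ltW.
rewrite [leLHS](_ : _ = t%:num * (Num.sqrt (t%:num : R) * (2 * defect_constant n C))); last by ring.
rewrite [leRHS]mulrC ler_wpM2l// (le_trans _ sK)// ler_wpM2l//.
by rewrite /K lerDl.
Qed.
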